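(* Let $\varphi$ be an Orlicz function and $w$ a decreasing positive weight function on $I=(0,a)$, $0<a\le\infty$, such that $W(t)=\int_0^t w\,dm<\infty$ for all $t\in I$. Then for $f\in\mathcal M_{\varphi,w}$, $$\mathrm Q(f)=\mathrm M(f^0)=\mathrm M_{w^f}(f)\ge\mathrm P(f),$$ and $$\|f\|_{\mathcal M_{\varphi,w}}=\|f\|_{\mathrm P}=\|f\|_{\mathrm Q},\qquad \|f\|^0_{\mathcal M_{\varphi,w}}=\|f\|^0_{\mathrm P}=\|f\|^0_{\mathrm Q}.$$ If in addition $\varphi$ is an $N$-function, that is $\lim_{s\to0}\varphi(s)/s=0$ and $\lim_{s\to\infty}\varphi(s)/s=\infty$, and either $I$ is finite or $W(\infty)=\int_0^\infty w\,dm=\infty$, then $$\mathrm P(f)=\mathrm M(f^0)=\mathrm Q(f).$$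
   Context: $m$ is Lebesgue measure; functions are identified when equal a.e.; ''decreasing'' means non-increasing. $L^0(I)$ is the space of real Lebesgue measurable functions on $I$. $f^*$ is the decreasing rearrangement of $f\in L^0(I)$ with respect to $m$. $f\prec g$ means $\int_0^x f^*\,dm\le\int_0^x g^*\,dm$ for all $x\in I$. An Orlicz function is a convex $\varphi:[0,\infty)\to[0,\infty)$ with $\varphi(0)=0$ and $\varphi>0$ on $(0,\infty)$. For a positive decreasing weight $v$ on $I$ and $f\in L^0(I)$, $\mathrm M_v(f)=\int_I\varphi\left(\frac{f^*}{v}\right)v\,dm\in[0,\infty]$, and $\mathrm M=\mathrm M_w$. $M_{L_\varphi,v}$ is the class of $f$ with $\mathrm M_v(\lambda f)<\infty$ for some $\lambda>0$. For $f\in L^0(I)$: $\mathrm P(f)=\inf\{\mathrm M_v(f): v\prec w,\ v>0,\ v\text{ decreasing}\}$ and $\mathrm Q(f)=\inf\{\mathrm M(g): f\prec g,\ g\in M_{L_\varphi,w}\}$. For a functional $\rho:L^0(I)\to[0,\infty]$, $\|f\|_\rho=\inf\{\lambda>0:\rho(f/\lambda)\le1\}$ (Luxemburg) and $\|f\|_\rho^0=\inf_{t>0}t(1+\rho(f/t))$ (Orlicz/Amemiya). $Q_{L_\varphi,w}$ is the set of $f\in L^0(I)$ with $f\prec g$ for some $g\in M_{L_\varphi,w}$, and $P_{L_\varphi,w}$ is the union of the classes $M_{L_\varphi,v}$ over positive decreasing $v\prec w$. These sets coincide, and $\mathcal M_{\varphi,w}:=Q_{L_\varphi,w}=P_{L_\varphi,w}$.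 Its two norms (corresponding to the Luxemburg and Orlicz norms on $L_\varphi$) are $\|f\|_{\mathcal M_{\varphi,w}}=\inf\{\|g\|_{\mathrm M}: f\prec g\}=\inf\{\|f\|_{\mathrm M_v}:v\prec w,\ v>0,\ v\text{ decreasing}\}$ and $\|f\|^0_{\mathcal M_{\varphi,w}}=\inf\{\|g\|^0_{\mathrm M}: f\prec g\}=\inf\{\|f\|^0_{\mathrm M_v}:v\prec w,\ v>0,\ v\text{ decreasing}\}$ (it is known that the two expressions agree in each case). Level function (Halperin). For $f\in L^0(I)$ with $f^*$ finite and integrable on the finite intervals $(0,t)$, $t\in I$, and $0\le\alpha<\beta<\infty$, $(\alpha,\beta)\subset I$, put $W(\alpha,\beta)=\int_\alpha^\beta w\,dm$, $F(\alpha,\beta)=\int_\alpha^\beta f^*\,dm$, $R(\alpha,\beta)=F(\alpha,\beta)/W(\alpha,\beta)$, and, if $a=\infty$, $R(\alpha,\infty)=\limsup_{t\to\infty}R(\alpha,t)$. An interval $(\alpha,\beta)\subset I$ ($\beta\le\infty$) is a level interval if $R(\alpha,\beta)>0$ and $R(\alpha,t)\le R(\alpha,\beta)$ for each $t\in(\alpha,\beta)$; it is a maximal level interval if not contained in a larger level interval. Maximal level intervals are pairwise disjoint, hence at most countably many. The level function is $f^0(t)=R(\alpha,\beta)w(t)$ if $t$ belongs to a maximal level interval $(\alpha,\beta)$, and $f^0(t)=f^*(t)$ otherwise. The inverse level function $w^f$ is $w^f(t)=f^*(t)/R(\alpha,\beta)$ if $t$ belongs to a maximal level interval $(\alpha,\beta)$,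 and $w^f(t)=w(t)$ otherwise; it is a positive decreasing weight with $w^f\prec w$. *)

(* Defs.v *)
From HB Require Import structures.
From mathcomp Require Import all_boot all_order all_algebra.
From mathcomp Require Import all_classical all_reals all_analysis.

Set Implicit Arguments.
Unset Strict Implicit.
Unset Printing Implicit Defensive.

Import Order.TTheory GRing.Theory Num.Theory.
Import numFieldNormedType.Exports.

Local Open Scope classical_set_scope.
Local Open Scope ring_scope.
Local Open Scope ereal_scope.

(* Functions on [I] are total functions [R -> R] whose values outside [I] are
   ignored.  Extended-real values are used for everything that may be infinite:
   rearrangements, integrals, modulars and norms; [ereal_inf set0 = +oo]. *)

Section OrliczLorentz.
Context {R : realType}.
Implicit Types (D I : set R) (f g v w phi : R -> R) (a b : R) (c : \bar R).

(* [R] with the sigma-algebra of Lebesgue measurable sets, on which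
   [completed_lebesgue_measure] is a (complete) measure. *)
Definition lebesgueT : measurableType _ :=
  caratheodory_type ((wlength (@idfun R))^*)%mu.

Definition L0 I f : Prop :=
  measurable_fun (I : set lebesgueT) (f : lebesgueT -> R).

Definition oitv a c : set R := [set t | (a < t)%R /\ t%:E < c].

Definition orlicz phi : Prop :=
  [/\ @convex_function R R^o [set s | (0 <= s)%R] phi,
      phi 0%R = 0%R
    & forall s, (0 < s)%R -> (0 < phi s)%R].

Definition N_function phi : Prop :=
  ((phi s / s)%R @[s --> 0%R^'+] --> (0 : R)%R) /\
  ((phi s / s)%R @[s --> +oo%R] --> +oo%R).

Definition decreasing_weight I v : Prop :=
  (forall t, I t -> (0 < v t)%R) /\
  (forall s t, I s -> I t -> (s <= t)%R -> (v t <= v s)%R).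

Definition distribution_fun I f (s : R) : \bar R :=
  completed_lebesgue_measure (I `&` [set x | (s < `|f x|)%R]).

(* Identically [+oo] when all the superlevel sets have infinite measure. *)
Definition rearrangement I f (t : R) : \bar R :=
  ereal_inf [set s%:E | s in [set s | (0 <= s)%R /\ distribution_fun I f s <= t%:E]].

(* The functions integrated below are built from monotone functions and are
   Borel, so the Lebesgue measure on Borel sets is enough for the integrals. *)
Local Notation m := (@lebesgue_measure R).

Definition submajorized I f g : Prop :=
  forall x, I x ->
    \int[m]_(t in oitv 0 x%:E) rearrangement I f t <=
    \int[m]_(t in oitv 0 x%:E) rearrangement I g t.

(* [er_map phi] extends [phi] by [phi +oo = +oo], its limit at infinity. *)
Definition modular phi I v f : \bar R :=
  \int[m]_(t in I) (er_map phi (rearrangement I f t * ((v t)^-1)%:E) * (v t)%:E).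

Definition M_class phi I v f : Prop :=
  L0 I f /\
  exists2 l : R, (0 < l)%R & modular phi I v (fun x => l * f x)%R < +oo.

Definition P_modular phi I w f : \bar R :=
  ereal_inf [set modular phi I v f | v in
    [set v | decreasing_weight I v /\ submajorized I v w]].

Definition Q_modular phi I w f : \bar R :=
  ereal_inf [set modular phi I w g | g in
    [set g | submajorized I f g /\ M_class phi I w g]].

Definition luxemburg (rho : (R -> R) -> \bar R) f : \bar R :=
  ereal_inf [set l%:E | l in
    [set l | (0 < l)%R /\ rho (fun x => f x / l)%R <= 1]].

Definition amemiya (rho : (R -> R) -> \bar R) f : \bar R :=
  ereal_inf [set t%:E * (1 + rho (fun x => f x / t)%R) | t in [set t | (0 < t)%R]].

(* [M_space] and its two norms (Luxemburg, Orlicz) are given by their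
   description through majorants [g] of [f]; it is known that the description
   through weights [v] submajorized by [w] yields the same space and norms. *)
Definition M_space phi I w f : Prop :=
  L0 I f /\ exists2 g, M_class phi I w g & submajorized I f g.

Definition M_norm phi I w f : \bar R :=
  ereal_inf [set luxemburg (modular phi I w) g | g in
    [set g | L0 I g /\ submajorized I f g]].

Definition M_norm0 phi I w f : \bar R :=
  ereal_inf [set amemiya (modular phi I w) g | g in
    [set g | L0 I g /\ submajorized I f g]].

(* The mean of the rearrangement of [f] relative to [w] over (a, b). *)
Definition level_ratio_fin I w f a b : \bar R :=
  (\int[m]_(t in oitv a b%:E) rearrangement I f t) /
  (\int[m]_(t in oitv a b%:E) (w t)%:E).

(* The same over (a, c), as a limsup if [c = +oo]; [c = -oo] is irrelevant. *)
Definition level_ratio I w f a c : \bar R :=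
  if c is b%:E then level_ratio_fin I w f a b
  else limf_esup (level_ratio_fin I w f a) +oo%R.

Definition level_interval I w f a c : Prop :=
  [/\ (0 <= a)%R, a%:E < c, oitv a c `<=` I,
      0 < level_ratio I w f a c
    & forall t, oitv a c t -> level_ratio I w f a t%:E <= level_ratio I w f a c].

Definition maximal_level_interval I w f a c : Prop :=
  level_interval I w f a c /\
  forall a' c', level_interval I w f a' c' ->
    oitv a c `<=` oitv a' c' -> oitv a' c' = oitv a c.

Definition maximal_level_at I w f (t : R) : set (R * \bar R) :=
  [set p | maximal_level_interval I w f p.1 p.2 /\ oitv p.1 p.2 t].

(* [level_ratio] over the maximal level interval (a, c) containing [t], which is
   unique because maximal level intervals are disjoint; meaningless if there
   is none. *)
Definition level_slope I w f t : R :=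
  let p := get (maximal_level_at I w f t) in fine (level_ratio I w f p.1 p.2).

(* For [f] in [M_space] the rearrangement and the level ratios are finite on
   [I], so no information is lost through [fine]. *)
Definition level_fun I w f (t : R) : R :=
  if `[< maximal_level_at I w f t !=set0 >] then (level_slope I w f t * w t)%R
  else fine (rearrangement I f t).

Definition inverse_level_fun I w f (t : R) : R :=
  if `[< maximal_level_at I w f t !=set0 >]
  then (fine (rearrangement I f t) / level_slope I w f t)%R
  else w t.

End OrliczLorentz.

(* Main.v *)
(* Let F and W be the primitives of f^* and w.  Level intervals are read off the
   tilted functions F - u W: the slope of the least concave majorant of F, as a
   function of W, is at t the supremum of the u such that F - u W takes, somewhere
   to the right of t, a value larger than all its values on [0, t] (such t form an
   initial segment, so the slope is decreasing for free).  A maximal level interval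
   around t is made of the first and last maximizers of F - u W for u = slope t,
   hence f^0 = slope * w almost everywhere.

   Maximizers of F - u W on [0, x] for u in a grid cut (0, x) into pieces on which
   F and slope * W are comparable up to the ratio of the grid; refining a geometric
   grid shows that f is submajorized by f^0 and w^f by w.  With an arithmetic grid and the chords of phi it
   gives: if F is at most the primitive of y and the primitive of v is at most W,
   then M(f^0) is at most the integral of phi (y / v) v.  Taking (y, v) = (g^*, w)
   and (f^*, v) yields Q(f) = M(f^0) and M(f^0) <= P(f), so P(f) = M(f^0) = M_{w^f}(f)
   whenever f lies in the space, and the norm identities follow by homogeneity. *)

Require Import Defs.
From HB Require Import structures.
From mathcomp Require Import all_boot all_order all_algebra.
From mathcomp Require Import all_classical all_reals all_analysis.
From mathcomp Require Import measurable_realfun.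
From mathcomp Require Import ring lra.

Import Order.TTheory GRing.Theory Num.Theory.
Import numFieldNormedType.Exports.

Local Open Scope classical_set_scope.
Local Open Scope ring_scope.

(** In the limit of fine grids the lower bound for the modulars is an integration by parts in the
    tilt. Let sigma(u) be the maximum of F - u W and p(u) a maximizer, so that sigma' = - W(p(u)).
    Since phi(s) is the integral of (s - u)^+ against phi'' (a measure, charging 0 if phi'(0+) > 0),
    the integral of phi (slope) w, which is that of phi'(u) W(p(u)) du, equals the integral of sigma
    against phi''; and sigma(u) is at most the integral of (y - u v)^+ over I. Grid sums avoid
    derivatives of phi, and truncation to [0, x] supplies maximizers that may be missing at
    infinity.

    The inequality M_{w^f}(f) <= M(f^0) comes from Hardy's lemma: almost everywhere f^* / w^f is the
    slope, so phi (f^* / w^f) w^f = k f^* with the decreasing function k = phi (slope) / slope, and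
    f is submajorized by f^0.

    As f^* and w may jump, first-order conditions at maximizers are read off chords, and hold
    outside a countable set. *)

(** * Extremal maximizers of continuous functions on a compact interval *)

Lemma within_eps (R : realType) (f : R -> R) (p q x : R) :
  {within `[p, q], continuous f} -> p <= x <= q ->
  forall e, 0 < e -> exists2 d, 0 < d &
    forall y, p <= y <= q -> `|y - x| < d -> `|f y - f x| < e.
Proof.
move=> cf xpq e e0.
have := cf x; rewrite /continuous_at.
move/cvgrPdist_lt => /(_ e e0).
rewrite near_simpl /prop_near1 /nbhs/= -nbhs_subspace_in//.
rewrite /within/= => /nbhs_ballP[d /= d0 hd].
exists d => // y ypq yx.
have := hd y; rewrite /ball/= distrC => /(_ yx).
by rewrite distrC; apply; rewrite in_itv.
Qed.

(** The infimum of the maximizers is one of them: a smaller value there would, by continuity,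
    persist on a neighbourhood, which contains maximizers. Strictness to the left makes the left end
    of a level interval extremal. *)
Lemma first_argmax (R : realType) (f : R -> R) (p q : R) : p <= q ->
  {within `[p, q], continuous f} ->
  exists c, [/\ p <= c <= q, forall t, p <= t <= q -> f t <= f c &
    forall t, p <= t < c -> f t < f c].
Proof.
move=> pq cf; have [m] := EVT_max pq cf; rewrite in_itv/= => mpq hm.
pose A := [set t | p <= t <= q /\ f m <= f t].
have Am : A m by split.
have lA : has_lbound A by exists p => t [/andP[]].
have hA : has_inf A by split; [exists m|].
have cpq : p <= inf A <= q.
  apply/andP; split; first by apply: lb_le_inf; [exists m|move=> t [/andP[]]].
  by case/andP: mpq => _; apply: le_trans; exact: ge_inf.
have fc : f m <= f (inf A).
  rewrite leNgt; apply/negP => lt.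
  have := within_eps _ _ _ _ _ cf cpq (f m - f (inf A)).
  rewrite subr_gt0 => /(_ lt)[d d0 hd].
  have [t At tlt] := inf_adherent d0 hA.
  have [tpq ft] := At.
  have := hd t tpq; rewrite ger0_norm ?subr_ge0 ?ge_inf// ltrBlDl => /(_ tlt).
  by rewrite ltr_norml => /andP[_]; rewrite ltrD2r ltNge ft.
exists (inf A); split => //.
  by move=> t tpq; apply: le_trans fc; apply: hm; rewrite in_itv.
move=> t /andP[pt tc]; rewrite ltNge; apply/negP => ft.
have : A t.
  by split; [rewrite pt (le_trans (ltW tc))//; case/andP: cpq|exact: le_trans ft].
by move/(ge_inf lA); rewrite leNgt tc.
Qed.

Lemma last_argmax (R : realType) (f : R -> R) (p q : R) : p <= q ->
  {within `[p, q], continuous f} ->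
  exists c, [/\ p <= c <= q, forall t, p <= t <= q -> f t <= f c &
    forall t, c < t <= q -> f t < f c].
Proof.
move=> pq cf; have [m] := EVT_max pq cf; rewrite in_itv/= => mpq hm.
pose A := [set t | p <= t <= q /\ f m <= f t].
have Am : A m by split.
have lA : has_ubound A by exists q => t [/andP[]].
have hA : has_sup A by split; [exists m|].
have cpq : p <= sup A <= q.
  apply/andP; split; last by apply: ge_sup; [exists m|move=> t [/andP[]]].
  by case/andP: mpq => + _; move/le_trans; apply; exact: ub_le_sup.
have fc : f m <= f (sup A).
  rewrite leNgt; apply/negP => lt.
  have := within_eps _ _ _ _ _ cf cpq (f m - f (sup A)).
  rewrite subr_gt0 => /(_ lt)[d d0 hd].
  have [t At tlt] := sup_adherent d0 hA.
  have [tpq ft] := At.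
  have := hd t tpq; rewrite ler0_norm ?subr_le0 ?ub_le_sup// opprB ltrBlDr -ltrBlDl => /(_ tlt).
  by rewrite ltr_norml => /andP[_]; rewrite ltrD2r ltNge ft.
exists (sup A); split => //.
  by move=> t tpq; apply: le_trans fc; apply: hm; rewrite in_itv.
move=> t /andP[ct tq]; rewrite ltNge; apply/negP => ft.
have : A t.
  by split; [rewrite tq (le_trans _ (ltW ct))//; case/andP: cpq|exact: le_trans ft].
by move/(ub_le_sup lA); rewrite leNgt ct.
Qed.

(** * Tilted functions and level intervals *)

Section slope.
Context {R : realType} (a : \bar R) (F W : R -> R).

Definition tilt (u s : R) : R := F s - u * W s.

(** For finite [a] the witness [x] may be the right end [a] itself. *)
Definition ascent (u t : R) : Prop :=
  exists x, [/\ t <= x, (x%:E <= a)%E &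
    forall s, 0 <= s <= t -> tilt u s < tilt u x].

(** Adding [u = 0] by hand keeps the set nonempty: where [F] is constant to the right of [t] no
    nonnegative [u] ascends, and the slope is 0. *)
Definition slope (t : R) : R := sup [set u | u = 0 \/ 0 <= u /\ ascent u t].

(* Level intervals, with their ratio [r].  The last clause is
   [limsup_(y -> c-) ratio al y >= r], which by continuity of [F] and [W] treats
   finite and infinite right ends [c] alike. *)
Definition level (al : R) (c : \bar R) (r : R) : Prop :=
  [/\ 0 <= al, (al%:E < c)%E, (c <= a)%E, 0 < r &
    (forall y, al < y -> (y%:E < c)%E -> F y - F al <= r * (W y - W al)) /\
    (forall r' y0, r' < r -> al <= y0 -> (y0%:E < c)%E ->
      exists y, [/\ y0 < y, (y%:E < c)%E & r' * (W y - W al) < F y - F al])].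

Hypothesis cF : forall q : R, 0 <= q -> (q%:E <= a)%E -> {within `[0, q], continuous F}.
Hypothesis cW : forall q : R, 0 <= q -> (q%:E <= a)%E -> {within `[0, q], continuous W}.
Hypothesis F0 : F 0 = 0.
Hypothesis W0 : W 0 = 0.
Hypothesis ndF : forall x y : R, 0 <= x -> x <= y -> (y%:E <= a)%E -> F x <= F y.
Hypothesis incW : forall x y : R, 0 <= x -> x < y -> (y%:E <= a)%E -> W x < W y.
Hypothesis growth : exists C1 C2 : R, [/\ 0 <= C1, 0 <= C2 &
  forall x : R, 0 <= x -> (x%:E <= a)%E -> F x <= C1 * W x + C2].

Lemma ndW x y : 0 <= x -> x <= y -> (y%:E <= a)%E -> W x <= W y.
Proof.
move=> x0; rewrite le_eqVlt => /predU1P[->//|xy] ya.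
exact/ltW/incW.
Qed.

Lemma continuous_tilt u p q : 0 <= p -> p <= q -> (q%:E <= a)%E ->
  {within `[p, q], continuous (tilt u)}.
Proof.
move=> p0 pq qa.
apply: (@continuous_subspaceW _ _ _ `[0, q]).
  by apply: subset_itv; rewrite bnd_simp.
have q0 := le_trans p0 pq.
move=> x; apply: cvgB; first exact: cF.
by apply: cvgM; [exact: cvg_cst|exact: cW].
Qed.

Lemma ascent_antimono u s t : s <= t -> ascent u t -> ascent u s.
Proof.
move=> st [x [tx xa hx]]; exists x; split=> //; first exact: le_trans tx.
by move=> z /andP[z0 zs]; apply: hx; rewrite z0 (le_trans zs).
Qed.

Lemma ascent_le u v t : u <= v -> ascent v t -> ascent u t.
Proof.
move=> uv [x [tx xa hx]]; exists x; split=> // s /andP[s0 st].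
have := hx s; rewrite s0 st => /(_ isT).
have := @ndW s x s0 (le_trans st tx) xa.
by rewrite /tilt; nra.
Qed.

(** Comparing the witness [x] with [s = 0] gives [u W x < F x <= C1 W x + C2], and
    [W x >= W t > 0]. *)
Lemma ascent_bounded t : 0 < t -> (t%:E <= a)%E -> exists B, forall u, ascent u t -> u <= B.
Proof.
move=> t0 ta; have [C1 [C2 [C10 C20 hC]]] := growth.
have Wt : 0 < W t by rewrite -W0 incW.
exists (C1 + C2 / W t) => u [x [tx xa hx]].
have := hx 0; rewrite lexx (ltW t0) => /(_ isT).
rewrite /tilt F0 W0 mulr0 subr0 => h1.
have x0 := le_trans (ltW t0) tx.
have := hC x x0 xa.
have Wx := ndW _ _ (ltW t0) tx xa.
move=> h2; rewrite leNgt; apply/negP => h3.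
have : C2 <= (C2 / W t) * W x by rewrite mulrAC ler_pdivlMr// ler_wpM2l.
have : 0 < (u - (C1 + C2 / W t)) * W x by rewrite mulr_gt0//; lra.
nra.
Qed.

Lemma slope_has_sup t : 0 < t -> (t%:E <= a)%E ->
  has_sup [set u | u = 0 \/ 0 <= u /\ ascent u t].
Proof.
move=> t0 ta; split; first by exists 0; left.
have [B hB] := ascent_bounded t t0 ta.
exists (Num.max B 0) => u [->|[u0 /hB uB]]; first by rewrite le_max lexx orbT.
by rewrite le_max uB.
Qed.

Lemma slope_ge0 t : 0 < t -> (t%:E <= a)%E -> 0 <= slope t.
Proof. by move=> t0 ta; apply: ub_le_sup; [exact: (slope_has_sup t t0 ta).2|left]. Qed.

Lemma slope_ge u t : 0 < t -> (t%:E <= a)%E -> 0 <= u -> ascent u t -> u <= slope t.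
Proof.
by move=> t0 ta u0 h; apply: ub_le_sup; [exact: (slope_has_sup t t0 ta).2|right].
Qed.

Lemma ascent_lt_slope u t : 0 < t -> (t%:E <= a)%E -> 0 <= u -> u < slope t ->
  ascent u t.
Proof.
move=> t0 ta u0 us.
have := sup_adherent _ (slope_has_sup t t0 ta).
move/(_ (slope t - u)); rewrite subr_gt0 => /(_ us)[v].
rewrite -/(slope t) subKr => -[->|[v0 hv]]; first by rewrite ltNge u0.
by move=> uv; apply: ascent_le hv; exact: ltW.
Qed.

Lemma slope_antimono s t : 0 < s -> s <= t -> (t%:E <= a)%E -> slope t <= slope s.
Proof.
move=> s0 st ta; have t0 := lt_le_trans s0 st.
have sa : (s%:E <= a)%E by apply: le_trans ta; rewrite lee_fin.
rewrite leNgt; apply/negP => h.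
have s0' := slope_ge0 s s0 sa.
have u0 : 0 <= (slope s + slope t) / 2 by lra.
have ut : (slope s + slope t) / 2 < slope t by lra.
have /(ascent_antimono _ _ _ st) us := ascent_lt_slope _ _ t0 ta u0 ut.
by have := slope_ge _ _ s0 sa u0 us; lra.
Qed.

(** A witness [x] would exceed the maximum over [[0, t]], which is attained, by a positive gap;
    raising [u] by [e], half the gap over [W x], would leave an ascent above the supremum. *)
Lemma not_ascent_slope t : 0 < t -> (t%:E <= a)%E -> ~ ascent (slope t) t.
Proof.
move=> t0 ta [x [tx xa hx]].
have s0 := slope_ge0 t t0 ta.
have [m [/andP[m0 mt] hm _]] := first_argmax _ _ _ _ (ltW t0) (continuous_tilt (slope t) 0 t (lexx 0) (ltW t0) ta).
have mx : tilt (slope t) m < tilt (slope t) x by apply: hx; rewrite m0.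
have Wx : 0 < W x by rewrite -W0 incW// (lt_le_trans t0).
pose e := (tilt (slope t) x - tilt (slope t) m) / (2 * W x).
have e0 : 0 < e by rewrite divr_gt0// ?subr_gt0// mulr_gt0.
have eW : e * W x = (tilt (slope t) x - tilt (slope t) m) / 2.
  by rewrite /e; field; rewrite gt_eqF.
have : ascent (slope t + e) t.
  exists x; split => // s /andP[s0' st].
  have := hm s; rewrite s0' st => /(_ isT).
  have : 0 <= W s by rewrite -W0; apply: ndW => //; apply: le_trans ta; rewrite lee_fin.
  move: eW mx; rewrite /tilt; nra.
move=> he; have := slope_ge _ _ t0 ta (addr_ge0 s0 (ltW e0)) he.
by rewrite gerDl leNgt e0.
Qed.

Lemma level_slope_uniq al c r r' : level al c r -> level al c r' -> r = r'.
Proof.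
have aux v v' : level al c v -> level al c v' -> v' <= v.
  move=> [al0 alc ca v0 [h1 h2]] [_ _ _ _ [_ h2']].
  rewrite leNgt; apply/negP => vv.
  have [|y [aly yc hy]] := h2' ((v + v') / 2) al _ (lexx _) alc; first lra.
  have := h1 y aly yc.
  have := incW _ _ al0 aly (le_trans (ltW yc) ca).
  nra.
by move=> h h'; apply/le_anti; rewrite !aux.
Qed.

(** If all late chords from [x] had slope at most [u], the ratio over [(al, y)] would be a weighted
    mean of [K >= k] and a number at most [u], the latter with weight bounded below; it would stay
    under [K - th <= r - th], against the limsup clause. This is what rules out level intervals
    larger than the one constructed in [level_max]. *)
Lemma level_chord al c r x y1 u k : level al c r -> al < x -> x <= y1 ->
  (y1%:E < c)%E -> u < k -> k * (W x - W al) <= F x - F al ->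
  ~ (forall y, y1 < y -> (y%:E < c)%E -> F y - F x <= u * (W y - W x)).
Proof.
move=> [al0 alc ca r0 [h1 h2]] alx xy1 y1c uk hk hy.
have xc : (x%:E < c)%E by apply: le_lt_trans y1c; rewrite lee_fin.
have D0 : 0 < W x - W al by rewrite subr_gt0; apply: incW => //; exact: le_trans (ltW xc) ca.
pose K := (F x - F al) / (W x - W al).
have KD : K * (W x - W al) = F x - F al by rewrite /K divfK// gt_eqF.
have kK : k <= K by rewrite /K ler_pdivlMr.
have Kr : K <= r by rewrite /K ler_pdivrMr//; exact: h1.
(* The value [r - 1] is immaterial: the clause only serves to produce a point [y2] of [(y1, c)]. *)
have [|y2 [y12 y2c _]] := h2 (r - 1) y1 _ (le_trans (ltW alx) xy1) y1c; first lra.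
have x0 : 0 <= x by rewrite (le_trans al0)// ltW.
have e0 : 0 < W y2 - W x.
  rewrite subr_gt0; apply: incW => //; first exact: le_lt_trans y12.
  exact: le_trans (ltW y2c) ca.
(* [K - u] times the share of [(x, y2)] in [(al, y2)], measured by [W]; this share only grows when
   [y2] is replaced by a later [y]. *)
pose th := (K - u) * (W y2 - W x) / ((W x - W al) + (W y2 - W x)).
have th0 : 0 < th.
  rewrite /th; apply: divr_gt0; last exact: addr_gt0.
  by apply: mulr_gt0 => //; rewrite subr_gt0; exact: lt_le_trans kK.
have thE : th * ((W x - W al) + (W y2 - W x)) = (K - u) * (W y2 - W x).
  by rewrite /th divfK// gt_eqF// addr_gt0.
have [||y [y2y yc hyy]] := h2 (K - th) y2 _ _ y2c; first lra.
  by rewrite (le_trans (ltW alx))// (le_trans xy1)// ltW.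
have := hy y (lt_trans y12 y2y) yc.
have : W y2 < W y.
  apply: incW => //; last exact: le_trans (ltW yc) ca.
  by rewrite (le_trans x0)// (le_trans xy1)// ltW.
move: hyy KD thE D0 e0 th0 kK uk.
set A := W x - W al; set B := W y2 - W x.
have -> : W y - W al = (W y - W x) + A by rewrite /A; ring.
have -> : F y - F al = (F y - F x) + (F x - F al) by ring.
set X := W y - W x => h3 KA thAB A0 B0 th0 kK uk WW h4.
have BX : B < X by rewrite /B /X ltrD2r.
have h5 : (K - u) * X < th * (X + A) by nra.
have Ku : 0 < K - u by lra.
have h6 : th * (A + B) * (X + A) = th * (X + A) * (A + B) by ring.
have h7 : (K - u) * X * (A + B) < (K - u) * B * (X + A).
  by rewrite -thAB h6 ltr_pM2r// addr_gt0.
have : X * (A + B) < B * (X + A) by rewrite -(ltr_pM2l Ku) !mulrA.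
nra.
Qed.

(** Level intervals are open, so an inequality at the right end has to be moved to points before it;
    the next lemma moves the reverse inequality to a whole left neighbourhood. *)
Lemma tilt_left_gt u l p c : 0 <= p -> p < c -> (c%:E <= a)%E -> l < tilt u c ->
  exists y, [/\ p < y, y < c & l < tilt u y].
Proof.
move=> p0 pc ca lc.
have [||d d0 hd] := within_eps _ _ _ _ c (continuous_tilt u p c p0 (ltW pc) ca) _ (tilt u c - l).
  by rewrite lexx ltW.
  by rewrite subr_gt0.
have pd : Num.max p (c - d) < c by rewrite gt_max pc gtrBl d0.
have [pm dm] : p <= Num.max p (c - d) /\ c - d <= Num.max p (c - d).
  by rewrite !le_max !lexx orbT.
exists ((Num.max p (c - d) + c) / 2); split; [lra|lra|].
have := hd ((Num.max p (c - d) + c) / 2).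
rewrite ltr_norml ltr_norml => h.
have {h} [||] := andP (h _ _); [apply/andP; split; lra|apply/andP; split; lra|].
lra.
Qed.

Lemma tilt_left_lt u l p c : 0 <= p -> p < c -> (c%:E <= a)%E -> tilt u c < l ->
  exists y, [/\ p <= y, y < c & forall z, y < z -> z < c -> tilt u z < l].
Proof.
move=> p0 pc ca lc.
have [||d d0 hd] := within_eps _ _ _ _ c (continuous_tilt u p c p0 (ltW pc) ca) _ (l - tilt u c).
  by rewrite lexx ltW.
  by rewrite subr_gt0.
have pd : Num.max p (c - d) < c by rewrite gt_max pc gtrBl d0.
have [pm dm] : p <= Num.max p (c - d) /\ c - d <= Num.max p (c - d).
  by rewrite !le_max !lexx orbT.
exists (Num.max p (c - d)); split => // z mz zc.
have := hd z; rewrite !ltr_norml => h.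
have {h} [||] := andP (h _ _); [apply/andP; split; lra|apply/andP; split; lra|].
lra.
Qed.

(** With [r = slope t0], the left end is the first maximizer of [tilt r] on [[0, t0]]. Beyond [t0]
    no value exceeds that maximum, as [r] does not ascend, while every [u < r] does ascend. A level
    interval starting earlier would have a chord of slope above [r] up to [al] and slopes at most
    [r] after it, which [level_chord] forbids. *)
Lemma level_max t0 : 0 < t0 -> (t0%:E < a)%E ->
  (exists s, 0 <= s <= t0 /\ tilt (slope t0) t0 < tilt (slope t0) s) ->
  exists al c, [/\ level al c (slope t0), al < t0, (t0%:E < c)%E &
    forall al' c' r', level al' c' r' -> al' < t0 -> (t0%:E < c')%E ->
      al <= al' /\ (c' <= c)%E].
Proof.
move=> t00 t0a [s0 [s0t hs0]].
have t0a' := ltW t0a.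
set r := slope t0 in hs0 *.
have r0' : 0 <= r := slope_ge0 _ t00 t0a'.
have [al [/andP[al0 alt0] hal hal']] :=
  first_argmax _ _ _ _ (ltW t00) (continuous_tilt r 0 t0 (lexx 0) (ltW t00) t0a').
have alt : tilt r t0 < tilt r al by exact: lt_le_trans (hal _ s0t).
have {alt0}alt0 : al < t0.
  by rewrite lt_neqAle alt0 andbT; apply: contraTneq alt => ->; rewrite ltxx.
have ala : (al%:E <= a)%E by apply: le_trans t0a'; rewrite lee_fin ltW.
have Hi y : t0 <= y -> (y%:E <= a)%E -> tilt r y <= tilt r al.
  move=> ty ya; rewrite leNgt; apply/negP => h.
  apply: (not_ascent_slope _ t00 t0a'); exists y; split => // s st.
  by apply: le_lt_trans h; exact: hal.
have Hall y : 0 <= y -> (y%:E <= a)%E -> tilt r y <= tilt r al.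
  by move=> y0 ya; have [ty|/ltW ty] := leP t0 y; [exact: Hi|apply: hal; rewrite y0].
have r0 : 0 < r.
  rewrite lt_neqAle r0' andbT; apply/eqP => r00; move: alt.
  by rewrite /tilt -r00 !mul0r !subr0 ltNge ndF// ltW.
have Hii u : 0 <= u -> u < r -> exists x, [/\ t0 <= x, (x%:E <= a)%E & tilt u al < tilt u x].
  move=> u0 ur; have [x [t0x xa hx]] := ascent_lt_slope _ _ t00 t0a' u0 ur.
  by exists x; split => //; apply: hx; rewrite al0 ltW.
have Hleft al' c' r' : level al' c' r' -> al' < t0 -> (t0%:E < c')%E -> al <= al'.
  move=> L al't t0c'; rewrite leNgt; apply/negP => al'al.
  have al'0 : 0 <= al' by case: L.
  have c'a : (c' <= a)%E by case: L.
  have WW : 0 < W al - W al' by rewrite subr_gt0 incW.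
  have h := hal' al'; rewrite al'0 al'al in h.
  apply: (@level_chord _ _ _ al t0 r ((F al - F al') / (W al - W al')) L al'al (ltW alt0) t0c').
  - by rewrite ltr_pdivlMr//; move: (h isT); rewrite /tilt; nra.
  - by rewrite divfK// gt_eqF.
  - by move=> y ty yc; have := Hi y (ltW ty) (le_trans (ltW yc) c'a); rewrite /tilt; nra.
(* Either the chords from [al] eventually have slope at most some [u0 < r], and the maximizers of
   [tilt r] stay below [y0]; or the ratios from [al] have limsup [r] at infinity, and the interval
   is [(al, +oo)]. *)
have [[u0 [y0 [u00 u0r ty0 y0a hE]]]|nE] := pselect (exists u0 y0,
   [/\ 0 <= u0, u0 < r, t0 <= y0, (y0%:E <= a)%E &
    forall y, y0 < y -> (y%:E <= a)%E -> tilt u0 y <= tilt u0 al]); last first.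
  have ay : a = +oo%E.
    (* For [a = b] finite the first alternative holds vacuously with [y0 = b], so the second one
       forces [a = +oo]. *)
    move: t0a nE; case: (a) => [b t0b nE|//|//]; exfalso; apply: nE.
    exists 0, b; split => //; first by rewrite ltW.
    by move=> y yb; rewrite lee_fin leNgt yb.
  exists al, +oo%E; split => //.
  - split; rewrite ?ltry ?ay//; split.
      move=> y aly _; have : (y%:E <= a)%E by rewrite ay leey.
      by move/(Hall y (ltW (le_lt_trans al0 aly))); rewrite /tilt; nra.
    move=> r' y0 r'r aly0 _; apply: contrapT => h; apply: nE.
    exists (Num.max r' 0), (Num.max y0 t0); split.
    + by rewrite le_max lexx orbT.
    + by rewrite gt_max r'r.
    + by rewrite le_max lexx orbT.
    + by rewrite ay leey.
    move=> y; rewrite gt_max => /andP[y0y t0y] ya; rewrite leNgt; apply/negP => hy.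
    apply: h; exists y; split=> //; first by rewrite ltry.
    have := incW _ _ al0 (le_lt_trans aly0 y0y) ya.
    have : r' <= Num.max r' 0 by rewrite le_max lexx.
    by move: hy; rewrite /tilt; nra.
  - by rewrite ltry.
  - by move=> al' c' r' L h1 h2; rewrite leey; split=> //; exact: Hleft L h1 h2.
have y00 : 0 <= y0 by rewrite (le_trans (ltW t00)).
have [c [/andP[t0c cy0] hc hc']] :=
  last_argmax _ _ _ _ ty0 (continuous_tilt r t0 y0 (ltW t00) ty0 y0a).
have ca : (c%:E <= a)%E by apply: le_trans y0a; rewrite lee_fin.
have c0 : 0 < c by exact: lt_le_trans t0c.
have cal : tilt r c = tilt r al.
  apply/le_anti; rewrite Hi//= leNgt; apply/negP => lt.
  have Wy0 : 0 < W y0 by rewrite -W0 incW// (lt_le_trans t00).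
  (* This [e] keeps [r - e] above [u0] and changes tilts on [[t0, y0]] by at most half the gap, so
     the ascent of [r - e] can have its witness neither before [y0] nor after it. *)
  pose e := Num.min (r - u0) ((tilt r al - tilt r c) / (2 * W y0)).
  have e0 : 0 < e by rewrite lt_min subr_gt0 u0r divr_gt0 ?subr_gt0// mulr_gt0.
  have eu : e <= r - u0 by rewrite ge_min lexx.
  have eW : e * (2 * W y0) <= tilt r al - tilt r c.
    by rewrite -ler_pdivlMr ?mulr_gt0// ge_min lexx orbT.
  have [||x [t0x xa hx]] := Hii (r - e); [lra|lra|].
  have Walx : W al <= W x by apply: ndW => //; rewrite (le_trans _ t0x)// ltW.
  have [xy0|y0x] := leP x y0.
    have Wx : W x <= W y0 by apply: ndW => //; exact: (le_trans (ltW t00)).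
    have := hc x; rewrite t0x xy0 => /(_ isT).
    have : 0 <= W al by rewrite -W0 ndW.
    by move: hx eW lt; rewrite /tilt; nra.
  by have := hE x y0x xa; move: hx; rewrite /tilt; nra.
have {}t0c : t0 < c.
  by rewrite lt_neqAle t0c andbT; apply: contraTneq alt => ->; rewrite cal ltxx.
have alc : al < c by exact: lt_trans t0c.
have Walc : W al < W c by exact: incW.
have Hbeyond y : c < y -> (y%:E <= a)%E -> tilt r y < tilt r c.
  move=> cy ya; have [yy0|y0y] := leP y y0; first by apply: hc'; rewrite cy.
  rewrite cal; have := hE y y0y ya.
  have := incW _ _ al0 (lt_trans alc cy) ya.
  by rewrite /tilt; nra.
exists al, c%:E; split => //.
- split; rewrite ?lte_fin//; split.
    move=> y aly yc; have : (y%:E <= a)%E by apply: le_trans ca; exact: ltW.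
    by move/(Hall y (ltW (le_lt_trans al0 aly))); rewrite /tilt; nra.
  move=> r' z0 r'r alz0 z0c.
  have h : tilt r' al < tilt r' c by move: cal; rewrite /tilt; nra.
  have [y [zy yc hy]] := tilt_left_gt _ _ _ _ (le_trans al0 alz0) z0c ca h.
  by exists y; rewrite lte_fin; split => //; move: hy; rewrite /tilt; nra.
- move=> al' c' r' L h1 h2; split; first exact: Hleft L h1 h2.
  rewrite leNgt; apply/negP => cc'.
  have [al'0 _ c'a _ _] := L.
  have k1 : r * (W c - W al') <= F c - F al'.
    have := hal al'; rewrite al'0 (ltW h1) => /(_ isT); move: cal; rewrite /tilt; nra.
  have al'c : al' < c by exact: lt_trans t0c.
  move: c'a cc' L h2; case: c' => [b'| |//] c'a cc' L h2.
  + rewrite lte_fin in cc'.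
    have tb := Hbeyond _ cc' c'a.
    have WW : 0 < W b' - W c by rewrite subr_gt0 incW// ltW.
    (* Half the drop from [c] to [b'], per unit of [W]: chords from [c] to points near [b'] then
       have slope at most [r - e], while the chord from [al'] to [c] has slope at least [r]. *)
    pose e := (tilt r c - tilt r b') / (2 * (W b' - W c)).
    have e0 : 0 < e by rewrite divr_gt0 ?subr_gt0// mulr_gt0.
    have eE : e * (2 * (W b' - W c)) = tilt r c - tilt r b' by rewrite divfK// gt_eqF// mulr_gt0.
    have h : tilt (r - e) b' < tilt (r - e) c by move: eE tb; rewrite /tilt; nra.
    have [y1 [cy1 y1b hy1]] := tilt_left_lt _ _ _ _ (ltW c0) cc' c'a h.
    apply: (@level_chord _ _ _ c y1 (r - e) r L) => //; first lra.
    by move=> y y1y yb; have := hy1 y y1y yb; rewrite /tilt; nra.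
  + have ay : a = +oo%E by apply/eqP; rewrite -leye_eq.
    apply: (@level_chord _ _ _ c (Num.max c y0) u0 r L) => //.
      by rewrite le_max lexx.
      by rewrite ltry.
    move=> y; rewrite gt_max => /andP[cy y0y] _.
    have ya : (y%:E <= a)%E by rewrite ay leey.
    by have := hE y y0y ya; move: cal; rewrite /tilt; nra.
Qed.

Definition maxlevel (al : R) (c : \bar R) (r : R) : Prop :=
  level al c r /\ forall al' c' r', level al' c' r' -> al' <= al -> (c <= c')%E ->
    al' = al /\ c' = c.

(** If [t] does not maximize its own tilt on [[0, t]], the interval is the one given by [level_max].
    If it does, it maximizes it everywhere; [level_chord] makes the chord from [al] to [t] have
    slope exactly [slope t], and the two clauses of [level] squeeze [r] to it. *)
Lemma maxlevel_slope al c r t : maxlevel al c r -> al < t -> (t%:E < c)%E ->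
  r = slope t.
Proof.
move=> [L mL] alt tc; have [al0 alc ca r0 [h1 h2]] := L.
have t0 : 0 < t by exact: le_lt_trans alt.
have ta : (t%:E < a)%E by exact: lt_le_trans ca.
have ta' := ltW ta.
have [h|nh] := pselect (exists s, 0 <= s <= t /\ tilt (slope t) t < tilt (slope t) s).
  have [al' [c' [L' al't tc' hmax]]] := level_max _ t0 ta h.
  have [alal cc] := hmax _ _ _ L alt tc.
  have [alE cE] := mL _ _ _ L' alal cc.
  by apply: level_slope_uniq L _; rewrite -alE -cE.
have hle s : 0 <= s <= t -> tilt (slope t) s <= tilt (slope t) t.
  by move=> hs; rewrite leNgt; apply/negP => lt; apply: nh; exists s.
have hge y : t <= y -> (y%:E <= a)%E -> tilt (slope t) y <= tilt (slope t) t.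
  move=> ty ya; rewrite leNgt; apply/negP => lt.
  apply: (not_ascent_slope _ t0 ta'); exists y; split => // s st.
  exact: le_lt_trans (hle _ st) lt.
have WW : 0 < W t - W al by rewrite subr_gt0 incW.
have k1 : slope t * (W t - W al) <= F t - F al.
  by have := hle al; rewrite al0 (ltW alt) => /(_ isT); rewrite /tilt; nra.
have k2 y : t < y -> (y%:E < c)%E -> F y - F t <= slope t * (W y - W t).
  by move=> ty yc; have := hge y (ltW ty) (le_trans (ltW yc) ca); rewrite /tilt; nra.
pose K := (F t - F al) / (W t - W al).
have KE : K * (W t - W al) = F t - F al by rewrite divfK// gt_eqF.
have [sK|Ks] := ltP (slope t) K.
  exfalso; apply: (@level_chord _ _ _ t t (slope t) K L alt (lexx _) tc sK _ k2).
  by rewrite KE.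
have KE' : F t - F al = slope t * (W t - W al).
  by apply/le_anti; rewrite k1 andbT -KE ler_pM2r.
apply/le_anti/andP; split; last first.
  by rewrite -(ler_pM2r WW) -KE'; exact: h1.
rewrite leNgt; apply/negP => lt.
have [y [ty yc hy]] := h2 _ _ lt (ltW alt) tc.
by have := k2 y ty yc; nra.
Qed.

(** A larger value to the left would put [t] in a maximal level interval, a larger one to the right
    would be an ascent at [slope t]. *)
Lemma tilt_le_slope t : 0 < t -> (t%:E < a)%E ->
  (forall al c r, maxlevel al c r -> al < t -> ~ (t%:E < c)%E) ->
  forall y, 0 <= y -> (y%:E <= a)%E -> tilt (slope t) y <= tilt (slope t) t.
Proof.
move=> t0 ta hm y y0 ya; have ta' := ltW ta.
have hle s : 0 <= s <= t -> tilt (slope t) s <= tilt (slope t) t.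
  move=> hs; rewrite leNgt; apply/negP => lt.
  have [al [c [L alt tc hmax]]] := level_max _ t0 ta (ex_intro _ s (conj hs lt)).
  apply: (hm al c _ _ alt tc); split; first exact: L.
  move=> al' c' r' L' alal cc.
  have [h1 h2] := hmax _ _ _ L' (le_lt_trans alal alt) (lt_le_trans tc cc).
  by split; apply/le_anti; apply/andP.
have [ty|/ltW yt] := leP t y; last by apply: hle; rewrite y0.
rewrite leNgt; apply/negP => lt.
apply: (not_ascent_slope _ t0 ta'); exists y; split => // s st.
exact: le_lt_trans (hle _ st) lt.
Qed.

(** * Peaks: maximizers of the tilted functions on [[0, x]] *)

(** An arbitrary maximizer among possibly many; the bounds below hold for any choice. *)
Definition peak (x u : R) : R :=
  xget 0 [set c | 0 <= c <= x /\ forall t, 0 <= t <= x -> tilt u t <= tilt u c].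

Lemma peakP x u : 0 <= x -> (x%:E <= a)%E ->
  0 <= peak x u <= x /\ forall t, 0 <= t <= x -> tilt u t <= tilt u (peak x u).
Proof.
move=> x0 xa; rewrite /peak; case: xgetP => [y _ [? ?]//|/= h].
have [c [? ? _]] := first_argmax _ _ _ _ x0 (continuous_tilt u 0 x (lexx 0) x0 xa).
by exfalso; apply: (h c).
Qed.

(** Adding the two maximality inequalities gives [(v - u) (W (peak x v) - W (peak x u)) <= 0], and
    [W] is strictly increasing. *)
Lemma peak_antimono x u v : 0 <= x -> (x%:E <= a)%E -> u < v -> peak x v <= peak x u.
Proof.
move=> x0 xa uv.
have [/[dup] uI /andP[u0 ux] hu] := peakP x u x0 xa.
have [/[dup] vI /andP[v0 vx] hv] := peakP x v x0 xa.
rewrite leNgt; apply/negP => lt.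
have Wlt : W (peak x u) < W (peak x v).
  by apply: incW => //; apply: le_trans xa; rewrite lee_fin.
have := hu _ vI; have := hv _ uI; rewrite /tilt; nra.
Qed.

Lemma peak_chord x u v : 0 <= x -> (x%:E <= a)%E ->
  F (peak x u) - F (peak x v) <= v * (W (peak x u) - W (peak x v)) /\
  u * (W (peak x u) - W (peak x v)) <= F (peak x u) - F (peak x v).
Proof.
move=> x0 xa; have [uI hu] := peakP x u x0 xa; have [vI hv] := peakP x v x0 xa.
by have := hu _ vI; have := hv _ uI; rewrite /tilt; split; nra.
Qed.

(** For every [u' < u] the peak of [u] witnesses an ascent of [u'] at [t], because [W] is strictly
    smaller on [[0, t]] than at the peak. *)
Lemma slope_lt_peak x u t : (x%:E <= a)%E -> 0 <= u -> 0 < t -> t < peak x u ->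
  u <= slope t.
Proof.
move=> xa u0 t0 tp; have [xlt|x0] := ltP x 0.
  move: tp; rewrite /peak; case: xgetP => [y _ [/andP[h1 h2] _]|_].
    by move: (le_trans h1 h2); rewrite leNgt xlt.
  by rewrite ltNge (ltW t0).
have [/[dup] uI /andP[p0 px] hu] := peakP x u x0 xa.
have pa : ((peak x u)%:E <= a)%E by apply: le_trans xa; rewrite lee_fin.
have ta : (t%:E <= a)%E by apply: le_trans pa; rewrite lee_fin ltW.
have s0 := slope_ge0 _ t0 ta.
rewrite leNgt; apply/negP => lt.
have : ascent ((slope t + u) / 2) t.
  exists (peak x u); split => //; first exact: ltW.
  move=> s /andP[s0' st].
  have := hu s; rewrite s0' (le_trans st)//; last by rewrite (le_trans (ltW tp)).
  move=> /(_ isT).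
  have : W s < W (peak x u) by apply: incW => //; exact: le_lt_trans tp.
  by rewrite /tilt; nra.
have v0 : 0 <= (slope t + u) / 2 by lra.
by move/(slope_ge _ _ t0 ta v0); lra.
Qed.

(** Compare the peak with the value 0 at 0. Peaks thus tend to 0 as [u] grows. *)
Lemma peak_small x u : 0 <= x -> (x%:E <= a)%E -> 0 <= u -> u * W (peak x u) <= F x.
Proof.
move=> x0 xa u0; have [/[dup] uI /andP[p0 px] hu] := peakP x u x0 xa.
have := hu 0; rewrite lexx x0 => /(_ isT); rewrite /tilt F0 W0.
by have := ndF _ _ p0 px xa; lra.
Qed.

(** If [F x > F t], then for small [u] the cost [u W x] is below the gain [F x - F t], and the
    maximizer lies beyond [t]. *)
Lemma flat_after_peaks x t : 0 < x -> (x%:E <= a)%E -> t <= x ->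
  (forall u, 0 < u -> peak x u <= t) -> F x = F t.
Proof.
move=> x0 xa tx hp.
have t0 : 0 <= t.
  by have [/andP[? _] _] := peakP x 1 (ltW x0) xa; exact: le_trans (hp 1 ltr01).
apply/le_anti; rewrite [X in _ && X]ndF// andbT leNgt; apply/negP => lt.
have Wx : 0 < W x by rewrite -W0 incW.
pose u := (F x - F t) / (2 * W x).
have u0 : 0 < u by rewrite divr_gt0 ?subr_gt0// mulr_gt0.
have uE : u * (2 * W x) = F x - F t by rewrite divfK// gt_eqF// mulr_gt0.
have [/[dup] uI /andP[p0 px] hu] := peakP x u (ltW x0) xa.
have := hu x; rewrite lexx (ltW x0) => /(_ isT).
have := ndF _ _ p0 (hp u u0) (le_trans (_ : t%:E <= x%:E)%E xa).
rewrite lee_fin tx => /(_ isT).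
have : 0 <= W (peak x u) by rewrite -W0 ndW//; apply: le_trans xa; rewrite lee_fin.
rewrite /tilt; nra.
Qed.

(** The witness of an ascent may be [a] itself; continuity moves it to some [y] below [a], and a
    maximizer on [[0, x]] with [x >= y] then beats the maximum over [[0, t]]. *)
Lemma ascent_peak u t : 0 <= t -> (t%:E < a)%E -> ascent u t ->
  exists y, [/\ t < y, (y%:E < a)%E &
    forall x, y <= x -> (x%:E <= a)%E -> t < peak x u].
Proof.
move=> t0 ta [z [tz za hz]].
have {}tz : t < z.
  rewrite lt_neqAle tz andbT; apply/eqP => tzE.
  by have := hz t; rewrite t0 lexx -tzE ltxx => /(_ isT).
have ta' := ltW ta.
have [m [mI hm _]] := first_argmax _ _ _ _ t0 (continuous_tilt u 0 t (lexx 0) t0 ta').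
have [y [ty yz hy]] := tilt_left_gt _ _ _ _ t0 tz za (hz _ mI).
exists y; split => //; first by apply: lt_le_trans za; rewrite lte_fin.
move=> x yx xa.
have x0 : 0 <= x by rewrite (le_trans t0)// (le_trans (ltW ty)).
have [/andP[p0 px] hu] := peakP x u x0 xa.
rewrite ltNge; apply/negP => pt.
have := hu y; rewrite yx (le_trans t0 (ltW ty)) => /(_ isT).
have := hm (peak x u); rewrite p0 pt => /(_ isT) /le_lt_trans /(_ hy).
by rewrite ltNge => /negP.
Qed.

End slope.

(** * Chords of an Orlicz function *)

Section convex.
Context {R : realType} (phi : R -> R).
Hypothesis ophi : orlicz phi.

Lemma orlicz0 : phi 0 = 0. Proof. by case: ophi. Qed.

Lemma orlicz_ge0 s : 0 <= s -> 0 <= phi s.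
Proof.
rewrite le_eqVlt => /predU1P[<-|s0]; first by rewrite orlicz0.
by case: ophi => _ _ /(_ s s0) /ltW.
Qed.

Lemma orlicz_convex x y z : 0 <= x -> x <= y -> y <= z ->
  (z - x) * phi y <= (z - y) * phi x + (y - x) * phi z.
Proof.
move=> x0 xy yz; have [xz|zx] := ltP x z; last first.
  have -> : y = x by lra.
  have -> : z = x by lra.
  by rewrite !subrr !mul0r addr0.
have zx0 : 0 < z - x by rewrite subr_gt0.
have [cvx _ _] := ophi.
have t01 : 0 <= (z - y) / (z - x) <= 1.
  by rewrite divr_ge0 ?subr_ge0//= ?ler_pdivrMr ?mul1r; lra.
pose t : {i01 R} := Itv01 (andP t01).1 (andP t01).2.
have := cvx t x z; rewrite !inE/= => /(_ x0).
have z0 : 0 <= z by lra.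
move=> /(_ z0).
rewrite [X in phi X](_ : _ = (z - y) / (z - x) * x + (1 - (z - y) / (z - x)) * z) //.
rewrite !convRE/= /unstable.onem.
have -> : (z - y) / (z - x) * x + (1 - (z - y) / (z - x)) * z = y.
  by field; rewrite gt_eqF.
move=> h; rewrite -(ler_pM2l zx0) in h; apply: le_trans h _.
rewrite le_eqVlt; apply/orP; left; apply/eqP.
by field; rewrite gt_eqF.
Qed.

Lemma orlicz_nd x y : 0 <= x -> x <= y -> phi x <= phi y.
Proof.
move=> x0 xy; have := orlicz_convex 0 x y (lexx 0) x0 xy.
rewrite orlicz0; have := orlicz_ge0 y (le_trans x0 xy).
have [y0|y0] := eqVneq y 0.
  by have -> : x = y by lra.
have {}y0 : 0 < y by rewrite lt_neqAle eq_sym y0 (le_trans x0).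
move=> h1 h2; rewrite -(ler_pM2l y0).
nra.
Qed.

Variable d : R.
Hypothesis d0 : 0 < d.

(** [chord i] belongs to the cell from [(i - 1) d] to [i d]; the value 0 at [i = 0] lets the
    increments of the chords sum from 0, including a positive initial slope of [phi]. *)
Definition chord (i : nat) : R :=
  if i is j.+1 then (phi (j.+1%:R * d) - phi (j%:R * d)) / d else 0.

Lemma chord_ge0 i : 0 <= chord i.
Proof.
case: i => [//|i]; rewrite /chord divr_ge0 ?(ltW d0)// subr_ge0 orlicz_nd//.
  by rewrite mulr_ge0// ltW.
by rewrite ler_pM2r// ler_nat.
Qed.

Lemma chord_nd i : chord i <= chord i.+1.
Proof.
case: i => [|i]; first exact: chord_ge0.
rewrite /chord ler_pM2r ?invr_gt0//.
have i0 : 0 <= i%:R * d by rewrite mulr_ge0// ltW.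
have h1 : i%:R * d <= i.+1%:R * d by rewrite ler_pM2r// ler_nat.
have h2 : i.+1%:R * d <= i.+2%:R * d by rewrite ler_pM2r// ler_nat.
have := orlicz_convex _ _ _ i0 h1 h2.
rewrite -(ler_pM2l d0); move: h1 h2 => _ _.
have -> : i.+1%:R * d = i%:R * d + d by rewrite -natr1 mulrDl mul1r.
have -> : i.+2%:R * d = i%:R * d + d + d by rewrite -!natr1 !mulrDl !mul1r.
lra.
Qed.

Lemma sum_chord n : \sum_(i < n.+1) chord i * d = phi (n%:R * d).
Proof.
elim: n => [|n IH]; first by rewrite big_ord1 /= !mul0r orlicz0.
by rewrite big_ord_recr/= IH divfK ?gt_eqF// addrC subrK.
Qed.

(* Abel summation: the tangent of slope [chord n], lowered by [chord n * d]. *)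
Lemma sum_chord_tangent n s :
  \sum_(i < n) (chord i.+1 - chord i) * (s - i.+1%:R * d) =
  chord n * (s - n%:R * d) + \sum_(i < n) chord i * d.
Proof.
elim: n => [|n IH]; first by rewrite !big_ord0/= mul0r addr0.
by rewrite !big_ord_recr IH/=; rewrite -[n.+1%:R]natr1; ring.
Qed.

(** Without the cut at [n] the left side is the interpolant of [phi] on the grid with its kinks
    moved right by [d]: in each cell it has the slope of [phi] over the previous cell, so it stays
    below [phi]. *)
Lemma chord_tangent_le n s : 0 <= s ->
  \sum_(i < n) (chord i.+1 - chord i) * Num.max (s - i.+1%:R * d) 0 <= phi s.
Proof.
move=> s0; elim: n => [|n IH]; first by rewrite big_ord0 orlicz_ge0.
have [hs|hs] := ltP s (n.+1%:R * d).
  rewrite big_ord_recr/= [Num.max (s - _) 0]max_r ?mulr0 ?addr0//.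
  by rewrite subr_le0 ltW.
under eq_bigr => i _.
  rewrite max_l; first over.
  by rewrite subr_ge0 (le_trans _ hs)// ler_pM2r// ler_nat.
rewrite sum_chord_tangent sum_chord.
have n0 : 0 <= n%:R * d by rewrite mulr_ge0// ltW.
have h1 : n%:R * d <= n.+1%:R * d by rewrite ler_pM2r// ler_nat.
have h := orlicz_convex _ _ _ n0 h1 hs.
have cE : chord n.+1 * d = phi (n.+1%:R * d) - phi (n%:R * d).
  by rewrite /= divfK// gt_eqF.
have c0 := chord_ge0 n.+1.
have hE : n.+1%:R * d = n%:R * d + d by rewrite -natr1 mulrDl mul1r.
rewrite -(ler_pM2l d0).
move: h cE c0 hs n0; rewrite hE.
set p := phi (n%:R * d); set q := phi (n%:R * d + d); set X := n%:R * d.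
set c := chord _ => h cE c0 hs n0.
have qE : q = c * d + p by rewrite cE subrK.
rewrite qE in h; nra.
Qed.

(** Summation by parts, meant for [sg i] the maximum of the tilt of parameter [i d] and [Wm i] the
    value of [W] at its peak. The induction carries the boundary term [chord n * sg n], nonnegative
    and dropped at the end. *)
Lemma sum_chord_sigma (sg Wm : nat -> R) n :
  (forall i, 0 <= sg i) ->
  (forall i, d * Wm i.+1 <= sg i - sg i.+1) ->
  \sum_(i < n) chord i * d * Wm i.+1 <=
  \sum_(i < n) (chord i.+1 - chord i) * sg i.+1.
Proof.
move=> sg0 hW.
suff : \sum_(i < n) chord i * d * Wm i.+1 + chord n * sg n <=
       \sum_(i < n) (chord i.+1 - chord i) * sg i.+1.
  by apply: le_trans; rewrite lerDl mulr_ge0// chord_ge0.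
elim: n => [|n IH]; first by rewrite !big_ord0/= mul0r addr0.
rewrite !big_ord_recr/= -/(chord n.+1).
have := hW n; have := chord_ge0 n; nra.
Qed.

End convex.

(** * Decreasing rearrangements *)

Lemma countableU (T : Type) (A B : set T) : countable A -> countable B ->
  countable (A `|` B).
Proof.
move=> cA cB; rewrite (_ : A `|` B = \bigcup_(b : bool) (if b then A else B)).
  by apply: bigcup_countable => // -[].
by apply/seteqP; split => [x [Ax|Bx]|x [[]]]; [exists true|exists false|left|right].
Qed.

Section rearrangement.
Context {R : realType}.
Implicit Types (a : \bar R) (f g : R -> R).
Local Open Scope ereal_scope.

Lemma oitvE (x y : R) : oitv x y%:E = `]x, y[%classic.
Proof. by apply/seteqP; split => t; rewrite /oitv/= in_itv/= lte_fin => /andP. Qed.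

Lemma oitv_is_interval (x : R) a : is_interval (oitv x a).
Proof.
move=> s t [xs sa] [xt ta] z /andP[sz zt]; split; first exact: lt_le_trans sz.
by apply: le_lt_trans ta; rewrite lee_fin.
Qed.

Lemma measurable_oitv (x : R) a : measurable (oitv x a).
Proof. by apply: is_interval_measurable; exact: oitv_is_interval. Qed.

Lemma completed_lebesgueE (A : set R) :
  completed_lebesgue_measure (A : set lebesgueT) = lebesgue_measure A.
Proof. by []. Qed.

(** As a function on sets the completed measure is the outer measure, so this and the next bound
    hold for arbitrary sets. *)
Lemma le_completed_lebesgue (A B : set R) : A `<=` B ->
  completed_lebesgue_measure (A : set lebesgueT) <=
  completed_lebesgue_measure (B : set lebesgueT).
Proof. by move=> AB; apply: le_outer_measure. Qed.

Lemma completed_lebesgueU (A B : set R) :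
  completed_lebesgue_measure (A `|` B : set lebesgueT) <=
  completed_lebesgue_measure (A : set lebesgueT) +
  completed_lebesgue_measure (B : set lebesgueT).
Proof. exact: outer_measureU2. Qed.

Lemma completed_lebesgue_itv0 (t : R) : (0 <= t)%R ->
  completed_lebesgue_measure (`]0%R, t[%classic : set lebesgueT) = t%:E.
Proof.
move=> t0; rewrite completed_lebesgueE lebesgue_measure_itv/= lte_fin.
by case: ltgtP t0 => // [_ _|<- _]//; rewrite ?sube0.
Qed.

Lemma rearrangement_ge0 (I : set R) f t : 0 <= rearrangement I f t.
Proof. by apply: le_ereal_inf_tmp => _ [s [s0 _] <-]; rewrite lee_fin. Qed.

Lemma rearrangement_antimono (I : set R) f s t : (s <= t)%R ->
  rearrangement I f t <= rearrangement I f s.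
Proof.
move=> st; apply: ereal_inf_le_tmp => _ [r [r0 h] <-]; exists r => //; split => //.
by apply: le_trans h _; rewrite lee_fin.
Qed.

Lemma rearrangement_countable (I N : set R) f g : countable N ->
  (forall t, I t -> ~ N t -> f t = g t) ->
  rearrangement I f = rearrangement I g.
Proof.
have aux f' g' : countable N ->
    (forall t, I t -> ~ N t -> f' t = g' t) ->
    forall s, distribution_fun I f' s <= distribution_fun I g' s.
  move=> cN fg s; rewrite /distribution_fun.
  apply: (@le_trans _ _ (completed_lebesgue_measure
      ((I `&` [set x | (s < `|g' x|)%R]) `|` N : set lebesgueT))).
    apply: le_completed_lebesgue => t [It ft].
    by have [Nt|Nt] := pselect (N t); [right|left; split=> //=; rewrite -fg].
  apply: le_trans (completed_lebesgueU _ _) _.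
  by rewrite [X in _ + X]completed_lebesgueE countable_lebesgue_measure0// adde0.
move=> cN fg; apply/funext => t; rewrite /rearrangement.
congr (ereal_inf [set s%:E | s in _]); apply/seteqP.
by split => s [s0 h]; split => //; apply: le_trans h; apply: aux => // x Ix Nx;
  rewrite fg.
Qed.

Lemma rearrangementM (I : set R) f (l t : R) : (0 < l)%R ->
  rearrangement I (fun x => l * f x)%R t = l%:E * rearrangement I f t.
Proof.
move=> l0; rewrite /rearrangement -ereal_inf_pZl//; congr ereal_inf.
have dE s : distribution_fun I (fun x => l * f x)%R (l * s) = distribution_fun I f s.
  rewrite /distribution_fun; congr (completed_lebesgue_measure (_ `&` _)).
  apply/seteqP; split => x/=; rewrite normrM gtr0_norm// ltr_pM2l//.
apply/seteqP; split => [_ [s [s0 h] <-]|_ [_ [s [s0 h] <-] <-]].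
  exists (s / l)%:E; last by rewrite -EFinM mulrC divfK// gt_eqF.
  exists (s / l)%R => //; split; first by rewrite divr_ge0// ltW.
  by rewrite -dE mulrC divfK// gt_eqF.
by exists (l * s)%R => //; split; [rewrite mulr_ge0// ltW|rewrite dE].
Qed.

Lemma measurable_antimono (D : set R) (f : R -> \bar R) : is_interval D ->
  (forall s t, D s -> D t -> (s <= t)%R -> f t <= f s) -> measurable_fun D f.
Proof.
move=> iD ndf; have mD := is_interval_measurable iD.
apply: (measurability (@ErealGenCInfty.G R)) => [|/= _ [_] [r] -> <-].
  exact: ErealGenCInfty.measurableE.
apply: is_interval_measurable => s t/= [Ds fs] [Dt ft] u /andP[su ut].
have Du : D u by apply: (iD s t) => //; rewrite su.
split => //; move: ft; rewrite !in_itv/= !andbT => /le_trans; apply.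
exact: ndf.
Qed.

Lemma measurable_rearrangement x a f : measurable_fun (oitv x a) (rearrangement (oitv x a) f).
Proof.
apply: measurable_antimono; first exact: oitv_is_interval.
by move=> s t _ _; exact: rearrangement_antimono.
Qed.

(** For a decreasing [g] on an open interval these are its discontinuities, phrased by a level [l]
    separating [g t] from the values on one side. Nearly every almost-everywhere statement below has
    such a set as its exceptional set. *)
Definition jumps (I : set R) g : set R := [set t | I t /\ exists l : R,
  (l < g t)%R /\ (forall y, I y -> (t < y)%R -> (g y <= l)%R) \/
  (g t < l)%R /\ (forall s, I s -> (s < t)%R -> (l <= g s)%R)].

(** Some rational lies strictly between [l] and [g t], and for a given rational and side at most one
    [t] qualifies. *)
Lemma countable_jumps (I : set R) g : countable (jumps I g).
Proof.
pose A (q : rat) := [set t | I t /\ (ratr q < g t)%R /\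
  (forall y, I y -> (t < y)%R -> (g y <= ratr q)%R)].
pose B (q : rat) := [set t | I t /\ (g t < ratr q)%R /\
  (forall s, I s -> (s < t)%R -> (ratr q <= g s)%R)].
apply: (@sub_countable _ _ _ (\bigcup_q (A q) `|` \bigcup_q (B q))).
  apply: subset_card_le => t [It [l [[lt h]|[lt h]]]].
    have [q] := rat_in_itvoo lt; rewrite in_itv/= => /andP[lq qg].
    by left; exists q => //; split => //; split => // y Iy ty; rewrite (le_trans (h y Iy ty))// ltW.
  have [q] := rat_in_itvoo lt; rewrite in_itv/= => /andP[lq qg].
  by right; exists q => //; split => //; split => // y Iy ty; rewrite (le_trans _ (h y Iy ty))// ltW.
have c1 (X : set R) : (forall s t, X s -> X t -> ~ (s < t)%R) -> countable X.
  move=> hX; have [->|/set0P[s Xs]] := eqVneq X set0; first exact: countable0.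
  apply: (@sub_countable _ _ _ [set s]); last exact: countable1.
  apply: subset_card_le => t Xt /=; case: (ltgtP s t) => // h; exfalso.
    exact: (hX s t).
  exact: (hX t s).
apply: countableU.
  apply: bigcup_countable => // q _; apply: c1 => s t [Is [h1 h2]] [It [h3 h4]] st.
  by move: (h2 t It st); rewrite leNgt h3.
apply: bigcup_countable => // q _; apply: c1 => s t [Is [h1 h2]] [It [h3 h4]] st.
by move: (h4 s Is st); rewrite leNgt h1.
Qed.

(** An admissible level [s < g t] would satisfy [g y <= s] for all [y > t], since otherwise [(0, y)]
    lies in the superlevel set, of measure above [t]; then [t] is a jump. *)
Lemma rearrangement_decreasing a g t : (forall t, oitv 0 a t -> (0 <= g t)%R) ->
  (forall s t, oitv 0 a s -> oitv 0 a t -> (s <= t)%R -> (g t <= g s)%R) ->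
  oitv 0 a t -> ~ jumps (oitv 0 a) g t -> rearrangement (oitv 0 a) g t = (g t)%:E.
Proof.
move=> g0 dg It nj; have [t0 ta] := It; apply/le_anti/andP; split.
  apply: ereal_inf_lbound; exists (g t) => //; split; first exact: g0.
  rewrite -(completed_lebesgue_itv0 _ (ltW t0)); apply: le_completed_lebesgue.
  move=> x [Ix /=]; rewrite ger0_norm ?g0// in_itv/= => h.
  by have [x0 _] := Ix; rewrite x0/= ltNge; apply: contraL h => tx; rewrite -leNgt dg.
apply: le_ereal_inf_tmp => _ [s [s0 ds] <-]; rewrite lee_fin leNgt; apply/negP => sg.
apply: nj; split => //; exists s; left; split => // y Iy ty.
rewrite leNgt; apply/negP => sy; move: ds; apply/negP; rewrite -ltNge.
apply: (@lt_le_trans _ _ y%:E); first by rewrite lte_fin.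
have [y0 ya] := Iy.
rewrite -(completed_lebesgue_itv0 _ (ltW y0)); apply: le_completed_lebesgue.
move=> x /=; rewrite in_itv/= => /andP[x0 xy].
have Ix : oitv 0 a x by split => //; apply: lt_trans ya; rewrite lte_fin.
by split => //=; rewrite ger0_norm ?g0//; apply: lt_le_trans sy _; apply: dg => //; exact: ltW.
Qed.

End rearrangement.

(** * Primitives *)

Section primitive.
Context {R : realType}.
Variables (a : \bar R) (g : R -> R).
Local Open Scope ereal_scope.
Local Notation mu := (@lebesgue_measure R).

Definition primitive (x : R) : R := fine (\int[mu]_(t in oitv 0%R x%:E) (g t)%:E).

Hypothesis mg : measurable_fun [set: R] g.
Hypothesis g0 : forall t, (0 <= g t)%R.
Hypothesis fing : forall x : R, x%:E <= a ->
  \int[mu]_(t in oitv 0%R x%:E) (g t)%:E < +oo.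

Let mgE (D : set R) : measurable_fun D (EFin \o g).
Proof. by apply/measurable_EFinP; apply: measurable_funS mg. Qed.

Lemma integral_primitive x : x%:E <= a ->
  \int[mu]_(t in oitv 0%R x%:E) (g t)%:E = (primitive x)%:E.
Proof.
move=> xa; rewrite /primitive fineK// ge0_fin_numE ?fing//.
by apply: integral_ge0 => t _; rewrite lee_fin.
Qed.

Lemma primitive0 : primitive 0 = 0%R.
Proof. by rewrite /primitive oitvE set_itv_ge ?bnd_simp// integral_set0. Qed.

Lemma primitive_diff x y : (0 <= x)%R -> (x <= y)%R -> y%:E <= a ->
  \int[mu]_(t in oitv x y%:E) (g t)%:E = (primitive y - primitive x)%:E.
Proof.
move=> x0 xy ya; have xa : x%:E <= a by apply: le_trans ya; rewrite lee_fin.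
have [<-|xy'] := eqVneq x y.
  by rewrite subrr oitvE set_itv_ge ?bnd_simp// integral_set0.
have {xy'}xy' : (x < y)%R by rewrite lt_neqAle xy'.
have := integral_primitive _ ya; rewrite oitvE.
rewrite (@itv_bndbnd_setU _ _ (BRight 0%R) (BRight x) (BLeft y)) ?bnd_simp//.
rewrite ge0_integral_setU//=; last 2 first.
  by move=> t _; rewrite lee_fin.
  apply/disj_setPS => t [/=]; rewrite !in_itv/= => /andP[_ tx] /andP[xt _].
  by move: xt; rewrite ltNge tx.
rewrite -(integral_itv_bndo_bndc (mgE _)) -!oitvE integral_primitive//.
case: (\int[mu]_(t in _) _) => [r| |] //=.
by rewrite -EFinD => -[<-]; congr EFin; rewrite addrAC subrr add0r.
exact: mgE.
Qed.

Lemma primitive_ge c x y : (0 <= x)%R -> (x <= y)%R -> y%:E <= a ->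
  (forall t, (x < t < y)%R -> (c <= g t)%R) ->
  (c * (y - x) <= primitive y - primitive x)%R.
Proof.
move=> x0 xy ya hc; rewrite -lee_fin -primitive_diff// oitvE.
have [c0|c0] := leP 0%R c; last first.
  apply: (@le_trans _ _ 0).
    by rewrite lee_fin nmulr_rle0 ?subr_ge0.
  by apply: integral_ge0 => t _; rewrite lee_fin.
apply: (@le_trans _ _ (\int[mu]_(t in `]x, y[) (cst c%:E t))).
  rewrite integral_cst// [X in _ * X](_ : _ = lebesgue_measure `]x, y[%classic)// lebesgue_measure_itv/= lte_fin.
  move: xy; rewrite le_eqVlt => /predU1P[->|xy].
    by rewrite ltxx subrr mulr0 mule0.
  by rewrite xy -EFinB -EFinM.
apply: ge0_le_integral.
- exact: measurable_itv.
- by move=> t _; rewrite lee_fin.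
- exact: measurable_cst.
- exact: mgE.
- by move=> t; rewrite /= in_itv/= => /hc; rewrite lee_fin.
Qed.

Lemma primitive_le c x y : (0 <= x)%R -> (x <= y)%R -> y%:E <= a ->
  (forall t, (x < t < y)%R -> (g t <= c)%R) ->
  (primitive y - primitive x <= c * (y - x))%R.
Proof.
move=> x0 xy ya hc; rewrite -lee_fin -primitive_diff// oitvE.
apply: (@le_trans _ _ (\int[mu]_(t in `]x, y[) (cst c%:E t))).
  apply: ge0_le_integral.
  - exact: measurable_itv.
  - by move=> t _; rewrite lee_fin.
  - exact: mgE.
  - exact: measurable_cst.
  - by move=> t; rewrite /= in_itv/= => /hc; rewrite lee_fin.
rewrite integral_cst// [X in _ * X](_ : _ = lebesgue_measure `]x, y[%classic)// lebesgue_measure_itv/= lte_fin.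
move: xy; rewrite le_eqVlt => /predU1P[->|xy].
    by rewrite ltxx subrr mulr0 mule0.
  by rewrite xy -EFinB -EFinM.
Qed.

Lemma primitive_nd x y : (0 <= x)%R -> (x <= y)%R -> y%:E <= a ->
  (primitive x <= primitive y)%R.
Proof.
move=> x0 xy ya; rewrite -subr_ge0.
by have := @primitive_ge 0%R x y x0 xy ya; rewrite mul0r; apply.
Qed.

Lemma primitive_continuous q : (0 <= q)%R -> q%:E <= a ->
  {within `[0%R, q], continuous primitive}.
Proof.
move=> q0 qa.
have int : mu.-integrable `[0%R, q] (EFin \o g).
  apply/integrableP; split; first exact: mgE.
  rewrite [X in X < _](_ : _ = \int[mu]_(x in `[0%R, q]) (g x)%:E); last first.
    by apply: eq_integral => t _ /=; rewrite ger0_norm.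
  rewrite -(integral_itv_obnd_cbnd (mgE _)) -(integral_itv_bndo_bndc (mgE _)).
  by rewrite -oitvE fing.
have := parameterized_integral_continuous q0 int.
have -> // : (fun x => parameterized_integral lebesgue_measure 0%R x g) = primitive.
apply/funext => x; rewrite /parameterized_integral /Rintegral /primitive oitvE.
congr fine; have [x0|x0] := ltP x 0%R.
  by rewrite !set_itv_ge// bnd_simp -?ltNge -?leNgt// ltW.
rewrite -(integral_itv_obnd_cbnd (mgE _)).
by rewrite -(integral_itv_bndo_bndc (mgE _)).
Qed.

End primitive.

(** Integrals are assumed finite only up to points of [I]; to reach a finite right end, [g] is
    bounded by [g (x / 2)] on the second half of [(0, x)]. *)
Lemma finite_integral_oitv (R : realType) (a : \bar R) (g : R -> R) :
  measurable_fun [set: R] g -> (forall t, 0 <= g t) ->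
  (forall t, ~ oitv 0 a t -> g t = 0) ->
  (forall s t, oitv 0 a s -> oitv 0 a t -> s <= t -> g t <= g s) ->
  (forall x, oitv 0 a x -> (\int[lebesgue_measure]_(t in oitv 0 x%:E) (g t)%:E < +oo)%E) ->
  forall x : R, (x%:E <= a)%E -> (\int[lebesgue_measure]_(t in oitv 0 x%:E) (g t)%:E < +oo)%E.
Proof.
move=> mg g0 gI dg fin x xa.
have [x0|x0] := leP x 0; first by rewrite oitvE set_itv_ge ?integral_set0 ?ltry// bnd_simp -leNgt.
have hI t : 0 < t -> t < x -> oitv 0 a t.
  by move=> t0 tx; split => //; apply: lt_le_trans xa; rewrite lte_fin.
have x20 : 0 < x / 2 by lra.
have x2x : x / 2 < x by lra.
have Ix2 := hI _ x20 x2x.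
have mgE (D : set R) : measurable_fun D (EFin \o g).
  by apply/measurable_EFinP; apply: measurable_funS mg.
rewrite oitvE (@itv_bndbnd_setU _ _ (BRight 0) (BLeft (x / 2)) (BLeft x)) ?bnd_simp ?ltW//.
rewrite ge0_integral_setU//=; last 2 first.
  by move=> t _; rewrite lee_fin.
  apply/disj_setPS => t [/=]; rewrite !in_itv/= => /andP[_ tx] /andP[xt _].
  by move: tx; rewrite ltNge xt.
apply: lte_add_pinfty; first by rewrite -oitvE fin.
apply: (@le_lt_trans _ _ (\int[lebesgue_measure]_(t in `[(x / 2)%R, x[) (cst (g (x / 2)%R)%:E t))%E).
  apply: ge0_le_integral.
  - exact: measurable_itv.
  - by move=> t _; rewrite lee_fin.
  - exact: mgE.
  - exact: measurable_cst.
  - move=> t; rewrite /= in_itv/= => /andP[xt tx]; rewrite lee_fin dg//.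
    by apply: hI => //; exact: lt_le_trans xt.
rewrite integral_cst// [X in (_ * X)%E](_ : _ = lebesgue_measure `[x / 2, x[%classic)//.
rewrite lebesgue_measure_itv/= lte_fin x2x.
by rewrite -EFinB -EFinM ltry.
exact: mgE.
Qed.

(** * Modulars *)

Section modular.
Context {R : realType}.
Variables (a : \bar R) (phi : R -> R).
Hypothesis ophi : orlicz phi.
Local Open Scope ereal_scope.
Local Notation mu := (@lebesgue_measure R).
Local Notation I := (oitv 0%R a).

Let er_mapE (x : \bar R) : 0 <= x ->
  er_map phi x = er_map (fun s => phi (Num.max s 0%R)) x.
Proof. by case: x => [r| |] //=; rewrite lee_fin => r0; rewrite max_l. Qed.

Let arg_ge0 v f t : decreasing_weight I v -> I t ->
  0 <= rearrangement I f t * ((v t)^-1)%:E.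
Proof.
by move=> hv It; rewrite mule_ge0 ?rearrangement_ge0// lee_fin invr_ge0 ltW// hv.1.
Qed.

Lemma modular_ge0 v f t : decreasing_weight I v -> I t ->
  0 <= er_map phi (rearrangement I f t * ((v t)^-1)%:E) * (v t)%:E.
Proof.
move=> hv It; rewrite mule_ge0//; last by rewrite lee_fin ltW// hv.1.
have := arg_ge0 v f t hv It; case: (_ * _) => [r| |]//=.
by rewrite !lee_fin; exact: (orlicz_ge0 _ ophi).
Qed.

Lemma measurable_modular v f : decreasing_weight I v ->
  measurable_fun I (fun t => er_map phi (rearrangement I f t * ((v t)^-1)%:E) * (v t)%:E).
Proof.
move=> hv; have mI := measurable_oitv 0%R a.
have mv : measurable_fun I v.
  apply/measurable_EFinP; apply: (measurable_antimono I); first exact: oitv_is_interval.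
  by move=> s t Is It st; rewrite lee_fin; exact: hv.2.
have mvV : measurable_fun I (fun t => (v t)^-1)%R.
  rewrite -[X in measurable_fun _ X]opprK; apply: measurable_funN.
  apply/measurable_EFinP; apply: (measurable_antimono I); first exact: oitv_is_interval.
  move=> s t Is It st; rewrite lee_fin lerN2 lef_pV2 ?posrE; [exact: hv.2|exact: hv.1|exact: hv.1].
(* [phi] is monotone only on the nonnegative half-line; truncating its argument makes it monotone,
   hence measurable, on the whole line. *)
have h1 : measurable_fun [set: R] (fun s => phi (Num.max s 0))%R.
  apply: nondecreasing_measurable => // s t st; apply: (orlicz_nd _ ophi).
    by rewrite le_max lexx orbT.
  by rewrite ge_max !le_max st lexx orbT.
have h2 : measurable_fun I (fun t => rearrangement I f t * ((v t)^-1)%:E).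
  apply: emeasurable_funM; first exact: measurable_rearrangement.
  exact/measurable_EFinP.
have h3 := measurableT_comp (@measurable_er_map _ (measurableTypeR R) R _ h1) h2.
apply: emeasurable_funM; last exact/measurable_EFinP.
apply: (eq_measurable_fun (fun t => er_map (fun s => phi (Num.max s 0%R))
  (rearrangement I f t * ((v t)^-1)%:E))); last exact: h3.
by move=> t /set_mem It; rewrite er_mapE//; exact: arg_ge0.
Qed.

Lemma modular_ae v f g : decreasing_weight I v ->
  (forall t, I t -> (0 <= g t)%R) ->
  (forall s t, I s -> I t -> (s <= t)%R -> (g t <= g s)%R) ->
  measurable_fun I (fun t => phi (g t / v t) * v t)%R ->
  rearrangement I f = rearrangement I g ->
  modular phi I v f = \int[mu]_(t in I) (phi (g t / v t) * v t)%:E.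
Proof.
move=> hv g0 dg mg fg; rewrite /modular; apply: ge0_ae_eq_integral.
- exact: measurable_oitv.
- exact: measurable_modular.
- exact/measurable_EFinP.
- by move=> t; exact: modular_ge0.
- move=> t It; rewrite lee_fin mulr_ge0//; last by rewrite ltW// hv.1.
  by apply: (orlicz_ge0 _ ophi); rewrite divr_ge0 ?g0// ltW// hv.1.
exists (jumps I g); split.
- exact: countable_measurable (countable_jumps _ _).
- exact: countable_lebesgue_measure0 (countable_jumps _ _).
- move=> t /= /not_implyP[It nP]; apply: contrapT => nj; apply: nP.
  by rewrite fg rearrangement_decreasing// -EFinM.
Qed.

Lemma integral_rearrangement_decreasing g x : I x ->
  (forall t, I t -> (0 <= g t)%R) ->
  (forall s t, I s -> I t -> (s <= t)%R -> (g t <= g s)%R) ->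
  \int[mu]_(t in oitv 0%R x%:E) rearrangement I g t =
  \int[mu]_(t in oitv 0%R x%:E) (g t)%:E.
Proof.
move=> [x0 xa] g0 dg.
have sub : oitv 0%R x%:E `<=` I by move=> t [t0 tx]; split => //; exact: lt_trans xa.
have mI := measurable_oitv 0%R a.
apply: ge0_ae_eq_integral.
- exact: measurable_oitv.
- by apply: measurable_funS (measurable_rearrangement _ _ _).
- apply: (measurable_funS mI sub); apply: (measurable_antimono I).
    exact: oitv_is_interval.
  by move=> s t Is It st; rewrite lee_fin dg.
- by move=> t _; exact: rearrangement_ge0.
- by move=> t /sub It; rewrite lee_fin g0.
exists (jumps I g); split.
- exact: countable_measurable (countable_jumps _ _).
- exact: countable_lebesgue_measure0 (countable_jumps _ _).
- move=> t /= /not_implyP[/sub It nP]; apply: contrapT => nj; apply: nP.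
  exact: rearrangement_decreasing.
Qed.

(** Convexity gives [s <= 1 + phi s / phi 1] for [s >= 0]. Taking [s = l g^* / w], multiplying by
    [w] and integrating yields the bound, with the finite modular of [l g] in the constant. *)
Lemma M_class_growth w g : decreasing_weight I w -> M_class phi I w g ->
  exists C1 C2 : R, [/\ (0 <= C1)%R, (0 <= C2)%R & forall x, I x ->
    \int[mu]_(t in oitv 0%R x%:E) rearrangement I g t <=
    C1%:E * \int[mu]_(t in oitv 0%R x%:E) (w t)%:E + C2%:E].
Proof.
move=> hw [_ [l l0 fin]].
set E := fun t => er_map phi (rearrangement I (fun x => l * g x)%R t * ((w t)^-1)%:E) * (w t)%:E.
have p1 : (0 < phi 1)%R by case: ophi => _ _; apply.
have mI := measurable_oitv 0%R a.
have mE : measurable_fun I E by exact: measurable_modular.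
have mw : measurable_fun I (fun t => (w t)%:E).
  apply: (measurable_antimono I); first exact: oitv_is_interval.
  by move=> s t Is It st; rewrite lee_fin; exact: hw.2.
have E0 t : I t -> 0 <= E t by exact: modular_ge0.
have pt t : I t -> l%:E * rearrangement I g t <= (w t)%:E + (phi 1)^-1%:E * E t.
  move=> It; rewrite /E rearrangementM//; have wt := hw.1 t It.
  have := rearrangement_ge0 I g t; case: (rearrangement I g t) => [r| |//].
    rewrite lee_fin => r0; rewrite -!EFinM/= -?EFinM -?EFinD lee_fin.
    set s := (l * r / w t)%R.
    have -> : (l * r = s * w t)%R by rewrite divfK// gt_eqF.
    have s0 : (0 <= s)%R by rewrite divr_ge0 ?mulr_ge0// ltW.
    have hs : (s <= 1 + (phi 1)^-1 * phi s)%R.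
      have [s1|s1] := leP s 1%R.
        by rewrite (le_trans s1)// lerDl mulr_ge0 ?invr_ge0 ?(ltW p1)// (orlicz_ge0 _ ophi).
      have := orlicz_convex _ ophi 0%R 1%R s (lexx _) ler01 (ltW s1).
      rewrite (orlicz0 _ ophi) !subr0 mulr0 add0r mul1r => h.
      have : (s <= (phi 1)^-1 * phi s)%R by rewrite mulrC ler_pdivlMr.
      lra.
    by rewrite mulrA -{2}[w t]mul1r -mulrDl ler_wpM2r// ltW.
  (* Where the rearrangement is infinite both sides are [+oo]. *)
  move=> _; rewrite gt0_muley ?lte_fin// gt0_mulye ?lte_fin ?invr_gt0//=.
  by rewrite gt0_mulye ?lte_fin// gt0_muley ?lte_fin ?invr_gt0// addey.
pose K := fine (\int[mu]_(t in I) E t).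
have KE : \int[mu]_(t in I) E t = K%:E.
  by rewrite fineK// ge0_fin_numE//; apply: integral_ge0.
have K0 : (0 <= K)%R by rewrite -lee_fin -KE; apply: integral_ge0.
exists (l^-1)%R, (l^-1 * ((phi 1)^-1 * K))%R; split.
- by rewrite invr_ge0 ltW.
- by rewrite !mulr_ge0// invr_ge0 ltW.
move=> x [x0 xa].
have sub : oitv 0%R x%:E `<=` I by move=> t [t0 tx]; split => //; exact: lt_trans xa.
have mD := measurable_oitv 0%R x%:E.
have mwD := measurable_funS mI sub mw; have mED := measurable_funS mI sub mE.
have mgD : measurable_fun (oitv 0%R x%:E) (rearrangement I g).
  exact: measurable_funS mI sub (measurable_rearrangement _ _ _).
have h : l%:E * \int[mu]_(t in oitv 0%R x%:E) rearrangement I g t <=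
    \int[mu]_(t in oitv 0%R x%:E) (w t)%:E + ((phi 1)^-1 * K)%:E.
  rewrite -ge0_integralZl//; last 2 first.
    by move=> t _; exact: rearrangement_ge0.
    by rewrite lee_fin ltW.
  apply: (@le_trans _ _ (\int[mu]_(t in oitv 0%R x%:E) ((w t)%:E + (phi 1)^-1%:E * E t))).
    apply: ge0_le_integral => //.
    - by move=> t _; rewrite mule_ge0 ?rearrangement_ge0// lee_fin ltW.
    - exact: measurable_funeM.
    - by apply: emeasurable_funD => //; exact: measurable_funeM.
    - by move=> t /sub; exact: pt.
  rewrite ge0_integralD//; last 3 first.
  - by move=> t /sub It; rewrite lee_fin ltW// hw.1.
  - by move=> t /sub It; rewrite mule_ge0 ?E0// lee_fin invr_ge0 ltW.
  - exact: measurable_funeM.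
  apply: leeD => //; rewrite ge0_integralZl//; last 2 first.
  - by move=> t /sub; exact: E0.
  - by rewrite lee_fin invr_ge0 ltW.
  rewrite EFinM -KE; apply: lee_wpmul2l; first by rewrite lee_fin invr_ge0 ltW.
  exact: ge0_subset_integral.
have li : 0 <= (l^-1)%:E by rewrite lee_fin invr_ge0 ltW.
have := lee_wpmul2l li h.
have W0 : 0 <= \int[mu]_(t in oitv 0%R x%:E) (w t)%:E.
  by apply: integral_ge0 => t /sub It; rewrite lee_fin ltW// hw.1.
have K1 : 0 <= ((phi 1)^-1 * K)%:E by rewrite lee_fin mulr_ge0// invr_ge0 ltW.
rewrite (ge0_muleDr _ W0 K1) muleA -!EFinM mulVf ?mul1e//.
by rewrite gt_eqF.
Qed.

End modular.

(** * Level functions *)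

Section level_function.
Context {R : realType}.
Variables (a : \bar R) (w f : R -> R).
Local Open Scope ereal_scope.
Local Notation mu := (@lebesgue_measure R).
Local Notation I := (oitv 0%R a).

Hypothesis a0 : 0 < a.
Hypothesis hw : decreasing_weight I w.
Hypothesis hW : forall t, I t -> \int[mu]_(s in oitv 0%R t%:E) (w s)%:E < +oo.
Hypothesis hf : forall t, I t -> \int[mu]_(s in oitv 0%R t%:E) rearrangement I f s < +oo.

(* Vanishing outside [I] makes the primitives of [wI] and [fI] meaningful up to the
   right end of [I], which level intervals may reach. *)
Definition wI (t : R) : R := if t \in I then w t else 0%R.
Definition fI (t : R) : R := if t \in I then fine (rearrangement I f t) else 0%R.
Definition Wint : R -> R := primitive wI.
Definition Fint : R -> R := primitive fI.
Definition slp (t : R) : R := slope a Fint Wint t.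

Hypothesis hgrowth : a = +oo -> exists C1 C2 : R, [/\ (0 <= C1)%R, (0 <= C2)%R &
  forall x : R, (0 < x)%R -> (Fint x <= C1 * Wint x + C2)%R].

Lemma wIE t : I t -> wI t = w t. Proof. by move=> It; rewrite /wI mem_set. Qed.

Lemma wI_ge0 t : (0 <= wI t)%R.
Proof. by rewrite /wI; case: ifPn => // /set_mem It; apply/ltW/hw.1. Qed.

Lemma wI_gt0 t : I t -> (0 < wI t)%R.
Proof. by move=> It; rewrite wIE//; exact: hw.1. Qed.

Lemma wI_antimono s t : I s -> I t -> (s <= t)%R -> (wI t <= wI s)%R.
Proof. by move=> Is It st; rewrite !wIE//; exact: hw.2. Qed.

Lemma oitv_sub0 x (y : R) : I y -> (0 <= x)%R -> oitv x y%:E `<=` I.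
Proof.
move=> [y0 ya] x0 t [xt ty]; split; first exact: le_lt_trans xt.
exact: lt_trans ya.
Qed.

Lemma oitv_le_sub x (y : R) : y%:E <= a -> (0 <= x)%R -> oitv x y%:E `<=` I.
Proof.
move=> ya x0 t [xt ty]; split; first exact: le_lt_trans xt.
exact: lt_le_trans ya.
Qed.

(** An infinite value at [t] would persist on [(0, t)] and make the integral there infinite. *)
Lemma rearrangement_fin t : I t -> rearrangement I f t = (fI t)%:E.
Proof.
move=> It; rewrite /fI mem_set// fineK// ge0_fin_numE ?rearrangement_ge0//.
rewrite ltey; apply/negP => /eqP ty; have [t0 ta] := It.
have := hf _ It; rewrite ltNge => /negP; apply.
apply: (@le_trans _ _ (\int[mu]_(s in oitv 0%R t%:E) (cst +oo s))).
  rewrite integral_cst; last exact: measurable_oitv.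
  rewrite oitvE [X in _ * X](_ : _ = lebesgue_measure `]0%R, t[%classic)//.
  by rewrite lebesgue_measure_itv/= lte_fin t0 sube0 gt0_mulye.
apply: ge0_le_integral.
- exact: measurable_oitv.
- by move=> s _; rewrite /= leey.
- exact: measurable_cst.
- apply: measurable_funS (measurable_rearrangement _ _ _) => //.
    exact: measurable_oitv.
  exact: oitv_sub0.
- move=> s [_]; rewrite lte_fin => st; rewrite -ty; apply: rearrangement_antimono.
  exact: ltW.
Qed.

Lemma fI_ge0 t : (0 <= fI t)%R.
Proof. by rewrite /fI; case: ifPn => // _; rewrite fine_ge0// rearrangement_ge0. Qed.

Lemma fI_antimono s t : I s -> I t -> (s <= t)%R -> (fI t <= fI s)%R.
Proof.
by move=> Is It st; rewrite -lee_fin -!rearrangement_fin//; exact: rearrangement_antimono.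
Qed.

Lemma antimono_measurable (g : R -> R) : (forall t, ~ I t -> g t = 0%R) ->
  (forall s t, I s -> I t -> (s <= t)%R -> (g t <= g s)%R) ->
  measurable_fun [set: R] g.
Proof.
move=> gI dg; have mI := measurable_oitv 0%R a.
have -> : g = (g \_ I).
  apply/funext => t; rewrite patchE; case: ifPn => //.
  by rewrite notin_setE => /gI.
apply: (measurable_restrictT g mI).1; apply/measurable_EFinP.
apply: (measurable_antimono (oitv 0%R a) (EFin \o g)); first exact: oitv_is_interval.
by move=> s t Is It st; rewrite lee_fin dg.
Qed.

Lemma wI_out t : ~ I t -> wI t = 0%R.
Proof. by move=> It; rewrite /wI memNset. Qed.

Lemma fI_out t : ~ I t -> fI t = 0%R.
Proof. by move=> It; rewrite /fI memNset. Qed.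

Lemma measurable_wI : measurable_fun [set: R] wI.
Proof. by apply: antimono_measurable; [exact: wI_out|exact: wI_antimono]. Qed.

Lemma measurable_fI : measurable_fun [set: R] fI.
Proof. by apply: antimono_measurable; [exact: fI_out|exact: fI_antimono]. Qed.

Lemma integral_wIE (x y : R) : (0 <= x)%R -> y%:E <= a ->
  \int[mu]_(t in oitv x y%:E) (w t)%:E = \int[mu]_(t in oitv x y%:E) (wI t)%:E.
Proof.
move=> x0 ya; apply: eq_integral => t /set_mem ht; rewrite wIE//.
exact: oitv_le_sub ht.
Qed.

Lemma integral_fIE (x y : R) : (0 <= x)%R -> y%:E <= a ->
  \int[mu]_(t in oitv x y%:E) rearrangement I f t = \int[mu]_(t in oitv x y%:E) (fI t)%:E.
Proof.
move=> x0 ya; apply: eq_integral => t /set_mem ht; rewrite rearrangement_fin//.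
exact: oitv_le_sub ht.
Qed.

Lemma wI_fin (x : R) : x%:E <= a -> \int[mu]_(t in oitv 0%R x%:E) (wI t)%:E < +oo.
Proof.
apply: finite_integral_oitv; [exact: measurable_wI|exact: wI_ge0|exact: wI_out|exact: wI_antimono|].
by move=> t It; rewrite -integral_wIE ?hW// ltW//; case: It.
Qed.

Lemma fI_fin (x : R) : x%:E <= a -> \int[mu]_(t in oitv 0%R x%:E) (fI t)%:E < +oo.
Proof.
apply: finite_integral_oitv; [exact: measurable_fI|exact: fI_ge0|exact: fI_out|exact: fI_antimono|].
by move=> t It; rewrite -integral_fIE ?hf// ltW//; case: It.
Qed.

Lemma int_w (x y : R) : (0 <= x)%R -> (x <= y)%R -> y%:E <= a ->
  \int[mu]_(t in oitv x y%:E) (w t)%:E = (Wint y - Wint x)%:E.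
Proof.
move=> x0 xy ya; rewrite integral_wIE//.
exact: primitive_diff measurable_wI wI_ge0 wI_fin _ _ x0 xy ya.
Qed.

Lemma int_f (x y : R) : (0 <= x)%R -> (x <= y)%R -> y%:E <= a ->
  \int[mu]_(t in oitv x y%:E) rearrangement I f t = (Fint y - Fint x)%:E.
Proof.
move=> x0 xy ya; rewrite integral_fIE//.
exact: primitive_diff measurable_fI fI_ge0 fI_fin _ _ x0 xy ya.
Qed.

Lemma F_cont q : (0 <= q)%R -> q%:E <= a -> {within `[0%R, q], continuous Fint}.
Proof. exact: primitive_continuous measurable_fI fI_ge0 fI_fin _. Qed.

Lemma W_cont q : (0 <= q)%R -> q%:E <= a -> {within `[0%R, q], continuous Wint}.
Proof. exact: primitive_continuous measurable_wI wI_ge0 wI_fin _. Qed.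

Lemma F_0 : Fint 0%R = 0%R. Proof. exact: primitive0. Qed.

Lemma W_0 : Wint 0%R = 0%R. Proof. exact: primitive0. Qed.

Lemma F_nd x y : (0 <= x)%R -> (x <= y)%R -> y%:E <= a -> (Fint x <= Fint y)%R.
Proof. exact: primitive_nd measurable_fI fI_ge0 fI_fin _ _. Qed.

Lemma oitv_between x y t : (0 <= x)%R -> y%:E <= a -> (x < t < y)%R -> I t.
Proof.
move=> x0 ya /andP[xt ty]; split; first exact: le_lt_trans xt.
by apply: lt_le_trans ya; rewrite lte_fin.
Qed.

Lemma W_inc x y : (0 <= x)%R -> (x < y)%R -> y%:E <= a -> (Wint x < Wint y)%R.
Proof.
(* The midpoint lies in [I], whereas [y] may be the right end, where [wI] vanishes. *)
move=> x0 xy ya; pose z := ((x + y) / 2)%R.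
have xz : (x < z)%R by rewrite /z; lra.
have zy : (z < y)%R by rewrite /z; lra.
have Iz : I z by apply: (oitv_between x y) => //; rewrite xz.
have za : z%:E <= a by apply: ltW; case: Iz.
apply: (@lt_le_trans _ _ (Wint z)); last first.
  by apply: primitive_nd ya; [exact: measurable_wI|exact: wI_ge0|exact: wI_fin|
    rewrite (le_trans x0)// ltW|exact: ltW].
have := primitive_ge _ _ measurable_wI wI_ge0 wI_fin (wI z) x z x0 (ltW xz) za.
have := wI_gt0 z Iz.
move=> z0 h; rewrite -subr_gt0; apply: lt_le_trans (h _).
  by rewrite mulr_gt0// subr_gt0.
move=> t /andP[xt tz]; apply: wI_antimono => //; last exact: ltW.
by apply: (oitv_between x y) => //; rewrite xt (lt_trans tz).
Qed.

(** For finite [a] the nondecreasing [Fint] is bounded by its value at the right end. *)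
Lemma FW_growth : exists C1 C2 : R, [/\ (0 <= C1)%R, (0 <= C2)%R &
  forall x, (0 <= x)%R -> x%:E <= a -> (Fint x <= C1 * Wint x + C2)%R].
Proof.
move: a0 hgrowth F_nd; case: (a) => [b| |//] b0 hg nd.
  exists 0%R, (Fint b); split => //.
    by rewrite -F_0; apply: nd => //; rewrite ltW.
  by move=> x x0 xb; rewrite mul0r add0r; apply: nd.
have [//|C1 [C2 [h1 h2 h3]]] := hg; exists C1, C2; split => // x.
rewrite le_eqVlt => /predU1P[<- _|x0 _]; last exact: h3.
by rewrite F_0 W_0 mulr0 add0r.
Qed.

Let Wnd := ndW a Wint W_inc.

(** * Level intervals in terms of ratios and in terms of tilts *)

Lemma ratio_fin (x y : R) : (0 <= x)%R -> (x < y)%R -> y%:E <= a ->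
  level_ratio_fin I w f x y = ((Fint y - Fint x) / (Wint y - Wint x))%:E.
Proof.
move=> x0 xy ya; rewrite /level_ratio_fin int_f ?int_w//; [|exact: ltW..].
by rewrite inver gt_eqF -?EFinM// subr_gt0 W_inc.
Qed.

Lemma ratio_le (x y r : R) : (0 <= x)%R -> (x < y)%R -> y%:E <= a ->
  (level_ratio_fin I w f x y <= r%:E) = (Fint y - Fint x <= r * (Wint y - Wint x))%R.
Proof.
move=> x0 xy ya; rewrite ratio_fin// lee_fin ler_pdivrMr// subr_gt0.
exact: W_inc.
Qed.

Lemma ratio_gt (x y r : R) : (0 <= x)%R -> (x < y)%R -> y%:E <= a ->
  (r%:E < level_ratio_fin I w f x y) = (r * (Wint y - Wint x) < Fint y - Fint x)%R.
Proof. by move=> x0 xy ya; rewrite ltNge ratio_le// -ltNge. Qed.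

Lemma oitv_sub (x x' : R) (c c' : \bar R) : x%:E < c ->
  oitv x c `<=` oitv x' c' -> (x' <= x)%R /\ c <= c'.
Proof.
move=> xc sub; have key (y z : R) : (y < z)%R -> exists2 t, (y < t)%R & (t < z)%R.
  by move=> yz; exists ((y + z) / 2)%R; lra.
have [y [xy yc]] : exists y : R, (x < y)%R /\ y%:E < c.
  clear sub; case: c xc => [b|_|//]; last by exists (x + 1)%R; rewrite ltry; lra.
  by rewrite lte_fin => /key[t ? ?]; exists t; rewrite lte_fin.
split.
  rewrite leNgt; apply/negP => xx'.
  have [t xt tm] : exists2 t, (x < t)%R & (t < Num.min x' y)%R.
    by apply: key; rewrite lt_min xx'.
  have tc : t%:E < c by apply: lt_trans yc; rewrite lte_fin (lt_le_trans tm)// ge_min lexx orbT.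
  have [] := sub t (conj xt tc); move=> + _; apply/negP; rewrite -leNgt ltW//.
  by rewrite (lt_le_trans tm)// ge_min lexx.
rewrite leNgt; apply/negP => c'c.
have [t xt [c't tc]] : exists2 t : R, (x < t)%R & c' <= t%:E /\ t%:E < c.
  clear sub; case: c' c'c => [b'|+|_]; [|by rewrite ltNge leey|]; last by exists y => //; rewrite leNye.
  case: c yc xc => [b|_ _ _|//].
    rewrite !lte_fin => yb xb b'b; exists (Num.max b' y); first by rewrite lt_max xy orbT.
    by rewrite lee_fin lte_fin le_max lexx gt_max b'b.
  exists (Num.max b' y); first by rewrite lt_max xy orbT.
  by rewrite lee_fin le_max lexx ltry.
have [_ ] := sub t (conj xt tc).
by rewrite ltNge c't.
Qed.

Lemma oitv_sub_le (x x' : R) (c c' : \bar R) : (x' <= x)%R -> c <= c' ->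
  oitv x c `<=` oitv x' c'.
Proof.
move=> xx cc t [xt tc]; split; first exact: le_lt_trans xt.
exact: lt_le_trans cc.
Qed.

(** For finite [c] both clauses of [level] pass to the end point by continuity; for [c = +oo] they
    are the two halves of the limsup being [r]. *)
Lemma levelP al c r : level a Fint Wint al c r -> level_ratio I w f al c = r%:E.
Proof.
move=> [al0 alc ca r0 [h1 h2]]; case: c alc ca h1 h2 => [b| |//].
  rewrite lte_fin => alb ba h1 h2 /=; rewrite ratio_fin//.
  have WW : (0 < Wint b - Wint al)%R by rewrite subr_gt0 W_inc.
  congr EFin; apply/le_anti/andP; split.
    rewrite ler_pdivrMr//; rewrite leNgt; apply/negP => lt.
    have lt' : (tilt Fint Wint r al < tilt Fint Wint r b)%R by move: lt; rewrite /tilt; nra.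
    have [y [aly yb hy]] := tilt_left_gt _ _ _ F_cont W_cont _ _ _ _ al0 alb ba lt'.
    have := h1 y aly; rewrite lte_fin => /(_ yb).
    by move: hy; rewrite /tilt; nra.
  rewrite ler_pdivlMr//; rewrite leNgt; apply/negP => lt.
  pose K := ((Fint b - Fint al) / (Wint b - Wint al))%R.
  have KE : (K * (Wint b - Wint al) = Fint b - Fint al)%R by rewrite divfK// gt_eqF.
  have Kr : (K < r)%R by rewrite -(ltr_pM2r WW) KE.
  have lt' : (tilt Fint Wint ((K + r) / 2) b < tilt Fint Wint ((K + r) / 2) al)%R.
    by move: lt; rewrite /tilt; nra.
  have [y [aly yb hy]] := tilt_left_lt _ _ _ F_cont W_cont _ _ _ _ al0 alb ba lt'.
  have r'r : ((K + r) / 2 < r)%R by lra.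
  have [z [yz zb hz]] := h2 _ _ r'r aly yb.
  by have := hy z yz zb; move: hz; rewrite /tilt; nra.
move=> _ ca h1 h2; have ay : a = +oo by apply/eqP; rewrite -leye_eq.
have ya (y : R) : y%:E <= a by rewrite ay leey.
rewrite /level_ratio limf_esupE; apply/le_anti/andP; split.
  apply: ereal_inf_le; exists (ereal_sup [set level_ratio_fin I w f al x | x in [set x | (al < x)%R]]).
    exists [set x | (al < x)%R] => //.
    by exists al; split => //; rewrite num_real.
  apply: ge_ereal_sup => _ [y /= aly <-]; rewrite ratio_le//.
  by apply: h1 => //; rewrite ltry.
apply: le_ereal_inf_tmp => _ [V [M [_ hM]] <-].
apply/lee_subgt0Pr => e e0.
have re : (r - e < r)%R by rewrite gtrBl.
have alM : (al <= Num.max al M)%R by rewrite le_max lexx.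
have [y [My _ hy]] := h2 _ _ re alM (ltry _).
move: My; rewrite gt_max => /andP[aly My].
apply: le_trans (ereal_sup_ubound _); last by exists y; [exact: hM|reflexivity].
by rewrite -EFinB ltW// ratio_gt.
Qed.

(** The delicate case is [c = +oo]: the limsup must be shown finite before it can serve as [r], and
    the growth bound does this. *)
Lemma level_intervalP al c : level_interval I w f al c <-> exists r, level a Fint Wint al c r.
Proof.
split; last first.
  move=> [r L]; have [al0 alc ca r0 [h1 h2]] := L; split => //.
  - by move=> t [alt tc]; split; [exact: le_lt_trans alt|exact: lt_le_trans ca].
  - by rewrite (levelP _ _ _ L) lte_fin.
  - move=> t [alt tc]; rewrite (levelP _ _ _ L) /=  ratio_le//; first exact: h1.
    exact: le_trans (ltW tc) ca.
move=> [al0 alc sub rho0 hle].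
have ca : c <= a := (oitv_sub _ _ _ _ alc sub).2.
have {}hle (t : R) : (al < t)%R -> t%:E < c -> level_ratio_fin I w f al t <= level_ratio I w f al c.
  by move=> h1 h2; apply: (hle t).
case: c alc ca sub rho0 hle => [b| |//].
  rewrite lte_fin => alb ba sub /=; rewrite ratio_fin// lte_fin => r0 hle.
  have WW : (0 < Wint b - Wint al)%R by rewrite subr_gt0 W_inc.
  set r := (_ / _)%R in r0 hle.
  have rE : (r * (Wint b - Wint al) = Fint b - Fint al)%R by rewrite divfK// gt_eqF.
  exists r; split => //; split.
    move=> y aly yb; rewrite -ratio_le//; first exact: hle.
    exact: le_trans (ltW yb) ba.
  move=> r' y0 r'r aly0; rewrite lte_fin => y0b.
  have h : (tilt Fint Wint r' al < tilt Fint Wint r' b)%R by rewrite /tilt; nra.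
  have [y [aly yb hy]] := tilt_left_gt _ _ _ F_cont W_cont _ _ _ _ (le_trans al0 aly0) y0b ba h.
  by exists y; rewrite lte_fin; split => //; move: hy; rewrite /tilt; nra.
move=> _ ca sub rho0 hle; have ay : a = +oo by apply/eqP; rewrite -leye_eq.
have ya (y : R) : y%:E <= a by rewrite ay leey.
have [C1 [C2 [C10 C20 hC]]] := FW_growth.
have W1 : (0 < Wint (al + 1) - Wint al)%R by rewrite subr_gt0 W_inc// ltrDl.
have WA : (0 <= Wint al)%R by rewrite -W_0; apply: Wnd.
(* For [y > al + 1] the increment of [Fint] is at most [C1 (W y - W al) + (C1 W al + C2)], and
   dividing the constant by [W (al + 1) - W al] makes it a multiple of [W y - W al]. *)
pose C := (C1 + (C1 * Wint al + C2) / (Wint (al + 1) - Wint al))%R.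
have rhoC : level_ratio I w f al +oo <= C%:E.
  rewrite /level_ratio limf_esupE.
  apply: ereal_inf_le; exists (ereal_sup [set level_ratio_fin I w f al x | x in [set x | (al + 1 < x)%R]]).
    exists [set x | (al + 1 < x)%R] => //.
    by exists (al + 1)%R; split => //; rewrite num_real.
  apply: ge_ereal_sup => _ [y /= aly <-]; rewrite ratio_le//; last by lra.
  have y0 : (0 <= y)%R by lra.
  have Wy : (Wint (al + 1) < Wint y)%R by apply: W_inc => //; lra.
  have := hC y y0 (ya y).
  have F0' : (0 <= Fint al)%R by rewrite -F_0; apply: F_nd.
  rewrite /C mulrDl => h.
  have : (C1 * Wint al + C2 <= (C1 * Wint al + C2) / (Wint (al + 1) - Wint al) * (Wint y - Wint al))%R.
    rewrite mulrAC ler_pdivlMr// ler_wpM2l ?addr_ge0 ?mulr_ge0//; lra.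
  lra.
have [r rE] : exists r, level_ratio I w f al +oo = r%:E.
  by case: (level_ratio I w f al +oo) rho0 rhoC => [r| |] // _ _; exists r.
rewrite rE lte_fin in rho0; exists r; split; rewrite ?ltry//; split.
  by move=> y aly yc; rewrite -ratio_le// -rE; exact: hle.
move=> r' y0 r'r aly0 _.
have : r'%:E < ereal_sup [set level_ratio_fin I w f al x | x in [set x | (y0 < x)%R]].
  apply: (@lt_le_trans _ _ r%:E); first by rewrite lte_fin.
  rewrite -rE /level_ratio limf_esupE; apply: ereal_inf_lbound.
  exists [set x | (y0 < x)%R] => //.
  by exists y0; split => //; rewrite num_real.
move/ereal_sup_gt => [_ [y /= y0y <-]] hy; exists y; split => //; first by rewrite ltry.
by rewrite -ratio_gt//; exact: le_lt_trans y0y.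
Qed.

Lemma maximal_level_intervalP al c : maximal_level_interval I w f al c <->
  exists r, maxlevel a Fint Wint al c r.
Proof.
split=> [[/level_intervalP[r L] hm]|[r [L hm]]].
  exists r; split => // al' c' r' L' alal cc.
  have LI : level_interval I w f al' c' by apply/level_intervalP; exists r'.
  have E := hm _ _ LI (oitv_sub_le _ _ _ _ alal cc).
  have [_ al'c' _ _ _] := L'.
  have [h1 h2] : (al <= al')%R /\ c' <= c by apply: oitv_sub => //; rewrite E.
  by split; apply/le_anti/andP.
split; first by apply/level_intervalP; exists r.
move=> al' c' /level_intervalP[r' L'] sub.
have [_ alc _ _ _] := L.
have [h1 h2] := oitv_sub _ _ _ _ alc sub.
by have [-> ->] := hm _ _ _ L' h1 h2.
Qed.

(** * The level function as slope times weight *)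

Definition leveled (t : R) : Prop := maximal_level_at I w f t !=set0.

Lemma leveledP t : leveled t <->
  exists al c, [/\ maxlevel a Fint Wint al c (slp t), (al < t)%R & t%:E < c].
Proof.
split=> [[[al c] [/maximal_level_intervalP[r m] [/= alt tc]]]|[al [c [m alt tc]]]].
  exists al, c; split => //.
  by rewrite /slp -(maxlevel_slope _ _ _ F_cont W_cont F_0 W_0 F_nd W_inc FW_growth _ _ _ _ m alt tc).
by exists (al, c); split => //=; apply/maximal_level_intervalP; exists (slp t).
Qed.

(** Any maximal level interval around [t] that [get] may pick has ratio [slp t]. *)
Lemma level_slopeE t : leveled t -> level_slope I w f t = slp t.
Proof.
rewrite /leveled /level_slope => -[p0 hp0].
have : maximal_level_at I w f t (get (maximal_level_at I w f t)) by apply: getPex; exists p0.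
case: (get _) => al c [/maximal_level_intervalP[r m] /= [alt tc]].
rewrite (levelP _ _ _ m.1)/=.
exact: (maxlevel_slope _ _ _ F_cont W_cont F_0 W_0 F_nd W_inc FW_growth _ _ _ _ m alt tc).
Qed.

Lemma slp_ge0 t : I t -> (0 <= slp t)%R.
Proof. by move=> [t0 ta]; apply: slope_ge0 F_0 W_0 W_inc FW_growth _ t0 (ltW ta). Qed.

Lemma slp_antimono s t : I s -> I t -> (s <= t)%R -> (slp t <= slp s)%R.
Proof.
by move=> [s0 _] [_ ta] st; apply: slope_antimono F_0 W_0 W_inc FW_growth _ _ s0 st (ltW ta).
Qed.

(** Here [t] maximizes its tilt everywhere. Bounding the increments over [(t, y)] by end values,
    [fI t > slp t w t] forces [fI y <= slp t w t] for all [y > t], a jump; the opposite inequality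
    gives a jump on the left. *)
Lemma unleveled_slope t : I t -> ~ jumps I fI t -> ~ leveled t -> fI t = (slp t * w t)%R.
Proof.
move=> It nj nl; have [t0 ta] := It.
have ht y : (0 <= y)%R -> y%:E <= a -> (tilt Fint Wint (slp t) y <= tilt Fint Wint (slp t) t)%R.
  apply: (tilt_le_slope _ _ _ F_cont W_cont F_0 W_0 F_nd W_inc FW_growth t t0 ta _ y).
  move=> al c r m alt tc; apply: nl; apply/leveledP; exists al, c; split => //.
  rewrite /slp.
  by rewrite -(maxlevel_slope _ _ _ F_cont W_cont F_0 W_0 F_nd W_inc FW_growth _ _ _ _ m alt tc).
have s0 := slp_ge0 _ It; have wt := wIE t It.
apply/le_anti/andP; split.
  rewrite leNgt; apply/negP => lt; apply: nj; split => //; exists (slp t * w t)%R; left.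
  split => // y Iy ty; have ya : y%:E <= a by apply: ltW; case: Iy.
  have := ht y (ltW (lt_trans t0 ty)) ya; rewrite /tilt => h.
  have yt : (0 < y - t)%R by rewrite subr_gt0.
  rewrite -(ler_pM2r yt).
  have h1 : (fI y * (y - t) <= Fint y - Fint t)%R.
    apply: (primitive_ge _ _ measurable_fI fI_ge0 fI_fin _ _ _ (ltW t0) (ltW ty) ya).
    move=> z /andP[tz zy]; apply: (fI_antimono _ _ _ _ (ltW zy)) => //.
    by apply: (oitv_between t y) => //; [exact: ltW|rewrite tz].
  have h2 : (Wint y - Wint t <= w t * (y - t))%R.
    apply: (primitive_le _ _ measurable_wI wI_ge0 wI_fin _ _ _ (ltW t0) (ltW ty) ya).
    move=> z /andP[tz zy]; rewrite -wt; apply: (wI_antimono _ _ _ _ (ltW tz)) => //.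
    by apply: (oitv_between t y) => //; [exact: ltW|rewrite tz].
  nra.
rewrite leNgt; apply/negP => lt; apply: nj; split => //; exists (slp t * w t)%R; right.
split => // y Iy yt; have [y0 _] := Iy; have ya := ltW ta.
have yt' : (0 < t - y)%R by rewrite subr_gt0.
have := ht y (ltW y0) (ltW (lt_trans (_ : y%:E < t%:E) ta)); rewrite lte_fin => /(_ yt).
rewrite /tilt => h; rewrite -(ler_pM2r yt').
have h1 : (Fint t - Fint y <= fI y * (t - y))%R.
  apply: (primitive_le _ _ measurable_fI fI_ge0 fI_fin _ _ _ (ltW y0) (ltW yt) ya).
  move=> z /andP[tz zy]; apply: (fI_antimono _ _ _ _ (ltW tz)) => //.
  by apply: (oitv_between y t) => //; [exact: ltW|rewrite tz].
have h2 : (w t * (t - y) <= Wint t - Wint y)%R.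
  apply: (primitive_ge _ _ measurable_wI wI_ge0 wI_fin _ _ _ (ltW y0) (ltW yt) ya).
  move=> z /andP[tz zy]; rewrite -wt; apply: (wI_antimono _ _ _ _ (ltW zy)) => //.
  by apply: (oitv_between y t) => //; [exact: ltW|rewrite tz].
nra.
Qed.

Lemma measurable_antimonoR (g : R -> R) :
  (forall s t, I s -> I t -> (s <= t)%R -> (g t <= g s)%R) -> measurable_fun I g.
Proof.
move=> dg; apply/measurable_EFinP.
apply: (measurable_antimono (oitv 0%R a)); first exact: oitv_is_interval.
by move=> s t Is It st; rewrite lee_fin dg.
Qed.

Lemma leveled_slp_gt0 t : leveled t -> (0 < slp t)%R.
Proof. by move=> /leveledP[al [c [[[]]]]]. Qed.

(** If [f^*] vanished at [t], [Fint] would be constant from [t] on inside the level interval, and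
    the ratios from its left end could not approach [r > 0]. This makes [w^f] positive. *)
Lemma leveled_fI_gt0 t : leveled t -> (0 < fI t)%R.
Proof.
move=> /leveledP[al [c [[L _] alt tc]]]; have [al0 alc ca r0 [h1 h2]] := L.
have t0 : (0 < t)%R by exact: le_lt_trans alt.
have ta : t%:E < a by exact: lt_le_trans ca.
have It : I t by [].
rewrite lt_neqAle fI_ge0 andbT; apply/eqP => fI0.
have flat y : (t < y)%R -> y%:E < c -> (Fint y - Fint t <= 0 * (Wint y - Wint t))%R.
  move=> ty yc; have ya : y%:E <= a by exact: le_trans (ltW yc) ca.
  have := primitive_le _ _ measurable_fI fI_ge0 fI_fin 0%R _ _ (ltW t0) (ltW ty) ya.
  rewrite !mul0r; apply => z tzy; rewrite fI0; have := tzy => /andP[tz _].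
  by apply: (fI_antimono _ _ _ _ (ltW tz)) => //; apply: (oitv_between t y) => //; exact: ltW.
have WW : (0 < Wint t - Wint al)%R by rewrite subr_gt0 W_inc// ltW.
have [FF|FF] := ltP 0%R (Fint t - Fint al)%R.
  apply: (level_chord _ _ _ W_inc _ _ _ _ t 0%R _ L alt (lexx _) tc _ _ flat).
    by apply: (divr_gt0 FF WW).
  by rewrite divfK// gt_eqF.
have [y [ty yc hy]] := h2 _ _ r0 (ltW alt) tc.
by have := flat y ty yc; rewrite !mul0r in hy *; lra.
Qed.

(** * The inverse level function is a decreasing weight *)

Let wf := inverse_level_fun I w f.

Lemma wf_leveled t : I t -> leveled t -> wf t = (fI t / slp t)%R.
Proof.
move=> It lt; rewrite /wf /inverse_level_fun ifT; last exact/asboolP.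
by rewrite rearrangement_fin//= level_slopeE.
Qed.

Lemma wf_unleveled t : ~ leveled t -> wf t = w t.
Proof. by move=> nl; rewrite /wf /inverse_level_fun ifF//; apply/asboolPn. Qed.

Lemma level_fun_leveled t : leveled t -> level_fun I w f t = (slp t * w t)%R.
Proof.
by move=> lt; rewrite /level_fun ifT; [rewrite level_slopeE|exact/asboolP].
Qed.

Lemma level_fun_unleveled t : I t -> ~ leveled t -> level_fun I w f t = fI t.
Proof.
move=> It nl; rewrite /level_fun ifF; last exact/asboolPn.
by rewrite rearrangement_fin.
Qed.

Lemma level_funE t : I t -> ~ jumps I fI t -> level_fun I w f t = (slp t * w t)%R.
Proof.
move=> It nj; have [l|l] := pselect (leveled t); first exact: level_fun_leveled.
by rewrite level_fun_unleveled//; exact: unleveled_slope.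
Qed.

Lemma wf_gt0 t : I t -> (0 < wf t)%R.
Proof.
move=> It; have [l|l] := pselect (leveled t); last by rewrite wf_unleveled//; exact: hw.1.
by rewrite wf_leveled// divr_gt0 ?leveled_fI_gt0 ?leveled_slp_gt0.
Qed.

(** On the end piece [(s, b)] of a finite level interval [Fint] gains at least [r] times what [Wint]
    gains, so [fI s (b - s) >= r w b (b - s)]; and [w y <= w b]. *)
Lemma wf_ge_right s al c y : maxlevel a Fint Wint al c (slp s) -> (al < s)%R -> s%:E < c ->
  I y -> c <= y%:E -> (w y <= fI s / slp s)%R.
Proof.
move=> [L _] als sc Iy cy; have [al0 alc ca r0 [h1 _]] := L.
move: L alc ca sc cy h1; case: c => [b| |//] L alc ca sc cy h1; last by rewrite leye_eq in cy.
rewrite !lte_fin in alc sc; rewrite lee_fin in cy.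
have Is : I s by apply: (oitv_between al b) => //; rewrite als.
have Ib : I b.
  split; first exact: le_lt_trans alc.
  by case: Iy => _; apply: le_lt_trans; rewrite lee_fin.
have := levelP _ _ _ L; rewrite /= ratio_fin// => -[rE].
have WW : (0 < Wint b - Wint al)%R by rewrite subr_gt0 W_inc.
have {}rE : (Fint b - Fint al = slp s * (Wint b - Wint al))%R by rewrite -rE divfK// gt_eqF.
have := h1 s als; rewrite lte_fin => /(_ sc) hs.
have s0 : (0 <= s)%R by apply: ltW; case: Is.
have k1 : (Fint b - Fint s <= fI s * (b - s))%R.
  apply: (primitive_le _ _ measurable_fI fI_ge0 fI_fin _ _ _ s0 (ltW sc) ca).
  move=> z /andP[sz zb]; apply: (fI_antimono _ _ _ _ (ltW sz)) => //.
  by apply: (oitv_between s b) => //; rewrite sz.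
have k2 : (w b * (b - s) <= Wint b - Wint s)%R.
  rewrite -wIE//.
  apply: (primitive_ge _ _ measurable_wI wI_ge0 wI_fin _ _ _ s0 (ltW sc) ca).
  move=> z /andP[sz zb]; apply: (wI_antimono _ _ _ _ (ltW zb)) => //.
  by apply: (oitv_between s b) => //; rewrite sz.
apply: (@le_trans _ _ (w b)); first exact: hw.2.
rewrite ler_pdivlMr// -(@ler_pM2r _ (b - s)%R) ?subr_gt0//.
nra.
Qed.

(** Mirror image: over the initial piece [(al, t)] the integral of [f^*] is at most [r] times that
    of [w]. *)
Lemma wf_le_left t al c s : maxlevel a Fint Wint al c (slp t) -> (al < t)%R -> t%:E < c ->
  I s -> (s <= al)%R -> (fI t / slp t <= w s)%R.
Proof.
move=> [L _] alt tc Is sal; have [al0 alc ca r0 [h1 _]] := L.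
have t0 : (0 < t)%R by exact: le_lt_trans alt.
have ta : t%:E < a by exact: lt_le_trans ca.
have It : I t by [].
have ht := h1 t alt tc.
have k1 : (fI t * (t - al) <= Fint t - Fint al)%R.
  apply: (primitive_ge _ _ measurable_fI fI_ge0 fI_fin _ _ _ al0 (ltW alt) (ltW ta)).
  move=> z /andP[sz zb]; apply: (fI_antimono _ _ _ _ (ltW zb)) => //.
  by apply: (oitv_between al t) => //; rewrite ?sz// ltW.
have k2 : (Wint t - Wint al <= w s * (t - al))%R.
  rewrite -wIE//.
  apply: (primitive_le _ _ measurable_wI wI_ge0 wI_fin _ _ _ al0 (ltW alt) (ltW ta)).
  move=> z /andP[sz zb]; apply: wI_antimono => //.
    by apply: (oitv_between al t) => //; rewrite ?sz// ltW.
  by rewrite (le_trans sal)// ltW.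
rewrite ler_pdivrMr// -(@ler_pM2r _ (t - al)%R) ?subr_gt0//.
nra.
Qed.

(** Within one level interval [w^f] is a multiple of [f^*]; across an end point the two preceding
    bounds pass through a value of [w]. *)
Lemma wf_antimono s t : I s -> I t -> (s <= t)%R -> (wf t <= wf s)%R.
Proof.
move=> Is It; rewrite le_eqVlt => /predU1P[->//|st].
have [ls|ls] := pselect (leveled s); have [lt|lt] := pselect (leveled t); last first.
- by rewrite !wf_unleveled//; apply: hw.2 => //; exact: ltW.
- rewrite (wf_unleveled _ ls) (wf_leveled _ It lt).
  have /leveledP[al [c [m alt tc]]] := lt.
  apply: (wf_le_left _ _ _ _ m alt tc Is); rewrite leNgt; apply/negP => als; apply: ls.
  apply/leveledP; exists al, c; split => //; last by apply: lt_trans tc; rewrite lte_fin.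
  have sc : s%:E < c by apply: lt_trans tc; rewrite lte_fin.
  rewrite /slp -(maxlevel_slope _ _ _ F_cont W_cont F_0 W_0 F_nd W_inc FW_growth _ _ _ _ m als sc).
  exact: m.
- rewrite (wf_unleveled _ lt) (wf_leveled _ Is ls).
  have /leveledP[al [c [m als sc]]] := ls.
  apply: (wf_ge_right _ _ _ _ m als sc It); rewrite leNgt; apply/negP => tc; apply: lt.
  apply/leveledP; exists al, c; split => //; last exact: lt_trans st.
  have alt : (al < t)%R by exact: lt_trans st.
  rewrite /slp -(maxlevel_slope _ _ _ F_cont W_cont F_0 W_0 F_nd W_inc FW_growth _ _ _ _ m alt tc).
  exact: m.
rewrite (wf_leveled _ Is ls) (wf_leveled _ It lt).
have /leveledP[al [c [m als sc]]] := ls.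
have /leveledP[al' [c' [m' alt tc']]] := lt.
have same : slp s = slp t -> (fI t / slp t <= fI s / slp s)%R.
  by move=> ->; rewrite ler_pM2r ?invr_gt0 ?leveled_slp_gt0//; apply: fI_antimono => //; exact: ltW.
have [tc|ct] := ltP t%:E c.
  apply: same.
  exact: (maxlevel_slope _ _ _ F_cont W_cont F_0 W_0 F_nd W_inc FW_growth _ _ _ _ m (lt_trans als st) tc).
move: m sc ct; case: c => [b| |//] m; last by rewrite leye_eq.
rewrite lte_fin lee_fin => sb bt.
have [bal|alb] := leP b al'.
  have [_ alb ba _ _] := m.1.
  have Ib : I b.
    split; first by case: Is => s0 _; exact: lt_trans sb.
    by case: It => _; apply: le_lt_trans; rewrite lee_fin.
  apply: (@le_trans _ _ (w b)).
    exact: (wf_le_left _ _ _ _ m' alt tc' Ib bal).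
  by apply: (wf_ge_right _ _ _ _ m als _ Ib); rewrite ?lte_fin// lee_fin.
(* A common point of the two overlapping maximal intervals; both ratios equal the slope there. *)
pose z := ((Num.max al' s + b) / 2)%R.
have mb : (Num.max al' s < b)%R by rewrite gt_max alb.
have [m1 m2] : (al' <= Num.max al' s)%R /\ (s <= Num.max al' s)%R by rewrite !le_max !lexx orbT.
have zb : (z < b)%R by rewrite /z; lra.
have alz : (al' < z)%R by rewrite /z; lra.
have alz' : (al < z)%R by apply: lt_trans als _; rewrite /z; lra.
have zc' : z%:E < c' by apply: lt_trans tc'; rewrite lte_fin (lt_le_trans zb).
apply: same; transitivity (slp z); last symmetry.
  by apply: (maxlevel_slope _ _ _ F_cont W_cont F_0 W_0 F_nd W_inc FW_growth _ _ _ _ m alz'); rewrite lte_fin.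
exact: (maxlevel_slope _ _ _ F_cont W_cont F_0 W_0 F_nd W_inc FW_growth _ _ _ _ m' alz zc').
Qed.

(** * Comparison of integrals along the peaks *)

Section peak_comparison.
Variables (x : R) (A B : R -> R).
Hypothesis Ix : I x.
Hypothesis mA : measurable_fun I A.
Hypothesis mB : measurable_fun I B.
Hypothesis A0 : forall t, I t -> (0 <= A t)%R.
Hypothesis B0 : forall t, I t -> (0 <= B t)%R.
Let pk := peak Fint Wint x.
Let J (v u : R) : set R := `]pk v, pk u]%classic.
Hypothesis AB : forall u v : R, (0 < u)%R -> (u < v)%R ->
  \int[mu]_(t in J v u) (A t)%:E <= (v / u)%:E * \int[mu]_(t in J v u) (B t)%:E.
Hypothesis AB0 : forall z, I z -> fI z = 0%R -> (A z <= B z)%R.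

Let x0 : (0 <= x)%R. Proof. by apply: ltW; case: Ix. Qed.
Let xa : x%:E <= a. Proof. by apply: ltW; case: Ix. Qed.

Let pk_le u v : (u < v)%R -> (pk v <= pk u)%R.
Proof. exact: (peak_antimono _ _ _ F_cont W_cont W_inc). Qed.

Let pk_bound u : (0 <= pk u <= x)%R.
Proof. exact: (peakP _ _ _ F_cont W_cont x u x0 xa).1. Qed.

Let sub_I (D : set R) : D `<=` `]0%R, x]%classic -> D `<=` I.
Proof.
move=> sub t /sub; rewrite /= in_itv/= => /andP[t0 tx]; split => //.
by case: Ix => _; apply: le_lt_trans; rewrite lee_fin.
Qed.

Let mJ v u : measurable (J v u). Proof. exact: measurable_itv. Qed.

Let J_sub v u : J v u `<=` `]0%R, x]%classic.
Proof.
move=> t; rewrite /J/= !in_itv/= => /andP[h1 h2].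
have /andP[h3 _] := pk_bound v; have /andP[_ h4] := pk_bound u.
by rewrite (le_lt_trans h3 h1) (le_trans h2 h4).
Qed.

Let mAE (D : set R) : D `<=` `]0%R, x]%classic -> measurable_fun D (fun t => (A t)%:E).
Proof.
move=> sub; apply/measurable_EFinP; apply: measurable_funS mA; last exact: sub_I.
exact: measurable_oitv.
Qed.

Let mBE (D : set R) : D `<=` `]0%R, x]%classic -> measurable_fun D (fun t => (B t)%:E).
Proof.
move=> sub; apply/measurable_EFinP; apply: measurable_funS mB; last exact: sub_I.
exact: measurable_oitv.
Qed.

Let AE0 (D : set R) : D `<=` `]0%R, x]%classic -> forall t, D t -> 0 <= (A t)%:E.
Proof. by move=> sub t /(sub_I _ sub) It; rewrite lee_fin A0. Qed.

Let BE0 (D : set R) : D `<=` `]0%R, x]%classic -> forall t, D t -> 0 <= (B t)%:E.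
Proof. by move=> sub t /(sub_I _ sub) It; rewrite lee_fin B0. Qed.

Let J_split (G : R -> R) (u v' v : R) : (u < v')%R -> (v' < v)%R ->
  (forall D, D `<=` `]0%R, x]%classic -> measurable_fun D (fun t => (G t)%:E)) ->
  (forall D, D `<=` `]0%R, x]%classic -> forall t, D t -> 0 <= (G t)%:E) ->
  \int[mu]_(t in J v u) (G t)%:E =
  \int[mu]_(t in J v v') (G t)%:E + \int[mu]_(t in J v' u) (G t)%:E.
Proof.
move=> uv vv mG G0.
have JE : J v u = J v v' `|` J v' u.
  by rewrite /J (@itv_bndbnd_setU _ _ (BRight (pk v)) (BRight (pk v')))// bnd_simp pk_le.
rewrite JE ge0_integral_setU//; [exact: mJ|exact: mJ| | |].
- by apply: mG; rewrite -JE; exact: J_sub.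
- by move=> t; rewrite -JE; exact: (G0 _ (J_sub _ _)).
- apply/disj_setPS => t []; rewrite /J/= !in_itv/= => /andP[_ tx] /andP[xt _].
  by move: xt; rewrite ltNge tx.
Qed.

(* Chaining the hypothesis along the geometric grid [u * q ^+ n] replaces the
   ratio [v / u] by any [q > 1]. *)
Let peak_geometric (q u v : R) : (1 < q)%R -> (0 < u)%R -> (u < v)%R ->
  \int[mu]_(t in J v u) (A t)%:E <= q%:E * \int[mu]_(t in J v u) (B t)%:E.
Proof.
move=> q1 u0; have q0 : (0 < q)%R by lra.
have step (u' v' : R) : (0 < u')%R -> (u' < v')%R -> (v' <= u' * q)%R ->
    \int[mu]_(t in J v' u') (A t)%:E <= q%:E * \int[mu]_(t in J v' u') (B t)%:E.
  move=> u'0 uv vq; apply: le_trans (AB _ _ u'0 uv) _; apply: lee_wpmul2r.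
    by apply: integral_ge0 => t; exact: (BE0 _ (J_sub _ _)).
  by rewrite lee_fin ler_pdivrMr// mulrC.
have key n : (v <= u * q ^+ n.+1)%R -> (u < v)%R ->
    \int[mu]_(t in J v u) (A t)%:E <= q%:E * \int[mu]_(t in J v u) (B t)%:E.
  elim: n v => [|n IH] v vn uv; first by apply: step.
  have [vn'|vn'] := leP v (u * q ^+ n.+1)%R; first exact: IH.
  have un : (u < u * q ^+ n.+1)%R by rewrite ltr_pMr// exprn_egt1.
  rewrite (J_split A u (u * q ^+ n.+1) v)// (J_split B u (u * q ^+ n.+1) v)//.
  rewrite ge0_muleDr; [|by apply: integral_ge0 => t; exact: (BE0 _ (J_sub _ _))..].
  apply: leeD; last exact: IH.
  apply: step => //; first by rewrite mulr_gt0// exprn_gt0.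
  by rewrite -mulrA -exprSr.
move=> uv; have [n hn] : exists n, (v <= u * q ^+ n.+1)%R.
  have q10 : (0 < q - 1)%R by lra.
  pose n := Num.truncn (v / u / (q - 1)).
  exists n; rewrite -ler_pdivrMl// mulrC.
  (* Bernoulli's inequality: finitely many steps of ratio [q] reach [v]. *)
  have bern : (1 + n.+1%:R * (q - 1) <= q ^+ n.+1)%R.
    elim: (n.+1) => [|k IH]; first by rewrite mul0r addr0 expr0.
    have h1 : (q * (1 + k%:R * (q - 1)) <= q * q ^+ k)%R by rewrite ler_pM2l.
    have h2 : (0 <= k%:R * ((q - 1) * (q - 1)))%R by rewrite !mulr_ge0// ltW.
    by rewrite exprS -natr1; lra.
  apply: le_trans bern.
  have : (v / u / (q - 1) < n.+1%:R)%R by rewrite truncnS_gt.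
  by rewrite ltr_pdivrMr//; lra.
exact: key hn uv.
Qed.

(** Let [q] tend to 1: if the right side is a finite [b], the choice [q = 1 + e / (b + 1)] costs at
    most [e]. *)
Let peak_le (u v : R) : (0 < u)%R -> (u < v)%R ->
  \int[mu]_(t in J v u) (A t)%:E <= \int[mu]_(t in J v u) (B t)%:E.
Proof.
move=> u0 uv.
have Bge0 : 0 <= \int[mu]_(t in J v u) (B t)%:E.
  by apply: integral_ge0 => t; exact: (BE0 _ (J_sub _ _)).
have hq := fun q (q1 : (1 < q)%R) => peak_geometric q u v q1 u0 uv.
move: Bge0 hq; case: (\int[mu]_(t in J v u) (B t)%:E) => [b| |//] Bge0 hq; last by rewrite leey.
rewrite lee_fin in Bge0; apply/lee_addgt0Pr => e e0.
have b1 : (0 < b + 1)%R by lra.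
have eb : (0 < e / (b + 1))%R by rewrite divr_gt0.
have := hq (1 + e / (b + 1))%R; rewrite ltrDl eb => /(_ isT) /le_trans; apply.
rewrite -EFinM -EFinD lee_fin mulrDl mul1r lerD2l mulrAC ler_pdivrMr//.
by rewrite ler_pM2l//; lra.
Qed.

(** The part of [(0, x]] swept by peaks of positive parameters. The index [n.+2] keeps the lower
    parameter below the upper one already at [n = 0]. *)
Let U : set R := \bigcup_n J n.+1%:R (n.+2%:R^-1).

Let inv_lt n : (n.+2%:R^-1 < n.+1%:R :> R)%R.
Proof.
by rewrite (@lt_le_trans _ _ 1%R)// ?ler1n// invf_lt1 ?ltr1n.
Qed.

Let U_nd : nondecreasing_seq (fun n => J n.+1%:R (n.+2%:R^-1)).
Proof.
apply/nondecreasing_seqP => n; rewrite subsetEset => t; rewrite /J/= !in_itv/= => /andP[h1 h2].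
have h3 : (pk n.+2%:R <= pk n.+1%:R)%R by apply: pk_le; rewrite ltr_nat.
have h4 : (pk n.+2%:R^-1 <= pk n.+3%:R^-1)%R.
  by apply: pk_le; rewrite ltf_pV2 ?posrE// ltr_nat.
by rewrite (le_lt_trans h3 h1) (le_trans h2 h4).
Qed.

Let U_sub : U `<=` `]0%R, x]%classic.
Proof. by move=> t [n _ /J_sub]. Qed.

Let int_U (G : R -> R) :
  (forall D, D `<=` `]0%R, x]%classic -> measurable_fun D (fun t => (G t)%:E)) ->
  (forall D, D `<=` `]0%R, x]%classic -> forall t, D t -> 0 <= (G t)%:E) ->
  \int[mu]_(t in J n.+1%:R (n.+2%:R^-1)) (G t)%:E @[n --> \oo] -->
  \int[mu]_(t in U) (G t)%:E.
Proof.
move=> mG G0; apply: ge0_nondecreasing_set_cvg_integral => //.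
- by move=> i; exact: measurable_itv.
- by move=> i; apply: mG; exact: J_sub.
- by move=> i t; exact: (G0 _ (J_sub _ _)).
Qed.

Let le_U : \int[mu]_(t in U) (A t)%:E <= \int[mu]_(t in U) (B t)%:E.
Proof.
have cA := int_U _ mAE AE0; have cB := int_U _ mBE BE0.
rewrite -(cvg_lim _ cA)// -(cvg_lim _ cB)//; apply: lee_lim.
- by apply/cvg_ex; eexists; exact: cA.
- by apply/cvg_ex; eexists; exact: cB.
- by apply: nearW => n; apply: peak_le.
Qed.

(** Peaks of large parameter lie left of [z], so a point missed by [U] has every peak at or before
    it, and [Fint] is flat from there on. *)
Let outside z : (`]0%R, x] `\` U) z -> Fint x = Fint z.
Proof.
move=> [/=]; rewrite in_itv/= => /andP[z0 zx] nU.
have za : z%:E <= a by apply: le_trans xa; rewrite lee_fin.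
have Wz : (0 < Wint z)%R by rewrite -W_0 W_inc.
have [N hN] : exists N, forall n, (N <= n)%N -> (pk n.+1%:R < z)%R.
  exists (Num.truncn (Fint x / Wint z)) => n Nn; rewrite ltNge; apply/negP => zp.
  have h1 := peak_small _ _ _ F_cont W_cont F_0 W_0 F_nd x n.+1%:R x0 xa (ler0n _ _).
  have h2 : (Wint z <= Wint (pk n.+1%:R))%R.
    apply: Wnd => //; first exact: ltW.
    by apply: le_trans xa; rewrite lee_fin; case/andP: (pk_bound n.+1%:R).
  have : (Fint x / Wint z < n.+1%:R)%R.
    by apply: lt_le_trans (truncnS_gt _) _; rewrite ler_nat.
  rewrite ltr_pdivrMr// => h3.
  have : (n.+1%:R * Wint z <= n.+1%:R * Wint (pk n.+1%:R))%R by rewrite ler_pM2l.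
  rewrite -/pk in h1; lra.
have x0' : (0 < x)%R by exact: lt_le_trans zx.
apply: (flat_after_peaks _ _ _ F_cont W_cont W_0 F_nd W_inc _ _ x0' xa zx) => u u0.
pose n := maxn N (Num.truncn u^-1).
have nu : (n.+2%:R^-1 < u)%R.
  rewrite invf_plt ?posrE//; apply: lt_trans (truncnS_gt _) _.
  by rewrite ltr_nat ltnS ltnS leq_maxr.
apply: le_trans (pk_le _ _ nu) _.
rewrite leNgt; apply/negP => h; apply: nU; exists n => //.
by rewrite /J/= in_itv/= hN ?leq_maxl// ltW.
Qed.

(** Off [U] the function [f^*] vanishes almost everywhere, and [AB0] compares [A] and [B]
    pointwise. *)
Lemma peak_comparison :
  \int[mu]_(t in oitv 0%R x%:E) (A t)%:E <= \int[mu]_(t in oitv 0%R x%:E) (B t)%:E.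
Proof.
have mU : measurable U by apply: bigcup_measurable => n _; exact: measurable_itv.
have sub0 : oitv 0%R x%:E `<=` `]0%R, x]%classic.
  by rewrite oitvE => t; rewrite /= !in_itv/= => /andP[-> /ltW].
have E (G : R -> R) :
  (forall D, D `<=` `]0%R, x]%classic -> measurable_fun D (fun t => (G t)%:E)) ->
  (forall D, D `<=` `]0%R, x]%classic -> forall t, D t -> 0 <= (G t)%:E) ->
  \int[mu]_(t in oitv 0%R x%:E) (G t)%:E =
  \int[mu]_(t in U) (G t)%:E + \int[mu]_(t in `]0%R, x] `\` U) (G t)%:E.
  move=> mG G0; have mG' := mG _ sub0; rewrite oitvE in mG'.
  rewrite oitvE (integral_itv_bndo_bndc mG').
  have DE := setDUK U_sub.
  rewrite -[in LHS]DE ge0_integral_setU.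
  - by [].
  - exact: mU.
  - by apply: measurableD => //; exact: measurable_itv.
  - by rewrite DE; exact: mG.
  - by move=> t; rewrite DE => Dt; exact: (G0 _ (fun _ h => h) _ Dt).
  - by apply/disj_setPS => t [Ut [_ nUt]]; exact: nUt.
rewrite (E A mAE AE0) (E B mBE BE0); apply: leeD; first exact: le_U.
have subD : `]0%R, x] `\` U `<=` `]0%R, x]%classic by move=> t [].
apply: ae_ge0_le_integral.
- by apply: measurableD => //; exact: measurable_itv.
- by move=> t; exact: (AE0 _ subD).
- exact: (mAE _ subD).
- by move=> t; exact: (BE0 _ subD).
- exact: (mBE _ subD).
(* Two missed points [z < y] have equal values of [Fint], which forces [fI y = 0]; only a leftmost
   missed point can escape. *)
pose X := [set z | (`]0%R, x] `\` U) z /\ fI z <> 0%R].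
have [z0 Xz0] : exists z0, X `<=` [set z0].
  have [->|/set0P[z0 Xz0]] := eqVneq X set0; first by exists 0%R.
  have far z y : (`]0%R, x] `\` U) z -> X y -> (z < y)%R -> False.
    move=> Dz [Dy ny] zy; apply: ny; have Iz := sub_I _ subD _ Dz; have Iy := sub_I _ subD _ Dy.
    have ya : y%:E <= a by apply: ltW; case: Iy.
    have z0' : (0 <= z)%R by apply: ltW; case: Iz.
    have := outside _ Dz; rewrite (outside _ Dy) => Fyz.
    have h : (fI y * (y - z) <= Fint y - Fint z)%R.
      apply: (primitive_ge _ _ measurable_fI fI_ge0 fI_fin _ _ _ z0' (ltW zy) ya).
      move=> t /andP[zt ty]; apply: (fI_antimono _ _ _ _ (ltW ty)) => //.
      by apply: (oitv_between z y) => //; rewrite zt.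
    rewrite Fyz subrr in h; apply/le_anti; rewrite fI_ge0 andbT.
    by rewrite -(@ler_pM2r _ (y - z)%R) ?subr_gt0// mul0r.
  exists z0 => y Xy /=; have [h|h|//] := ltgtP z0 y; exfalso.
    by apply: (far z0 y) => //; case: Xz0.
  by apply: (far y z0) => //; case: Xy.
exists [set z0]; split; [exact: measurable_set1|exact: lebesgue_measure_set1|].
move=> z /= /not_implyP[Dz nAB]; apply: Xz0; split => // fz; apply: nAB.
by rewrite lee_fin; apply: AB0 => //; exact: (sub_I _ subD _ Dz).
Qed.

End peak_comparison.

(** * Submajorization of [f] by its level function and of [w^f] by [w] *)

Definition hI (t : R) : R := if t \in I then (slp t * w t)%R else 0%R.

Lemma hIE t : I t -> hI t = (slp t * w t)%R.
Proof. by move=> It; rewrite /hI mem_set. Qed.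

Lemma hI_ge0 t : (0 <= hI t)%R.
Proof.
rewrite /hI; case: ifPn => // /set_mem It.
by rewrite mulr_ge0 ?slp_ge0//; exact/ltW/hw.1.
Qed.

Lemma hI_antimono s t : I s -> I t -> (s <= t)%R -> (hI t <= hI s)%R.
Proof.
move=> Is It st; rewrite !hIE//; apply: ler_pM.
- exact: slp_ge0.
- exact/ltW/hw.1.
- exact: slp_antimono.
- exact: hw.2.
Qed.

Lemma measurable_hI : measurable_fun I hI.
Proof. exact: measurable_antimonoR hI_antimono. Qed.

Lemma peak_itv_integral (g : R -> R) (v u x : R) : I x ->
  measurable_fun I g ->
  \int[mu]_(t in `]peak Fint Wint x v, peak Fint Wint x u]) (g t)%:E =
  \int[mu]_(t in oitv (peak Fint Wint x v) (peak Fint Wint x u)%:E) (g t)%:E.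
Proof.
move=> [x0 xa] mg.
have [/andP[p0 px] _] := peakP _ _ _ F_cont W_cont x v (ltW x0) (ltW xa).
have [/andP[q0 qx] _] := peakP _ _ _ F_cont W_cont x u (ltW x0) (ltW xa).
rewrite -integral_itv_bndo_bndc -?oitvE//.
apply/measurable_EFinP; apply: measurable_funS mg; first exact: measurable_oitv.
by apply: oitv_le_sub => //; apply: le_trans (ltW xa); rewrite lee_fin.
Qed.

Lemma peak_slp x v u t : I x -> (0 < u)%R ->
  oitv (peak Fint Wint x v) (peak Fint Wint x u)%:E t -> I t /\ (u <= slp t)%R.
Proof.
move=> [x0 xa] u0 [h1 h2].
have [/andP[p0 px] _] := peakP _ _ _ F_cont W_cont x v (ltW x0) (ltW xa).
have [/andP[q0 qx] _] := peakP _ _ _ F_cont W_cont x u (ltW x0) (ltW xa).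
have t0 : (0 < t)%R by exact: le_lt_trans h1.
split; first by split => //; apply: lt_trans h2 _; apply: le_lt_trans xa; rewrite lee_fin.
apply: (slope_lt_peak _ _ _ F_cont W_cont F_0 W_0 W_inc FW_growth x u t (ltW xa) (ltW u0) t0).
by rewrite -lte_fin.
Qed.

Lemma peak_Fint_Wint x u v : I x -> (0 < u)%R -> (u < v)%R ->
  [/\ (0 <= peak Fint Wint x v)%R,
      (peak Fint Wint x v <= peak Fint Wint x u)%R,
      (peak Fint Wint x u)%:E <= a &
      (Fint (peak Fint Wint x u) - Fint (peak Fint Wint x v) <=
       v * (Wint (peak Fint Wint x u) - Wint (peak Fint Wint x v)))%R].
Proof.
move=> [x0 xa] u0 uv.
have [/andP[p0 px] _] := peakP _ _ _ F_cont W_cont x v (ltW x0) (ltW xa).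
have [/andP[q0 qx] _] := peakP _ _ _ F_cont W_cont x u (ltW x0) (ltW xa).
split => //.
- exact: (peak_antimono _ _ _ F_cont W_cont W_inc _ _ _ (ltW x0) (ltW xa)).
- by apply: le_trans (ltW xa); rewrite lee_fin.
- exact: (peak_chord _ _ _ F_cont W_cont x u v (ltW x0) (ltW xa)).1.
Qed.

Lemma ae_not_jumps (g : R -> R) (P : R -> Prop) :
  (forall t, ~ jumps I g t -> P t) -> {ae mu, forall t, P t}.
Proof.
move=> h; exists (jumps I g); split.
- exact: countable_measurable (countable_jumps _ _).
- exact: countable_lebesgue_measure0 (countable_jumps _ _).
- by move=> t /= nP; apply: contrapT => nj; apply: nP; exact: h.
Qed.

(** Between the peaks of [v] and [u] the integral of [f^*] is at most [v] times that of [w], and the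
    slope is at least [u]. *)
Lemma integral_fI_le_hI x : I x ->
  \int[mu]_(t in oitv 0%R x%:E) (fI t)%:E <= \int[mu]_(t in oitv 0%R x%:E) (hI t)%:E.
Proof.
move=> Ix; apply: (peak_comparison x fI hI Ix).
- exact: measurable_antimonoR fI_antimono.
- exact: measurable_hI.
- by move=> t _; exact: fI_ge0.
- by move=> t _; exact: hI_ge0.
- move=> u v u0 uv; rewrite !peak_itv_integral//; last 2 first.
    exact: measurable_hI.
    exact: measurable_antimonoR fI_antimono.
  have [p0 pq qa hF] := peak_Fint_Wint _ _ _ Ix u0 uv.
  set p := peak _ _ _ v in p0 pq hF *; set q := peak _ _ _ u in pq qa hF *.
  rewrite (primitive_diff _ _ measurable_fI fI_ge0 fI_fin _ _ p0 pq qa).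
  have hWh : (u * (Wint q - Wint p))%:E <= \int[mu]_(t in oitv p q%:E) (hI t)%:E.
    rewrite EFinM -(primitive_diff _ _ measurable_wI wI_ge0 wI_fin _ _ p0 pq qa).
    rewrite -ge0_integralZl//; last 4 first.
    - exact: measurable_oitv.
    - by apply/measurable_EFinP; apply: measurable_funS measurable_wI.
    - by move=> t _; rewrite lee_fin wI_ge0.
    - by rewrite lee_fin ltW.
    apply: ge0_le_integral.
    - exact: measurable_oitv.
    - by move=> t _; rewrite mule_ge0// lee_fin ?wI_ge0// ltW.
    - apply: measurable_funeM; apply/measurable_EFinP.
      exact: measurable_funS measurable_wI.
    - apply/measurable_EFinP; apply: measurable_funS measurable_hI.
        exact: measurable_oitv.
      exact: oitv_le_sub.
    - move=> t ht; have [It ut] := peak_slp _ _ _ _ Ix u0 ht.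
      by rewrite -EFinM lee_fin hIE// wIE// ler_wpM2r//; exact/ltW/hw.1.
  apply: (@le_trans _ _ ((v / u)%:E * (u * (Wint q - Wint p))%:E)).
    by rewrite -EFinM lee_fin mulrA divfK// gt_eqF.
  by apply: lee_wpmul2l => //; rewrite lee_fin divr_ge0// ltW// (lt_trans u0).
- by move=> z _ ->; exact: hI_ge0.
Qed.

Lemma measurable_wf : measurable_fun I wf.
Proof. exact: measurable_antimonoR wf_antimono. Qed.

Lemma wf_le_fI t u : I t -> ~ jumps I fI t -> (0 < u)%R -> (u <= slp t)%R ->
  (wf t <= u^-1 * fI t)%R.
Proof.
move=> It nj u0 us; have s0 : (0 < slp t)%R by exact: lt_le_trans us.
have -> : wf t = (fI t / slp t)%R.
  have [l|l] := pselect (leveled t); first exact: wf_leveled.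
  by rewrite wf_unleveled// (unleveled_slope _ It nj l) mulrAC divff ?mul1r// gt_eqF.
by rewrite mulrC ler_wpM2r ?fI_ge0// lef_pV2.
Qed.

(** Between the same peaks [w^f = f^* / slp <= f^* / u] off jumps. Where [f^*] vanishes there is no
    level interval, so [w^f = w]. *)
Lemma integral_wf_le x : I x ->
  \int[mu]_(t in oitv 0%R x%:E) (wf t)%:E <= \int[mu]_(t in oitv 0%R x%:E) (wI t)%:E.
Proof.
move=> Ix; apply: (peak_comparison x wf wI Ix).
- exact: measurable_wf.
- exact: measurable_antimonoR wI_antimono.
- by move=> t It; exact/ltW/wf_gt0.
- by move=> t _; exact: wI_ge0.
- move=> u v u0 uv; rewrite !peak_itv_integral//; last 2 first.
    exact: measurable_antimonoR wI_antimono.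
    exact: measurable_wf.
  have [p0 pq qa hF] := peak_Fint_Wint _ _ _ Ix u0 uv.
  set p := peak _ _ _ v in p0 pq hF *; set q := peak _ _ _ u in pq qa hF *.
  rewrite (primitive_diff _ _ measurable_wI wI_ge0 wI_fin _ _ p0 pq qa).
  apply: (@le_trans _ _ (u^-1%:E * \int[mu]_(t in oitv p q%:E) (fI t)%:E)).
    rewrite -ge0_integralZl//; last 4 first.
    - exact: measurable_oitv.
    - by apply/measurable_EFinP; apply: measurable_funS measurable_fI.
    - by move=> t _; rewrite lee_fin fI_ge0.
    - by rewrite lee_fin invr_ge0 ltW.
    apply: ae_ge0_le_integral.
    - exact: measurable_oitv.
    - by move=> t ht; have [It _] := peak_slp _ _ _ _ Ix u0 ht; rewrite lee_fin ltW// wf_gt0.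
    - apply/measurable_EFinP; apply: measurable_funS measurable_wf.
        exact: measurable_oitv.
      exact: oitv_le_sub.
    - by move=> t _; rewrite mule_ge0// lee_fin ?fI_ge0// invr_ge0 ltW.
    - apply: measurable_funeM; apply/measurable_EFinP.
      exact: measurable_funS measurable_fI.
    - apply: (ae_not_jumps fI) => t nj ht; have [It ut] := peak_slp _ _ _ _ Ix u0 ht.
      by rewrite -EFinM lee_fin wf_le_fI.
  rewrite (primitive_diff _ _ measurable_fI fI_ge0 fI_fin _ _ p0 pq qa).
  rewrite -!EFinM lee_fin mulrAC [leRHS]mulrC.
  by rewrite ler_wpM2l ?invr_ge0 ?(ltW u0).
- move=> z Iz fz; rewrite wIE// wf_unleveled// => /leveled_fI_gt0.
  by rewrite fz ltxx.
Qed.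

Lemma measurable_weightV (v : R -> R) : decreasing_weight I v ->
  measurable_fun I (fun t => (v t)^-1)%R.
Proof.
move=> [v0 dv]; rewrite -[X in measurable_fun _ X]opprK; apply: measurable_funN.
apply: measurable_antimonoR => s t Is It st; rewrite lerN2 lef_pV2 ?posrE ?v0//.
exact: dv.
Qed.

Lemma measurable_weight (v : R -> R) : decreasing_weight I v -> measurable_fun I v.
Proof. by move=> [_ dv]; exact: measurable_antimonoR. Qed.

Lemma measurable_perspective (phi y v : R -> R) : orlicz phi -> decreasing_weight I v ->
  measurable_fun I y -> (forall t, I t -> (0 <= y t)%R) ->
  measurable_fun I (fun t => phi (y t / v t) * v t)%R.
Proof.
move=> ophi hv my y0.
apply: (eq_measurable_fun (fun t => (fun s => phi (Num.max s 0)) (y t / v t) * v t)%R).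
  move=> t /set_mem It; rewrite max_l// divr_ge0 ?y0//; exact/ltW/hv.1.
have h1 : measurable_fun [set: R] (fun s => phi (Num.max s 0))%R.
  apply: nondecreasing_measurable => // s t st; apply: (orlicz_nd _ ophi).
    by rewrite le_max lexx orbT.
  by rewrite ge_max !le_max st lexx orbT.
have h2 : measurable_fun I (fun t => y t / v t)%R.
  by apply: measurable_funM => //; exact: measurable_weightV.
have h3 := measurableT_comp h1 h2.
by apply: measurable_funM; [exact: h3|exact: measurable_weight].
Qed.

Lemma integral_lincomb (N : nat) (k : nat -> R) (G : nat -> R -> R) :
  (forall i, (0 <= k i)%R) -> (forall i t, I t -> (0 <= G i t)%R) ->
  (forall i, measurable_fun I (G i)) ->
  \int[mu]_(t in I) (\sum_(i < N) k i * G i t)%:E =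
  \sum_(i < N) (k i)%:E * \int[mu]_(t in I) (G i t)%:E.
Proof.
move=> k0 G0 mG; have mI := measurable_oitv 0%R a.
have kG0 n t : I t -> (0 <= \sum_(i < n) k i * G i t)%R.
  by move=> It; apply: sumr_ge0 => i _; rewrite mulr_ge0// G0.
elim: N => [|N IH].
  rewrite big_ord0; under eq_integral do rewrite big_ord0.
  by rewrite integral0.
rewrite big_ord_recr/= -IH -ge0_integralZl//; last 3 first.
  by apply/measurable_EFinP; exact: mG.
  by move=> t It; rewrite lee_fin G0.
  by rewrite lee_fin.
rewrite -ge0_integralD//.
- by apply: eq_integral => t _; rewrite big_ord_recr/= EFinD EFinM.
- by move=> t It; rewrite lee_fin kG0.
- by apply/measurable_EFinP; apply: measurable_sum => i; apply: measurable_funM => //; exact: mG.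
- by move=> t It; rewrite mule_ge0// lee_fin ?G0.
- by apply: measurable_funeM; apply/measurable_EFinP; exact: mG.
Qed.

Lemma exhaust_I : exists xs : nat -> R, [/\ forall n, I (xs n),
  {homo xs : m n / (m <= n)%N >-> (m <= n)%R} &
  forall y, I y -> exists n0, forall n, (n0 <= n)%N -> (y <= xs n)%R].
Proof.
move: a0; case: (a) => [b| |//] b0.
  rewrite lte_fin in b0; exists (fun n => b - b / n.+2%:R)%R; split.
  - move=> n; split; last by rewrite lte_fin gtrBl divr_gt0.
    by rewrite subr_gt0 ltr_pdivrMr// ltr_pMr// ltr1n.
  - by move=> m n mn; rewrite lerD2l lerN2 ler_pM2l// lef_pV2 ?posrE// ler_nat !ltnS.
  move=> y [y0]; rewrite lte_fin => yb.
  exists (Num.truncn (b / (b - y))) => n hn.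
  have h : (b / (b - y) < n.+2%:R)%R.
    apply: lt_trans (truncnS_gt _) _; rewrite ltr_nat ltnS; exact: leq_trans hn _.
  rewrite ltr_pdivrMr ?subr_gt0// in h.
  have : (b / n.+2%:R <= b - y)%R by rewrite ler_pdivrMr// mulrC ltW.
  by rewrite lerBrDl -lerBrDr.
exists (fun n => n.+1%:R)%R; split.
- by move=> n; split => //; rewrite ltry.
- by move=> m n mn; rewrite ler_nat ltnS.
move=> y _; exists (Num.truncn y) => n hn.
by apply: ltW; apply: lt_le_trans (truncnS_gt _) _; rewrite ler_nat.
Qed.

(** * Lower bound for modulars by an arithmetic grid of tilts *)

Section lower_bound.
Variables (phi y v : R -> R).
Hypothesis ophi : orlicz phi.
Hypothesis my : measurable_fun I y.
Hypothesis y0 : forall t, I t -> (0 <= y t)%R.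
Hypothesis hv : decreasing_weight I v.
Hypothesis fy : forall x, I x ->
  \int[mu]_(t in oitv 0%R x%:E) (fI t)%:E <= \int[mu]_(t in oitv 0%R x%:E) (y t)%:E.
Hypothesis vw : forall x, I x ->
  \int[mu]_(t in oitv 0%R x%:E) (v t)%:E <= \int[mu]_(t in oitv 0%R x%:E) (wI t)%:E.

Let v0 t : I t -> (0 < v t)%R. Proof. exact: hv.1. Qed.

Let excess (u t : R) : R := Num.max (y t - u * v t)%R 0%R.

Let excess_ge0 u t : (0 <= excess u t)%R.
Proof. by rewrite le_max lexx orbT. Qed.

Let mexcess u : measurable_fun I (excess u).
Proof.
apply: measurable_maxr; last exact: measurable_cst.
apply: measurable_funB => //; apply: measurable_funM; first exact: measurable_cst.
exact: measurable_weight.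
Qed.

(** The hypotheses [fy] and [vw] bound [F m - u W m] by the integral of [y - u v] over [(0, m)],
    hence by that of its positive part over [I]. *)
Let excess_ge u m : (0 <= u)%R -> m = 0%R \/ I m ->
  (tilt Fint Wint u m)%:E <= \int[mu]_(t in I) (excess u t)%:E.
Proof.
move=> u0 [->|Im].
  rewrite /tilt F_0 W_0 mulr0 subr0; apply: integral_ge0 => t _.
  by rewrite lee_fin.
have [m0 ma] := Im; have sub : oitv 0%R m%:E `<=` I by exact: oitv_le_sub (ltW ma) (lexx _).
have mD := measurable_oitv 0%R m%:E; have mI := measurable_oitv 0%R a.
have mv : measurable_fun (oitv 0%R m%:E) (EFin \o v).
  by apply/measurable_EFinP; apply: measurable_funS (measurable_weight _ hv).
have mex : measurable_fun (oitv 0%R m%:E) (EFin \o excess u).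
  by apply/measurable_EFinP; apply: measurable_funS (mexcess u).
apply: (@le_trans _ _ (\int[mu]_(t in oitv 0%R m%:E) (excess u t)%:E)); last first.
  apply: ge0_subset_integral => //.
  - by apply/measurable_EFinP; exact: mexcess.
  - by move=> t _; rewrite lee_fin.
have h : \int[mu]_(t in oitv 0%R m%:E) (y t)%:E <=
    \int[mu]_(t in oitv 0%R m%:E) (excess u t)%:E + u%:E * \int[mu]_(t in oitv 0%R m%:E) (v t)%:E.
  rewrite -ge0_integralZl//; last first.
    by move=> t /sub It; rewrite lee_fin ltW// v0.
  rewrite -ge0_integralD//; last 3 first.
  - by move=> t _; rewrite lee_fin.
  - by move=> t /sub It; rewrite mule_ge0// lee_fin ?(ltW u0)// ltW// v0.
  - exact: measurable_funeM.
  apply: ge0_le_integral => //.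
  - by move=> t /sub It; rewrite lee_fin y0.
  - by apply/measurable_EFinP; apply: measurable_funS my.
  - by apply: emeasurable_funD => //; exact: measurable_funeM.
  - move=> t /sub It; rewrite -EFinM -EFinD lee_fin -lerBlDr.
    by rewrite le_max lexx.
have := fy _ Im; rewrite (integral_primitive _ _ fI_ge0 fI_fin) ?(ltW ma)// => h1.
have := vw _ Im; rewrite (integral_primitive _ _ wI_ge0 wI_fin) ?(ltW ma)// => h2.
have h3 : (Fint m)%:E <= \int[mu]_(t in oitv 0%R m%:E) (excess u t)%:E + (u * Wint m)%:E.
  apply: le_trans h1 _; apply: le_trans h _; apply: leeD => //.
  by rewrite EFinM; apply: lee_wpmul2l => //; rewrite lee_fin.
by rewrite /tilt EFinB leeBlDr.
Qed.

Let target := \int[mu]_(t in I) (phi (y t / v t) * v t)%:E.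

Let cut (m t : R) : R := if (t < m)%R then w t else 0%R.

Let cut_ge0 m t : I t -> (0 <= cut m t)%R.
Proof. by move=> It; rewrite /cut; case: ifP => // _; exact/ltW/hw.1. Qed.

Let mcut m : measurable_fun I (cut m).
Proof.
apply: measurable_antimonoR => s t Is It st; rewrite /cut.
have [tm|_] := ltP t m; last by case: ifP => // _; exact/ltW/hw.1.
by rewrite (le_lt_trans st tm); exact: hw.2.
Qed.

Let int_cut m : (0 <= m)%R -> m%:E <= a ->
  \int[mu]_(t in I) (cut m t)%:E = (Wint m)%:E.
Proof.
move=> m0 ma; rewrite -[RHS](integral_primitive _ _ wI_ge0 wI_fin)//.
rewrite -integral_wIE// integral_mkcond [RHS]integral_mkcond.
apply: eq_integral => t _; rewrite !patchE /cut.
have [tm|mt] := ltP t m.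
  have [It|nI] := pselect (I t).
    by rewrite !mem_set//; split; [case: It|rewrite lte_fin].
  by rewrite !memNset// => -[t0 _]; apply: nI; split => //; apply: lt_le_trans ma; rewrite lte_fin.
rewrite [in RHS]memNset; last by move=> [_]; rewrite lte_fin ltNge mt.
by case: ifP.
Qed.

(** Testing the maximum [sg i] at the next peak gives the hypothesis of [sum_chord_sigma]. Each
    maximum is at most the integral of an excess, and [v] times [chord_tangent_le] at [y / v] bounds
    the weighted sum of the excesses. *)
Let grid_bound (x d : R) N : I x -> (0 < d)%R ->
  \int[mu]_(t in I)
    (\sum_(i < N) chord phi d i * d * cut (peak Fint Wint x (i.+1%:R * d)) t)%:E <= target.
Proof.
move=> Ix d0; have [x0 xa] := Ix.
have pI u : (0 <= peak Fint Wint x u <= x)%R.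
  exact: (peakP _ _ _ F_cont W_cont x u (ltW x0) (ltW xa)).1.
have pmax u s : (0 <= s <= x)%R -> (tilt Fint Wint u s <= tilt Fint Wint u (peak Fint Wint x u))%R.
  exact: (peakP _ _ _ F_cont W_cont x u (ltW x0) (ltW xa)).2.
have pa u : (peak Fint Wint x u)%:E <= a.
  by apply: le_trans (ltW xa); rewrite lee_fin; case/andP: (pI u).
rewrite (integral_lincomb N (fun i => chord phi d i * d)%R (fun i => cut (peak Fint Wint x (i.+1%:R * d)))); last 3 first.
- by move=> i; rewrite mulr_ge0 ?chord_ge0// ltW.
- by move=> i t; exact: cut_ge0.
- by move=> i; exact: mcut.
under eq_bigr => i _.
  rewrite int_cut; [|by case/andP: (pI (i.+1%:R * d)%R)|exact: pa].
  rewrite -EFinM; over.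
pose sg i := tilt Fint Wint (i%:R * d) (peak Fint Wint x (i%:R * d)).
rewrite sumEFin.
apply: (@le_trans _ _ (\sum_(i < N) (chord phi d i.+1 - chord phi d i) * sg i.+1)%R%:E).
  rewrite lee_fin; apply: (sum_chord_sigma phi ophi d d0 sg (fun i => Wint (peak Fint Wint x (i%:R * d)))).
    move=> i; apply: le_trans (pmax _ 0%R _); last by rewrite lexx ltW.
    by rewrite /tilt F_0 W_0 mulr0 subr0.
  move=> i; have := pmax (i%:R * d)%R _ (pI (i.+1%:R * d)%R).
  by rewrite /sg /tilt -natr1 mulrDl mul1r; lra.
apply: (@le_trans _ _ (\int[mu]_(t in I)
    (\sum_(i < N) (chord phi d i.+1 - chord phi d i) * excess (i.+1%:R * d) t)%:E)).
  rewrite (integral_lincomb N (fun i => chord phi d i.+1 - chord phi d i)%R (fun i => excess (i.+1%:R * d))%R); last 3 first.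
  - by move=> i; rewrite subr_ge0 chord_nd.
  - by move=> i t _; exact: excess_ge0.
  - by move=> i; exact: mexcess.
  rewrite -sumEFin; apply: lee_sum => i _; rewrite EFinM; apply: lee_wpmul2l.
    by rewrite lee_fin subr_ge0 chord_nd.
  apply: excess_ge; first by rewrite mulr_ge0// ltW.
  have /andP[] := pI (i.+1%:R * d)%R; rewrite le_eqVlt => /predU1P[<- _|p0 px]; first by left.
  by right; split => //; apply: le_lt_trans xa; rewrite lee_fin.
apply: ge0_le_integral.
- exact: measurable_oitv.
- move=> t It; rewrite lee_fin; apply: sumr_ge0 => i _.
  by rewrite mulr_ge0 ?subr_ge0 ?chord_nd.
- by apply/measurable_EFinP; apply: measurable_sum => i; apply: measurable_funM => //; exact: mexcess.
- by apply/measurable_EFinP; exact: measurable_perspective.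
move=> t It; rewrite lee_fin; have vt := v0 _ It.
have yv : (0 <= y t / v t)%R by rewrite divr_ge0 ?y0// ltW.
have hh := chord_tangent_le phi ophi d d0 N (y t / v t)%R yv.
rewrite -(ler_pM2r vt) in hh; apply: (le_trans _ hh).
rewrite mulr_suml; apply: ler_sum => i _; rewrite -mulrA; apply: ler_wpM2l.
  by rewrite subr_ge0 chord_nd.
rewrite maxr_pMl; last exact: ltW.
by rewrite mul0r mulrBl divfK ?gt_eqF.
Qed.

(** Left of the peak of [u'] all cuts of parameter up to [u'] equal [w t], and the chords telescope
    to a value of [phi] at least [phi s]. *)
Let grid_ge (x d s u' t : R) N : I x -> I t -> (0 < d)%R -> (0 <= s)%R ->
  (s + 2 * d <= u')%R -> (t < peak Fint Wint x u')%R -> (s < (N%:R - 1) * d)%R ->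
  (phi s * w t <= \sum_(i < N) chord phi d i * d * cut (peak Fint Wint x (i.+1%:R * d)) t)%R.
Proof.
move=> [x0 xa] It d0 s0 su tp sN; have wt : (0 < w t)%R by exact: hw.1.
have sd0 : (0 <= s / d)%R by rewrite divr_ge0// ltW.
(* Rounding [s] up to the grid costs at most [d], and the shift between chord [i] and parameter
   [i.+1] another [d]: hence the margin [2 * d]. *)
pose k := (Num.truncn (s / d)).+1.
have sk : (s <= k%:R * d)%R by rewrite -ler_pdivrMr// ltW// truncnS_gt.
have ks : ((k%:R - 1) * d <= s)%R.
  by rewrite /k -natr1 addrK -ler_pdivlMr// truncn_le.
have kN : (k < N)%N.
  rewrite -(ltr_nat R) -(ltrD2r (-1)%R) -(ltr_pM2r d0); exact: le_lt_trans sN.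
have tk i : (i <= k)%N -> (t < peak Fint Wint x (i.+1%:R * d))%R.
  move=> ik; apply: lt_le_trans tp _.
  have : (i.+1%:R * d <= u')%R.
    have : (i.+1%:R * d <= k.+1%:R * d)%R by rewrite ler_pM2r// ler_nat.
    by rewrite -[k.+1%:R]natr1; nra.
  rewrite le_eqVlt => /predU1P[->//|].
  exact: (peak_antimono _ _ _ F_cont W_cont W_inc _ _ _ (ltW x0) (ltW xa)).
apply: (@le_trans _ _ (\sum_(i < k.+1) chord phi d i * d * w t)%R).
  rewrite -mulr_suml (sum_chord phi ophi d d0) ler_pM2r//.
  by apply: (orlicz_nd _ ophi).
rewrite -[leRHS](big_mkord xpredT (fun i => chord phi d i * d * cut (peak Fint Wint x (i.+1%:R * d)) t)%R).
rewrite (@big_cat_nat _ _ _ k.+1)//= big_mkord -[leLHS]addr0; apply: lerD.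
  by apply: ler_sum => i _; rewrite /cut tk// -ltnS.
by apply: sumr_ge0 => i _; rewrite mulr_ge0 ?cut_ge0// mulr_ge0 ?chord_ge0// ltW.
Qed.

Lemma limn_einf_ge (u : (\bar R)^nat) (l : \bar R) :
  (\forall n \near \oo, l <= u n) -> l <= limn_einf u.
Proof.
move=> [n0 _ hn]; rewrite limn_einf_lim; apply: lime_ge; first exact: is_cvg_einfs.
exists n0 => // n /= n0n; apply: le_ereal_inf_tmp => _ [k /= nk <-]; apply: hn.
exact: leq_trans nk.
Qed.

(** Fatou's lemma along ever finer grids on growing intervals: each grid sum integrates to at most
    [target], and pointwise their lower limit is at least [phi (slp t) * w t]. *)
Lemma modular_lower_bound : \int[mu]_(t in I) (phi (slp t) * w t)%:E <= target.
Proof.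
have [xs [Ixs _ hxs]] := exhaust_I.
pose d n : R := (n.+1%:R)^-1%R.
have d0 n : (0 < d n)%R by rewrite invr_gt0.
(* [n.+1 * n.+1] cells of mesh [1 / n.+1] reach up to [n.+1], so every slope is eventually
   covered. *)
pose g n t : R := (\sum_(i < n.+1 * n.+1) chord phi (d n) i * d n *
    cut (peak Fint Wint (xs n) (i.+1%:R * d n)) t)%R.
have g0 n t : I t -> (0 <= g n t)%R.
  move=> It; apply: sumr_ge0 => i _; rewrite mulr_ge0 ?cut_ge0//.
  by rewrite mulr_ge0 ?chord_ge0// ltW.
have mg n : measurable_fun I (EFin \o g n).
  apply/measurable_EFinP; apply: measurable_sum => i.
  by apply: measurable_funM => //; exact: mcut.
have mI := measurable_oitv 0%R a.
apply: (@le_trans _ _ (\int[mu]_(t in I) limn_einf (fun n => (g n t)%:E))); last first.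
  apply: le_trans (fatou mu mI (f := fun n t => (g n t)%:E) mg _) _.
    by move=> n t It; rewrite lee_fin g0.
  rewrite limn_einf_lim; apply: lime_le; first exact: is_cvg_einfs.
  apply: nearW => n; apply: le_trans (ereal_inf_lbound _) (grid_bound (xs n) (d n) (n.+1 * n.+1) (Ixs n) (d0 n)).
  by exists n => /=.
have slpI t : I t -> 0 <= (phi (slp t) * w t)%:E.
  move=> It; rewrite lee_fin mulr_ge0//; last exact/ltW/hw.1.
  by rewrite orlicz_ge0 ?slp_ge0.
apply: ge0_le_integral => //.
- apply/measurable_EFinP.
  apply: (eq_measurable_fun (fun t => phi (hI t / w t) * w t)%R).
    by move=> t /set_mem It; rewrite hIE// mulfK// gt_eqF//; exact: hw.1.
  apply: measurable_perspective => //; first exact: measurable_hI.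
  by move=> t _; exact: hI_ge0.
- have m1 : measurable_fun [set: \bar R] (-%E : \bar R -> \bar R) by exact: oppe_measurable.
  have h1 n := measurableT_comp m1 (mg n).
  have h : measurable_fun I (fun t => limn_esup (fun n => - (g n t)%:E)).
    by apply: (measurable_fun_limn_esup (f := fun n t => - (g n t)%:E)) => n; exact: h1.
  exact: (measurableT_comp m1 h).
move=> t It; have wt : (0 < w t)%R by exact: hw.1.
have S0 := slp_ge0 _ It.
have [->|Sn0] := eqVneq (slp t) 0%R.
  rewrite (orlicz0 _ ophi) mul0r; apply: limn_einf_ge; apply: nearW => n.
  by rewrite lee_fin g0.
have {}S0 : (0 < slp t)%R by rewrite lt_neqAle eq_sym Sn0.
set S := slp t in S0 *.
have P0 : (0 <= phi (S + 1))%R by apply: (orlicz_ge0 _ ophi); lra.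
apply/lee_addgt0Pr => e e0.
(* Convexity on [s <= S <= S + 1] gives [phi S - phi s <= (S - s) phi (S + 1)]; the added 1 makes
   [K] visibly positive. *)
pose K := (w t * (phi (S + 1) + 1))%R.
have K0 : (0 < K)%R by rewrite mulr_gt0//; lra.
pose s := Num.max 0%R (S - e / K)%R.
have sS : (s < S)%R by rewrite gt_max S0 gtrBl divr_gt0.
have s0 : (0 <= s)%R by rewrite le_max lexx.
have Ss : (S - s <= e / K)%R.
  by rewrite lerBlDr -lerBlDl; rewrite le_max lexx orbT.
have phiS : (phi S * w t <= phi s * w t + e)%R.
  have := orlicz_convex _ ophi s S (S + 1)%R s0 (ltW sS) _.
  rewrite lerDl ler01 => /(_ isT) h.
  have h0 := orlicz_ge0 _ ophi s s0.
  have h1 : (phi s <= phi S)%R by apply: (orlicz_nd _ ophi) => //; exact: ltW.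
  have h2 : (phi S - phi s <= (S - s) * phi (S + 1))%R by nra.
  have h3 : ((S - s) * K <= e)%R by rewrite -ler_pdivlMr.
  move: h3; rewrite /K => h3.
  have : (w t * (phi S - phi s) <= w t * ((S - s) * phi (S + 1)))%R by rewrite ler_pM2l.
  have : (0 <= w t * (S - s))%R by rewrite mulr_ge0 ?subr_ge0// ltW.
  nra.
apply: (@le_trans _ _ ((phi s * w t)%:E + e%:E)); first by rewrite -EFinD lee_fin.
apply: leeD => //; apply: limn_einf_ge.
pose u' := ((s + S) / 2)%R.
have su' : (s < u')%R by rewrite /u'; lra.
have u'S : (u' < S)%R by rewrite /u'; lra.
have u'0 : (0 <= u')%R by lra.
have [t0 ta] := It.
(* Every nonnegative [u'] below the slope ascends at [t], so [t] lies left of its peak once [xs n]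
   is large. *)
have asc : ascent a Fint Wint u' t.
  exact: (ascent_lt_slope _ _ _ F_0 W_0 W_inc FW_growth _ _ t0 (ltW ta) u'0 u'S).
have [z [tz za hz]] := ascent_peak _ _ _ F_cont W_cont _ _ (ltW t0) ta asc.
have Iz : I z by split => //; exact: lt_trans tz.
have [n0 hn0] := hxs z Iz.
exists (maxn n0 (maxn (Num.truncn (s + 1)) (Num.truncn (2 / (u' - s))))) => // n /=.
rewrite !geq_max => /and3P[n0n n1n n2n].
have s1n : (s + 1 < n.+1%:R)%R by apply: lt_le_trans (truncnS_gt _) _; rewrite ler_nat.
have d2 : (2 / (u' - s) < n.+1%:R)%R by apply: lt_le_trans (truncnS_gt _) _; rewrite ler_nat.
rewrite lee_fin; apply: (grid_ge (xs n) (d n) s u') => //.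
- rewrite ltr_pdivrMr ?subr_gt0// in d2.
  have : (2 * d n <= u' - s)%R by rewrite /d ler_pdivrMr// mulrC ltW.
  lra.
- by apply: hz; [exact: hn0|exact/ltW/(Ixs n).2].
- rewrite mulrBl mul1r natrM /d mulfK ?pnatr_eq0//.
  have : (n.+1%:R^-1 <= 1 :> R)%R by rewrite invf_le1// ler1n.
  move=> h; apply: (@lt_le_trans _ _ (n.+1%:R - 1)%R); first by rewrite ltrBrDr.
  by rewrite lerB.
Qed.

End lower_bound.

(** * Hardy's lemma for decreasing multipliers *)

Section hardy.
Variables (k A B : R -> R).
Hypothesis k0 : forall t, I t -> (0 <= k t)%R.
Hypothesis dk : forall s t, I s -> I t -> (s <= t)%R -> (k t <= k s)%R.
Hypothesis mA : measurable_fun I A.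
Hypothesis mB : measurable_fun I B.
Hypothesis A0 : forall t, I t -> (0 <= A t)%R.
Hypothesis B0 : forall t, I t -> (0 <= B t)%R.
Hypothesis AB : forall x, I x ->
  \int[mu]_(t in oitv 0%R x%:E) (A t)%:E <= \int[mu]_(t in oitv 0%R x%:E) (B t)%:E.

Let int_I_cvg (G : R -> R) (xs : nat -> R) : measurable_fun I G ->
  (forall t, I t -> (0 <= G t)%R) -> (forall n, I (xs n)) ->
  {homo xs : m n / (m <= n)%N >-> (m <= n)%R} ->
  (forall y, I y -> exists n0, forall n, (n0 <= n)%N -> (y <= xs n)%R) ->
  \int[mu]_(t in oitv 0%R (xs n)%:E) (G t)%:E @[n --> \oo] --> \int[mu]_(t in I) (G t)%:E.
Proof.
move=> mG G0 Ixs nd hxs.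
have IE : I = \bigcup_n oitv 0%R (xs n)%:E.
  apply/seteqP; split => [t It|t [n _ [t0 tn]]].
    have [t0 ta] := It.
    have [z [Iz tz]] : exists z, I z /\ (t < z)%R.
      rewrite /oitv/=; case: (a) ta => [b| |//].
        rewrite lte_fin => tb; exists ((t + b) / 2)%R; split; last by lra.
        by rewrite lte_fin; lra.
      by move=> _; exists (t + 1)%R; rewrite ltry; split => //; [split => //|]; lra.
    have [n hn] := hxs z Iz; exists n => //; split => //.
    by rewrite lte_fin (lt_le_trans tz)// hn.
  by split => //; apply: lt_trans tn (Ixs n).2.
rewrite [in X in _ --> X]IE.
have sub n : oitv 0%R (xs n)%:E `<=` I by apply: oitv_sub0 => //.
apply: ge0_nondecreasing_set_cvg_integral.
- by move=> m n mn; rewrite subsetEset; apply: oitv_sub_le => //; rewrite lee_fin nd.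
- by move=> n; exact: measurable_oitv.
- move=> n; apply/measurable_EFinP; apply: measurable_funS mG => //.
  exact: measurable_oitv.
- by move=> n t /sub It; rewrite lee_fin G0.
Qed.

Let int_I_le : \int[mu]_(t in I) (A t)%:E <= \int[mu]_(t in I) (B t)%:E.
Proof.
have [xs [Ixs nd hxs]] := exhaust_I.
have cA := int_I_cvg _ _ mA A0 Ixs nd hxs; have cB := int_I_cvg _ _ mB B0 Ixs nd hxs.
rewrite -(cvg_lim _ cA)// -(cvg_lim _ cB)//; apply: lee_lim.
- by apply/cvg_ex; eexists; exact: cA.
- by apply/cvg_ex; eexists; exact: cB.
- by apply: nearW => n; exact: AB.
Qed.

(** A superlevel set of a decreasing function is empty, an initial segment of [I], or [I] itself;
    the last case is settled by exhaustion. *)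
Let level_set_le s : \int[mu]_(t in I `&` [set t | (s < k t)%R]) (A t)%:E <=
  \int[mu]_(t in I `&` [set t | (s < k t)%R]) (B t)%:E.
Proof.
set E := I `&` _.
have [IE|] := pselect (I `<=` E).
  by have -> : E = I by apply/seteqP; split => // t [].
move=> /existsNP[x /not_implyP[Ix nEx]].
have Ex t : E t -> (t <= x)%R.
  move=> [It st]; rewrite leNgt; apply/negP => xt; apply: nEx; split => //=.
  by apply: lt_le_trans st _; apply: dk => //; exact: ltW.
have [->|/set0P[e Ee]] := eqVneq E set0; first by rewrite !integral_set0.
have hE : has_sup E by split; [exists e|exists x].
pose z := sup E.
have zx : (z <= x)%R by apply: ge_sup => //; exists e.
have ez : (e <= z)%R by apply: ub_le_sup => //; case: hE.
have Iz : I z.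
  split; first by case: Ee => [[e0 _] _]; exact: lt_le_trans ez.
  by case: Ix => _; apply: le_lt_trans; rewrite lee_fin.
have inE t : (0 < t)%R -> (t < z)%R -> E t.
  move=> t0 tz; have zt : (0 < z - t)%R by rewrite subr_gt0.
  have [u Eu tu] := sup_adherent zt hE.
  rewrite -/z subKr in tu; have [Iu su] := Eu.
  have It : I t by split => //; case: Iz => _; apply: lt_trans; rewrite lte_fin.
  by split => //=; apply: lt_le_trans su _; apply: dk => //; exact: ltW.
have mG (G : R -> R) : measurable_fun I G -> measurable_fun `]0%R, z[ (fun t => (G t)%:E).
  move=> mG; apply/measurable_EFinP; rewrite -oitvE; apply: measurable_funS mG.
    exact: measurable_oitv.
  exact: oitv_sub0.
have EE (G : R -> R) : measurable_fun I G ->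
    \int[mu]_(t in E) (G t)%:E = \int[mu]_(t in oitv 0%R z%:E) (G t)%:E.
  move=> mG'; have [Ez|nEz] := pselect (E z).
    have -> : E = `]0%R, z]%classic.
      apply/seteqP; split => t; rewrite /= in_itv/=.
        by move=> Et; have [[t0 _] _] := Et; rewrite t0/=; apply: ub_le_sup => //; case: hE.
      by move=> /andP[t0]; rewrite le_eqVlt => /predU1P[->//|]; exact: inE.
    by rewrite oitvE (integral_itv_bndo_bndc (mG _ mG')).
  congr (\int[_]_(_ in _) _); apply/seteqP; split => t; last first.
    by move=> [t0 tz]; apply: inE.
  move=> Et; have [[t0 _] _] := Et; split => //; rewrite lte_fin lt_neqAle.
  apply/andP; split; last by apply: ub_le_sup => //; case: hE.
  by apply/eqP => tz; apply: nEz; rewrite -tz.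
by rewrite !EE// AB.
Qed.

Let k' t := if t \in I then k t else 0%R.

Let mk' : measurable_fun [set: R] k'.
Proof.
apply: antimono_measurable; first by move=> t It; rewrite /k' memNset.
by move=> s t Is It st; rewrite /k' !mem_set// dk.
Qed.

(** Layer-cake formula: [k t] is the length of [[0, k t)], and Tonelli's theorem exchanges the
    integrals. *)
Let layer (G : R -> R) : measurable_fun I G -> (forall t, I t -> (0 <= G t)%R) ->
  \int[mu]_(t in I) (k t * G t)%:E =
  \int[mu]_(s in `[0%R, +oo[) \int[mu]_(t in I `&` [set t | (s < k t)%R]) (G t)%:E.
Proof.
move=> mG G0; have mI := measurable_oitv 0%R a.
pose G' := (G \_ I : R -> R).
have mG' : measurable_fun [set: R] G' by apply/(measurable_restrictT G mI).
have G'E t : I t -> G' t = G t by move=> It; rewrite /G' patchE mem_set.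
have G'0 t : (0 <= G' t)%R.
  by rewrite /G' patchE; case: ifPn => // /set_mem /G0.
pose S (p : R * R) := ((0 <= p.2) && (p.2 < k' p.1))%R.
pose h (p : R * R) : \bar R := if S p then (G' p.1)%:E else 0.
have mh : measurable_fun [set: R * R] h.
  apply: measurable_fun_if => //.
  - apply: measurable_and.
      exact: measurable_fun_ler.
    by apply: measurable_fun_ltr => //; exact: measurableT_comp.
  - apply/measurable_EFinP.
    by apply: measurable_funTS; exact: (measurableT_comp mG').
have h0 p : 0 <= h p by rewrite /h; case: ifP => // _; rewrite lee_fin.
have FT := fubini_tonelli (m1 := mu) (m2 := mu) h mh h0.
transitivity (\int[mu]_t \int[mu]_s h (t, s)).
  rewrite integral_mkcond; apply: eq_integral => t _.
  transitivity (\int[mu]_(s in `[0%R, k' t[) (cst (G' t)%:E s)).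
    rewrite integral_cst// [X in _ * X](_ : _ = lebesgue_measure `[0%R, k' t[%classic)//.
    rewrite lebesgue_measure_itv/= lte_fin patchE.
    case: ifPn => [tI|tI]; last first.
      by rewrite /k' (negbTE tI) ltxx mule0.
    have It := set_mem tI; rewrite /k' tI G'E//.
    have := k0 _ It; rewrite le_eqVlt => /predU1P[<-|kt]; first by rewrite ltxx mule0 mul0r.
    by rewrite kt sube0 -EFinM mulrC.
  rewrite integral_mkcond; apply: eq_integral => s _.
  rewrite patchE /h /S/=; case: ifPn => [|]; first by move/set_mem; rewrite /= in_itv/= => ->.
  by rewrite notin_setE/= in_itv/= => /negP/negbTE ->.
rewrite FT [RHS]integral_mkcond; apply: eq_integral => s _.
rewrite patchE; case: ifPn => [/set_mem|].
  rewrite /= in_itv/= andbT => s0; rewrite [RHS]integral_mkcond; apply: eq_integral => t _.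
  rewrite patchE /h /S/= s0/=; case: ifPn => [skt|skt].
    have It : I t.
      apply: contrapT => nI; move: skt; rewrite /k' memNset// ltNge s0//.
    rewrite mem_set ?G'E//; split => //=; by move: skt; rewrite /k' mem_set.
  rewrite memNset// => -[It /= sk]; move: skt; rewrite /k' mem_set//.
  by rewrite sk.
rewrite notin_setE/= in_itv/= andbT => /negP s0.
by apply: integral0_eq => t _; rewrite /h /S/= (negbTE s0).
Qed.

Lemma hardy : \int[mu]_(t in I) (k t * A t)%:E <= \int[mu]_(t in I) (k t * B t)%:E.
Proof.
rewrite !layer//.
(* The inner integral decreases in [s], hence is measurable. *)
have mono (G : R -> R) : measurable_fun I G -> (forall t, I t -> (0 <= G t)%R) ->
    measurable_fun (`[0%R, +oo[%classic : set R) (fun s : R => \int[mu]_(t in I `&` [set t | (s < k t)%R]) (G t)%:E).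
  move=> mG G0.
  have mD s : measurable (I `&` [set t | (s < k t)%R]).

    apply: is_interval_measurable => u t [Iu su] [It st] z /andP[uz zt].
    have Iz : I z by apply: (oitv_is_interval 0%R a u t) => //; rewrite uz.
    by split => //=; apply: lt_le_trans st _; exact: dk.
  apply: measurable_antimono; first exact: interval_is_interval.
  move=> s t _ _ st; apply: ge0_subset_integral; [exact: mD|exact: mD| | |].
  - by apply/measurable_EFinP; apply: measurable_funS mG; [exact: measurable_oitv|move=> ? []].
  - by move=> x [Ix _]; rewrite lee_fin G0.
  - by move=> x [Ix /= sx]; split => //=; exact: le_lt_trans sx.
apply: ge0_le_integral.
- exact: measurable_itv.
- by move=> s _; apply: integral_ge0 => t [It _]; rewrite lee_fin A0.
- exact: mono.
- exact: mono.
- by move=> s _; exact: level_set_le.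
Qed.

End hardy.

End level_function.

(** * The functionals P and Q *)

(** Absorbs a multiplier [l] into the Orlicz function, so that the lower bound also covers the
    modulars of [l f]. *)
Lemma orlicz_scale (R : realType) (phi : R -> R) (l : R) : orlicz phi -> 0 < l ->
  orlicz (fun s => phi (l * s)).
Proof.
move=> ophi l0; have [cvx p0 pp] := ophi; split; last 2 first.
- by rewrite mulr0.
- by move=> s s0; apply: pp; rewrite mulr_gt0.
move=> t x y; rewrite !inE/= => x0 y0.
have := cvx t (l * x) (l * y); rewrite !inE/= => /(_ (mulr_ge0 (ltW l0) x0) (mulr_ge0 (ltW l0) y0)).
rewrite !convRE; have -> // : forall p q : R, l * (p * x + q * y) = p * (l * x) + q * (l * y).
by move=> p q; ring.
Qed.

Section scaling.
Context {R : realType}.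
Variables (a : \bar R) (phi w : R -> R).
Local Open Scope ereal_scope.
Local Notation I := (oitv 0%R a).

Lemma L0_scale f (l : R) : L0 I f -> L0 I (fun x => l * f x)%R.
Proof. by move=> mf; apply: measurable_funM => //; exact: measurable_cst. Qed.

Lemma submajorized_scale f g (l : R) : (0 < l)%R -> submajorized I f g ->
  submajorized I (fun x => l * f x)%R (fun x => l * g x)%R.
Proof.
move=> l0 fg x Ix.
have E h : \int[lebesgue_measure]_(t in oitv 0%R x%:E) rearrangement I (fun x => l * h x)%R t =
    l%:E * \int[lebesgue_measure]_(t in oitv 0%R x%:E) rearrangement I h t.
  under eq_integral do rewrite rearrangementM//.
  rewrite ge0_integralZl//.
  - exact: measurable_oitv.
  - apply: measurable_funS (measurable_rearrangement _ _ _); first exact: measurable_oitv.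
    exact: oitv_sub0.
  - by move=> t _; exact: rearrangement_ge0.
  - by rewrite lee_fin ltW.
by rewrite (E f) (E g); apply: lee_wpmul2l; [rewrite lee_fin ltW|exact: fg].
Qed.

Lemma M_class_scale g (l : R) : (0 < l)%R -> M_class phi I w g ->
  M_class phi I w (fun x => l * g x)%R.
Proof.
move=> l0 [mg [k k0 fin]]; split; first exact: L0_scale.
exists (k / l)%R; first exact: divr_gt0.
have -> // : (fun x => k / l * (l * g x))%R = (fun x => k * g x)%R.
by apply/funext => x; rewrite mulrA divfK// gt_eqF.
Qed.

Lemma M_space_scale f (l : R) : (0 < l)%R -> M_space phi I w f ->
  M_space phi I w (fun x => l * f x)%R.
Proof.
move=> l0 [mf [g cg fg]]; split; first exact: L0_scale.
by exists (fun x => l * g x)%R; [exact: M_class_scale|exact: submajorized_scale].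
Qed.

End scaling.

(** * Attainment of [Q] by the level function and of [P] by the inverse level function *)

Section core.
Context {R : realType}.
Variables (a : \bar R) (phi w f : R -> R).
Local Open Scope ereal_scope.
Local Notation mu := (@lebesgue_measure R).
Local Notation I := (oitv 0%R a).

Hypothesis a0 : 0 < a.
Hypothesis ophi : orlicz phi.
Hypothesis hw : decreasing_weight I w.
Hypothesis hW : forall t, I t -> \int[mu]_(s in oitv 0%R t%:E) (w s)%:E < +oo.
Hypothesis hf : M_space phi I w f.

Let finite_majorized g h : M_class phi I w h -> submajorized I g h ->
  forall t, I t -> \int[mu]_(s in oitv 0%R t%:E) rearrangement I g s < +oo.
Proof.
move=> ch gh t It; have [C1 [C2 [C10 C20 hC]]] := M_class_growth a phi ophi w h hw ch.
apply: le_lt_trans (gh t It) _; apply: le_lt_trans (hC t It) _.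
apply: lte_add_pinfty; last by rewrite ltry.
by apply: lte_mul_pinfty; [rewrite lee_fin| |exact: hW].
Qed.

Let hfin t : I t -> \int[mu]_(s in oitv 0%R t%:E) rearrangement I f s < +oo.
Proof. by have [_ [g cg fg]] := hf; exact: (finite_majorized f g). Qed.

Let hgrow : a = +oo -> exists C1 C2 : R, [/\ (0 <= C1)%R, (0 <= C2)%R &
  forall x : R, (0 < x)%R -> (Fint a f x <= C1 * Wint a w x + C2)%R].
Proof.
move=> ay; have [_ [g cg fg]] := hf.
have [C1 [C2 [C10 C20 hC]]] := M_class_growth a phi ophi w g hw cg.
exists C1, C2; split => // x x0.
have Ix : I x by split => //; rewrite ay ltry.
have xa : x%:E <= a by rewrite ay leey.
have := le_trans (fg x Ix) (hC x Ix).
rewrite (integral_fIE a f hfin _ _ (lexx _) xa) (integral_wIE a w _ _ (lexx _) xa).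
rewrite (integral_primitive a _ (fI_ge0 a f) (fI_fin a f hfin) _ xa).
by rewrite (integral_primitive a _ (wI_ge0 a w hw) (wI_fin a w hw hW) _ xa) -EFinM -EFinD lee_fin.
Qed.

Let f0 := level_fun I w f.
Let wf := inverse_level_fun I w f.
Let hI0 := hI_ge0 a w f a0 hw hW hfin hgrow.
Let hId := hI_antimono a w f a0 hw hW hfin hgrow.

Lemma inverse_level_weight : decreasing_weight I wf.
Proof.
split; first exact: (wf_gt0 a w f a0 hw hW hfin hgrow).
exact: (wf_antimono a w f a0 hw hW hfin hgrow).
Qed.

Lemma inverse_level_submajorized : submajorized I wf w.
Proof.
have [wf0 wfd] := inverse_level_weight; have [w0 wd] := hw.
move=> x Ix; have [x0 xa] := Ix.
rewrite (integral_rearrangement_decreasing a wf)//; last by move=> t /wf0 /ltW.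
rewrite (integral_rearrangement_decreasing a w)//; last by move=> t /w0 /ltW.
rewrite [leRHS](integral_wIE a w _ _ (lexx _) (ltW xa)).
exact: (integral_wf_le a w f a0 hw hW hfin hgrow).
Qed.

Let level_fun_hI t : I t -> ~ jumps I (fI a f) t -> f0 t = hI a w f t.
Proof.
by move=> It nj; rewrite hIE//; exact: (level_funE a w f a0 hw hW hfin hgrow).
Qed.

Let rearrangement_level_fun (l : R) :
  rearrangement I (fun x => l * f0 x)%R = rearrangement I (fun x => l * hI a w f x)%R.
Proof.
apply: (rearrangement_countable _ _ _ _ (countable_jumps I (fI a f))) => t It nj.
by rewrite level_fun_hI.
Qed.

Lemma modular_level_fun (l : R) : (0 < l)%R ->
  modular phi I w (fun x => l * f0 x)%R =
  \int[mu]_(t in I) (phi (l * slp a w f t) * w t)%:E.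
Proof.
move=> l0; rewrite (modular_ae a phi ophi w _ (fun x => l * hI a w f x)%R hw) //.
- apply: eq_integral => t /set_mem It; rewrite hIE//.
  by rewrite mulrA mulfK// gt_eqF//; exact: hw.1.
- by move=> t _; rewrite mulr_ge0// ltW.
- by move=> s t Is It st; rewrite ler_pM2l//; exact: hId.
- apply: measurable_perspective => //; last by move=> t _; rewrite mulr_ge0// ltW.
  apply: measurable_funM; first exact: measurable_cst.
  exact: (measurable_hI a w f a0 hw hW hfin hgrow).
Qed.

Let modular1 g v : modular phi I v g = modular phi I v (fun x => 1 * g x)%R.
Proof. by congr (modular _ _ _ _); apply/funext => x; rewrite mul1r. Qed.

Lemma modular_level_fun_le g (l : R) : (0 < l)%R -> submajorized I f g ->
  M_class phi I w g ->
  modular phi I w (fun x => l * f0 x)%R <= modular phi I w (fun x => l * g x)%R.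
Proof.
move=> l0 fg cg; rewrite modular_level_fun//.
have gfin := finite_majorized g g cg (fun x _ => lexx _).
have -> : modular phi I w (fun x => l * g x)%R =
    \int[mu]_(t in I) ((fun s => phi (l * s)) (fI a g t / w t) * w t)%:E.
  apply: eq_integral => t /set_mem It.
  by rewrite rearrangementM// (rearrangement_fin a g gfin)// -!EFinM/= mulrA.
apply: (modular_lower_bound a w f a0 hw hW hfin hgrow (fun s => phi (l * s)%R) (fI a g) w).
- exact: orlicz_scale.
- exact: measurable_antimonoR (fI_antimono a g gfin).
- by move=> t _; exact: fI_ge0.
- exact: hw.
- move=> x Ix; have xa := ltW Ix.2.
  rewrite -(integral_fIE a f hfin _ _ (lexx _) xa) -(integral_fIE a g gfin _ _ (lexx _) xa).
  exact: fg.
- by move=> x Ix; rewrite (integral_wIE a w _ _ (lexx _) (ltW Ix.2)).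
Qed.

Lemma submajorized_level_fun : submajorized I f f0.
Proof.
move=> x Ix; have xa := ltW Ix.2.
have -> : rearrangement I f0 = rearrangement I (hI a w f).
  exact: (rearrangement_countable _ _ _ _ (countable_jumps I (fI a f)) level_fun_hI).
rewrite (integral_rearrangement_decreasing a (hI a w f))//.
rewrite (integral_fIE a f hfin _ _ (lexx _) xa).
exact: (integral_fI_le_hI a w f a0 hw hW hfin hgrow).
Qed.

(** [f0] agrees with the decreasing [hI] off a countable set, so its preimages differ from Borel
    sets by countable ones. *)
Lemma measurable_level_fun : L0 I f0.
Proof.
have mI := measurable_oitv 0%R a.
have mh := measurable_hI a w f a0 hw hW hfin hgrow.
move=> _ Y mY.
set N := jumps I (fI a f).
have cN : countable N by exact: countable_jumps.
have -> : I `&` f0 @^-1` Y =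
    (I `&` (hI a w f) @^-1` Y) `\` N `|` (I `&` f0 @^-1` Y) `&` N.
  apply/seteqP; split => t.
    move=> [It Yt]; have [Nt|Nt] := pselect (N t); first by right.
    by left; split => //; split => //=; rewrite /= -level_fun_hI.
  move=> [[[It Yt] nNt]|[] //]; split => //=.
  by rewrite level_fun_hI.
apply: sub_caratheodory; apply: measurableU.
  apply: measurableD; first exact: mh.
  exact: countable_measurable.
have cS : countable ((I `&` f0 @^-1` Y) `&` N).
  by apply: (@sub_countable _ _ _ N) => //; apply: subset_card_le => t [].
exact: countable_measurable cS.
Qed.

(** A multiplier that works for a majorant [g] works for [f0]. *)
Lemma M_class_level_fun : M_class phi I w f0.
Proof.
split; first exact: measurable_level_fun.
have [_ [g cg fg]] := hf; have [_ [l l0 fin]] := cg.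
exists l; first exact: l0.
exact: (le_lt_trans (modular_level_fun_le g l l0 fg cg) fin).
Qed.

Lemma Q_modularE : Q_modular phi I w f = modular phi I w f0.
Proof.
apply/le_anti/andP; split.
  apply: ereal_inf_lbound.
  exact: (ex_intro2 _ _ f0 (conj submajorized_level_fun M_class_level_fun) erefl).
apply: le_ereal_inf_tmp => _ [g [fg cg] <-].
rewrite (modular1 f0) (modular1 g).
exact: (modular_level_fun_le g 1%R ltr01 fg cg).
Qed.

Let modular_f v : modular phi I v f = \int[mu]_(t in I) (phi (fI a f t / v t) * v t)%:E.
Proof.
apply: eq_integral => t /set_mem It.
by rewrite (rearrangement_fin a f hfin)// -EFinM.
Qed.

Lemma P_modular_ge v : decreasing_weight I v -> submajorized I v w ->
  modular phi I w f0 <= modular phi I v f.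
Proof.
move=> hv vw; rewrite (modular1 f0) (modular_level_fun 1%R ltr01) modular_f.
under eq_integral do rewrite mul1r.
apply: (modular_lower_bound a w f a0 hw hW hfin hgrow phi (fI a f) v ophi).
- exact: measurable_antimonoR (fI_antimono a f hfin).
- by move=> t _; exact: fI_ge0.
- exact: hv.
- by [].
- have [v0 vd] := hv; have [w0 wd] := hw.
  move=> x Ix; have := vw x Ix.
  rewrite (integral_rearrangement_decreasing a v)//; last by move=> t /v0 /ltW.
  rewrite (integral_rearrangement_decreasing a w)//; last by move=> t /w0 /ltW.
  by rewrite [leRHS](integral_wIE a w _ _ (lexx _) (ltW Ix.2)).
Qed.

(** One inequality is the lower bound with [v = w^f]. For the other, the integrand is [k f^*] off
    jumps and Hardy's lemma replaces [f^*] by [slp w]. *)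
Lemma modular_inverse_level_fun : modular phi I wf f = modular phi I w f0.
Proof.
have [wf0 wfd] := inverse_level_weight.
apply/le_anti/andP; split; last first.
  by apply: P_modular_ge; [exact: inverse_level_weight|exact: inverse_level_submajorized].
have s0 := slp_ge0 a w f a0 hw hW hfin hgrow.
have sd := slp_antimono a w f a0 hw hW hfin hgrow.
have mf := measurable_antimonoR a _ (fI_antimono a f hfin).
(* [phi s / s] increases, by convexity and [phi 0 = 0], and the slope decreases. Where the slope is
   0, division by 0 yields [k t = 0], as monotonicity requires. *)
pose k t := (phi (slp a w f t) / slp a w f t)%R.
have k0 t : I t -> (0 <= k t)%R.
  by move=> It; rewrite divr_ge0 ?s0// (orlicz_ge0 _ ophi)// s0.
have dk s t : I s -> I t -> (s <= t)%R -> (k t <= k s)%R.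
  move=> Is It st; rewrite /k; have := sd s t Is It st; have := s0 t It.
  move: (slp a w f s) (slp a w f t) => p q; rewrite le_eqVlt => /predU1P[<- p0|q0 qp].
    by rewrite (orlicz0 _ ophi) mul0r divr_ge0// (orlicz_ge0 _ ophi).
  have p0 := lt_le_trans q0 qp.
  rewrite ler_pdivrMr// mulrAC ler_pdivlMr//.
  have := orlicz_convex _ ophi 0%R q p (lexx _) (ltW q0) qp.
  by rewrite (orlicz0 _ ophi) !subr0 mulr0 add0r => h; rewrite mulrC [leRHS]mulrC.
have mk := measurable_antimonoR a k dk.
have mh := measurable_hI a w f a0 hw hW hfin hgrow.
rewrite modular_f (modular1 f0) (modular_level_fun 1%R ltr01).
apply: (@le_trans _ _ (\int[mu]_(t in I) (k t * fI a f t)%:E)).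
  apply: ae_ge0_le_integral.
  - exact: measurable_oitv.
  - move=> t It; rewrite lee_fin mulr_ge0//; last exact/ltW/wf0.
    by apply: (orlicz_ge0 _ ophi); rewrite divr_ge0 ?fI_ge0//; exact/ltW/wf0.
  - apply/measurable_EFinP.
    apply: (measurable_perspective a phi (fI a f) wf ophi inverse_level_weight mf).
    by move=> t _; exact: fI_ge0.
  - by move=> t It; rewrite lee_fin mulr_ge0 ?k0 ?fI_ge0.
  - by apply/measurable_EFinP; exact: measurable_funM.
  apply: (ae_not_jumps a (fI a f)) => t nj It; rewrite lee_fin /k.
  have [lv|nl] := pselect (leveled a w f t).
    have sp := leveled_slp_gt0 a w f a0 hw hW hfin hgrow t lv.
    have fp := leveled_fI_gt0 a w f a0 hw hW hfin hgrow t lv.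
    rewrite /wf (wf_leveled a w f a0 hw hW hfin hgrow)//.
    have -> : (fI a f t / (fI a f t / slp a w f t) = slp a w f t)%R.
      by rewrite invf_div mulrC divfK// gt_eqF.
    by rewrite [X in (_ * X)%R]mulrC mulrA.
  have wt := hw.1 t It.
  rewrite /wf wf_unleveled// (unleveled_slope a w f a0 hw hW hfin hgrow)//.
  rewrite mulfK ?gt_eqF//; have [->|sn] := eqVneq (slp a w f t) 0%R.
    by rewrite (orlicz0 _ ophi) !mul0r.
  by rewrite mulrA divfK.
apply: (@le_trans _ _ (\int[mu]_(t in I) (k t * hI a w f t)%:E)).
  apply: (hardy a a0 k) => //; first by move=> t _; exact: fI_ge0.
  exact: (integral_fI_le_hI a w f a0 hw hW hfin hgrow).
rewrite le_eqVlt; apply/orP; left; apply/eqP.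
apply: eq_integral => t /set_mem It; rewrite hIE// /k mul1r.
have [->|sn] := eqVneq (slp a w f t) 0%R; first by rewrite (orlicz0 _ ophi) !mul0r.
by rewrite mulrA divfK.
Qed.

Lemma P_modularE : P_modular phi I w f = modular phi I wf f.
Proof.
apply/le_anti/andP; split.
  apply: ereal_inf_lbound.
  exact: (ex_intro2 _ _ wf (conj inverse_level_weight inverse_level_submajorized) erefl).
rewrite modular_inverse_level_fun.
by apply: le_ereal_inf_tmp => _ [v [hv vw] <-]; exact: P_modular_ge.
Qed.

(** [Q] ranges over the class only, the norms over all majorants in [L0]; a majorant outside the
    class has infinite modular, since otherwise the multiplier 1 would put it in. *)
Lemma Q_modular_le g : L0 I g -> submajorized I f g ->
  Q_modular phi I w f <= modular phi I w g.
Proof.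
move=> mg fg; have [fin|] := ltP (modular phi I w g) +oo; last first.
  by rewrite leye_eq => /eqP ->; rewrite leey.
have cg : M_class phi I w g.
  split; first exact: mg.
  by exists 1%R; [exact: ltr01|rewrite -(modular1 g)].
apply: ereal_inf_lbound.
exact: (ex_intro2 _ _ g (conj fg cg) erefl).
Qed.

End core.

(** * The Luxemburg and Orlicz norms *)

Section norms.
Context {R : realType}.
Variables (a : \bar R) (phi w f : R -> R).
Local Open Scope ereal_scope.
Local Notation mu := (@lebesgue_measure R).
Local Notation I := (oitv 0%R a).

Hypothesis a0 : 0 < a.
Hypothesis ophi : orlicz phi.
Hypothesis hw : decreasing_weight I w.
Hypothesis hW : forall t, I t -> \int[mu]_(s in oitv 0%R t%:E) (w s)%:E < +oo.
Hypothesis hf : M_space phi I w f.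

Let divE (g : R -> R) (l : R) : (fun x => g x / l)%R = (fun x => l^-1 * g x)%R.
Proof. by apply/funext => x; rewrite mulrC. Qed.

Let space_div (l : R) : (0 < l)%R -> M_space phi I w (fun x => f x / l)%R.
Proof. by move=> l0; rewrite divE; apply: M_space_scale => //; rewrite invr_gt0. Qed.

Let PQ (l : R) : (0 < l)%R ->
  P_modular phi I w (fun x => f x / l)%R = Q_modular phi I w (fun x => f x / l)%R.
Proof.
move=> l0; rewrite (P_modularE a phi w _ a0 ophi hw hW (space_div l l0)).
rewrite (modular_inverse_level_fun a phi w _ a0 ophi hw hW (space_div l l0)).
by rewrite (Q_modularE a phi w _ a0 ophi hw hW (space_div l l0)).
Qed.

(** The level function of [f / l] attains [Q]; multiplied by [l] it becomes a majorant of [f]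
    itself, as the norms require. *)
Let optimal (l : R) : (0 < l)%R -> exists g, [/\ L0 I g, submajorized I f g &
  modular phi I w (fun x => g x / l)%R = Q_modular phi I w (fun x => f x / l)%R].
Proof.
move=> l0; have sp := space_div l l0.
pose h := level_fun I w (fun x => f x / l)%R.
exists (fun x => l * h x)%R; split.
- by apply: L0_scale; exact: (measurable_level_fun a phi w _ a0 ophi hw hW sp).
- have -> : f = (fun x => l * (f x / l))%R.
    by apply/funext => x; rewrite mulrC divfK// gt_eqF.
  exact: (submajorized_scale a _ _ l l0 (submajorized_level_fun a phi w _ a0 ophi hw hW sp)).
- rewrite (Q_modularE a phi w _ a0 ophi hw hW sp); congr (modular _ _ _ _).
  by apply/funext => x; rewrite mulrAC divff ?mul1r// gt_eqF.
Qed.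

Let Q_div_le g (l : R) : (0 < l)%R -> L0 I g -> submajorized I f g ->
  Q_modular phi I w (fun x => f x / l)%R <= modular phi I w (fun x => g x / l)%R.
Proof.
move=> l0 mg fg; apply: (Q_modular_le a phi w _).
  by rewrite divE; exact: L0_scale.
rewrite !divE; apply: (submajorized_scale a _ _ l^-1%R _ fg).
by rewrite invr_gt0.
Qed.

Lemma luxemburg_PQ : luxemburg (P_modular phi I w) f = luxemburg (Q_modular phi I w) f.
Proof.
apply: (congr1 (@ereal_inf R)); apply/seteqP.
split => _ [l [l0 h] <-]; (exists l; last by []); (split; first exact: l0).
  by rewrite -(PQ l l0); exact: h.
by rewrite (PQ l l0); exact: h.
Qed.

Lemma amemiya_PQ : amemiya (P_modular phi I w) f = amemiya (Q_modular phi I w) f.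
Proof.
apply: (congr1 (@ereal_inf R)); apply/seteqP.
by split => _ [t t0 <-]; (exists t; first exact: t0); rewrite (PQ t t0).
Qed.

(** Because [Q] is attained, an [l] admissible for [Q] is admissible for the modular of a single
    majorant, so nothing is lost between an infimum of modulars and an infimum of norms. *)
Lemma M_norm_luxemburg : M_norm phi I w f = luxemburg (Q_modular phi I w) f.
Proof.
apply/le_anti/andP; split.
  apply: le_ereal_inf_tmp => _ [l [l0 h] <-].
  have [g [mg fg E]] := optimal l l0.
  apply: (@le_trans _ _ (luxemburg (modular phi I w) g)).
    exact: (ereal_inf_lbound (ex_intro2 _ _ g (conj mg fg) erefl)).
  have El : modular phi I w (fun x => g x / l)%R <= 1 by rewrite E.
  exact: (ereal_inf_lbound (ex_intro2 _ _ l (conj l0 El) erefl)).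
apply: le_ereal_inf_tmp => _ [g [mg fg] <-].
apply: le_ereal_inf_tmp => _ [l [l0 h] <-].
exact: (ereal_inf_lbound (ex_intro2 _ _ l (conj l0 (le_trans (Q_div_le g l l0 mg fg) h)) erefl)).
Qed.

Lemma M_norm0_amemiya : M_norm0 phi I w f = amemiya (Q_modular phi I w) f.
Proof.
apply/le_anti/andP; split.
  apply: le_ereal_inf_tmp => _ [t t0 <-].
  have [g [mg fg E]] := optimal t t0.
  apply: (@le_trans _ _ (amemiya (modular phi I w) g)).
    exact: (ereal_inf_lbound (ex_intro2 _ _ g (conj mg fg) erefl)).
  by rewrite -E; exact: (ereal_inf_lbound (ex_intro2 _ _ t t0 erefl)).
apply: le_ereal_inf_tmp => _ [g [mg fg] <-].
apply: le_ereal_inf_tmp => _ [t t0 <-].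
apply: (@le_trans _ _ (t%:E * (1 + Q_modular phi I w (fun x => f x / t)%R))).
  exact: (ereal_inf_lbound (ex_intro2 _ _ t t0 erefl)).
apply: lee_wpmul2l; first by rewrite lee_fin ltW.
by apply: leeD; [exact: lexx|exact: Q_div_le].
Qed.

End norms.

Local Open Scope ereal_scope.

Theorem theorem8p9 (R : realType) (a : \bar R) (phi w : R -> R)
    (ha : 0 < a)
    (hphi : orlicz phi)
    (hw : decreasing_weight (oitv 0 a) w)
    (hW : forall t, oitv 0 a t ->
       \int[lebesgue_measure]_(s in oitv 0 t%:E) (w s)%:E < +oo)
    (f : R -> R) (hf : M_space phi (oitv 0 a) w f) :
  let I := oitv 0 a in
  let M := modular phi I in
  let P := P_modular phi I w in
  let Q := Q_modular phi I w in
  let f0 := level_fun I w f in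
  let wf := inverse_level_fun I w f in
  [/\ [/\ Q f = M w f0, M w f0 = M wf f & P f <= M wf f],
      M_norm phi I w f = luxemburg P f /\ luxemburg P f = luxemburg Q f,
      M_norm0 phi I w f = amemiya P f /\ amemiya P f = amemiya Q f
    & N_function phi ->
      a < +oo \/ (a = +oo /\ \int[lebesgue_measure]_(s in I) (w s)%:E = +oo) ->
      P f = M w f0 /\ M w f0 = Q f].

Proof.
move=> I M P Q f0 wf.
have hQ : Q f = M w f0 := Q_modularE a phi w f ha hphi hw hW hf.
have hP : P f = M wf f := P_modularE a phi w f ha hphi hw hW hf.
have hM : M wf f = M w f0 := modular_inverse_level_fun a phi w f ha hphi hw hW hf.
split.
- by split; [exact: hQ|rewrite hM|rewrite hP].
- split; last exact: (luxemburg_PQ a phi w f ha hphi hw hW hf).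
  rewrite (M_norm_luxemburg a phi w f ha hphi hw hW hf).
  by rewrite -(luxemburg_PQ a phi w f ha hphi hw hW hf).
- split; last exact: (amemiya_PQ a phi w f ha hphi hw hW hf).
  rewrite (M_norm0_amemiya a phi w f ha hphi hw hW hf).
  by rewrite -(amemiya_PQ a phi w f ha hphi hw hW hf).
- by move=> _ _; rewrite hP hM hQ.
Qed.
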